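(* Let $d,L,N,n\ge 1$ and $p\ge 1$ be integers, let $R>0$, and let $\mu^1,\dots,\mu^L\in\mathcal M_1(\mathbb B_R)$. For each $\ell\in\{1,\dots,L\}$ let $X_1^\ell,\dots,X_n^\ell$ be i.i.d. random variables with law $\mu^\ell$, and let $\mu_n^\ell=\frac1n\sum_{i=1}^n\delta_{X_i^\ell}$. Let $A$ be a closed nonempty subset of $\mathbb B_R^N\times\Delta_N$, and let $\mathbb D$ be one of $W_p^p$, $W_{\epsilon,p}^p$ (for some $\epsilon>0$), $SW_p^p$, $\text{max-}SW_p^p$. Let $(Y_n,\pi_n)$, with $Y_n=(y_1^n,\dots,y_N^n)$ and $\pi_n=(\pi_1^n,\dots,\pi_N^n)$, be a minimizer over $A$ of $(Y,\pi)\mapsto F_{\mathbb D}\big(\mu_n^1,\dots,\mu_n^L,\sum_{i=1}^N\pi_i\delta_{y_i}\big)$. Then $$\mathbb E\left[F_{\mathbb D}\Big(\mu^1,\dots,\mu^L,\sum_{i=1}^N\pi_i^n\delta_{y_i^n}\Big)-\min_{(Y,\pi)\in A}F_{\mathbb D}\Big(\mu^1,\dots,\mu^L,\sum_{i=1}^N\pi_i\delta_{y_i}\Big)\right]\le 2C_{p,R}\sqrt{\frac{C_{d,N}}{n}},$$ where the constants are as follows. (i) If $\mathbb D=W_p^p$: $C_{p,R}=8\sqrt2\int_0^{2(2R)^p}\sqrt{\log\left(2+\frac{32pR^p}{\tau}\right)}\,d\tau$ and $C_{d,N}=N(d+1)$. (ii) If $\mathbb D=SW_p^p$ or $\mathbb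 D=\text{max-}SW_p^p$: $C_{p,R}=8\sqrt2\int_0^{2(2R)^p}\sqrt{\log\left(2+\frac{48pR^p}{\tau}\right)}\,d\tau$ and $C_{d,N}=N(d+1)+d$. (iii) If $\mathbb D=W_{\epsilon,p}^p$: $C_{p,R}=8\sqrt2\int_0^{(4p+1)(2R)^p}\sqrt{\log\left(2+\frac{64p(2R)^p}{\tau}\right)}\,d\tau$ and $C_{d,N}=N(d+1)$.
   Context: $\|\cdot\|$ is the Euclidean norm on $\mathbb R^d$, $\mathbb B_R$ is the closed ball of $\mathbb R^d$ centered at $0$ with radius $R$, $\mathcal M_1(\Omega)$ is the set of probability measures on $\Omega\subset\mathbb R^d$, $\Delta_N=\{\pi\in[0,1]^N:\sum_i\pi_i=1\}$ is the probability simplex, and $\mathbb S^{d-1}$ is the unit sphere of $\mathbb R^d$. $\Pi(\mu,\nu)$ denotes the set of probability measures on $\mathbb R^d\times\mathbb R^d$ with marginals $\mu,\nu$. For $(Y,\pi)$ we write $Y=(y_1,\dots,y_N)$, $\pi=(\pi_1,\dots,\pi_N)$. Divergences, for $\mu,\nu\in\mathcal M_1(\mathbb R^d)$: - $W_p^p(\mu,\nu)=\inf_{\gamma\in\Pi(\mu,\nu)}\int\|x-y\|^p\,d\gamma(x,y)$ (and likewise on $\mathbb R$, with cost $|x-y|^p$). - $W_{\epsilon,p}^p(\mu,\nu)=\inf_{\gamma\in\Pi(\mu,\nu)}\int\|x-y\|^p\,d\gamma(x,y)+\epsilon\,\mathrm{KL}(\gamma|\mu\otimes\nu)$, where $\mathrm{KL}(\gamma|\xi)=\int_{\mathbb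 R^d\times\mathbb R^d}\left(\log\left(\frac{d\gamma}{d\xi}(x,y)\right)-1\right)d\gamma(x,y)$ if $\gamma\ll\xi$ and $+\infty$ otherwise. - With $P_\theta(x)=\langle\theta,x\rangle$, $P_{\theta\sharp}\mu$ the pushforward, and $\sigma$ the uniform probability measure on $\mathbb S^{d-1}$: $SW_p^p(\mu,\nu)=\int_{\mathbb S^{d-1}}W_p^p(P_{\theta\sharp}\mu,P_{\theta\sharp}\nu)\,d\sigma(\theta)$ and $\text{max-}SW_p^p(\mu,\nu)=\max_{\theta\in\mathbb S^{d-1}}W_p^p(P_{\theta\sharp}\mu,P_{\theta\sharp}\nu)$. Barycenter functional: $F_{\mathbb D}(\mu^1,\dots,\mu^L,\nu)=\frac1L\sum_{\ell=1}^L\mathbb D(\mu^\ell,\nu)$. *)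

(* Defs.v *)
From HB Require Import structures.
From mathcomp Require Import all_boot all_order all_algebra.
From mathcomp Require Import all_classical all_reals all_analysis.

Set Implicit Arguments.
Unset Strict Implicit.
Unset Printing Implicit Defensive.

Import Order.TTheory GRing.Theory Num.Theory.
Import numFieldNormedType.Exports.

Local Open Scope classical_set_scope.
Local Open Scope ring_scope.

(* 'rV[R]_d carries a topology in the library but no sigma-algebra; [euclidean]
   is the same type equipped with its Borel sigma-algebra. *)
Definition euclidean (R : realType) (d : nat) :=
  g_sigma_algebraType (@open 'rV[R]_d).

(* The library norm on 'rV[R]_d is the sup norm. *)
Definition enorm (R : realType) (d : nat) (x : 'rV[R]_d) : R :=
  Num.sqrt (\sum_(i < d) x 0 i ^+ 2).

Definition eball (R : realType) (d : nat) (r : R) : set 'rV[R]_d :=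
  [set x | enorm x <= r].
Arguments eball {R d} r.

Definition esphere (R : realType) (d : nat) : set 'rV[R]_d :=
  [set x | enorm x = 1].
Arguments esphere {R d}.

Definition simplex (R : realType) (N : nat) : set 'rV[R]_N :=
  [set w | (forall i, 0 <= w 0 i <= 1) /\ \sum_(i < N) w 0 i = 1].
Arguments simplex {R N}.

Section discrete_measure.
Context {R : realType} {disp : measure_display} {T : measurableType disp}.
Context {N : nat}.
Local Open Scope ereal_scope.

(* \sum_i w_i \d_(y_i). Outside of the simplex this is an arbitrary Dirac mass,
   so that a probability measure is obtained for all arguments. *)
Definition discrete_measure (w : 'rV[R]_N) (y : 'I_N -> T) (B : set T)
    : \bar R :=
  if w \in simplex then \sum_(i < N) (w ord0 i)%:E * \d_(y i) B
  else \d_(point : T) B.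

Variables (w : 'rV[R]_N) (y : 'I_N -> T).

Let m0 : discrete_measure w y set0 = 0.
Proof.
rewrite /discrete_measure; case: ifP => _; last exact: measure0.
by rewrite big1// => i _; rewrite measure0 mule0.
Qed.

Let m_ge0 B : 0 <= discrete_measure w y B.
Proof.
rewrite /discrete_measure; case: ifPn => [|_]; last exact: measure_ge0.
rewrite inE => -[w01 _]; apply: sume_ge0 => i _.
by apply: mule_ge0; [rewrite lee_fin; case/andP: (w01 i)|exact: measure_ge0].
Qed.

Let m_sigma_additive : semi_sigma_additive (discrete_measure w y).
Proof.
have [ws|ws] := boolP (w \in simplex); last first.
  rewrite (_ : discrete_measure w y = \d_(point : T)).
    exact: measure_semi_sigma_additive.
  by apply/funext => B; rewrite /discrete_measure (negbTE ws).
have [w01 _] := set_mem ws.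
pose c i : {nonneg R} := NngNum (proj1 (andP (w01 i))).
rewrite (_ : discrete_measure w y =
    fun B => \sum_(i < N) mscale (c i) \d_(y i) B); last first.
  by apply/funext => B; rewrite /discrete_measure ws.
move=> F mF tF mUF.
rewrite (_ : (fun n => _) = fun n =>
    \sum_(i < N) \sum_(0 <= k < n) mscale (c i) \d_(y i) (F k)); last first.
  by apply/funext => n; rewrite exchange_big.
apply: cvg_nnesum => [i _|i _].
  by apply: nearW => n; apply: sume_ge0.
exact: (@measure_semi_sigma_additive _ _ _ (mscale (c i) \d_(y i)) F).
Qed.

HB.instance Definition _ := isMeasure.Build _ _ _ (discrete_measure w y)
  m0 m_ge0 m_sigma_additive.

Let m_setT : discrete_measure w y setT = 1.
Proof.
rewrite /discrete_measure; case: ifPn => [|_]; last exact: probability_setT.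
rewrite inE => -[_ w1]; under eq_bigr do rewrite diracT mule1.
by rewrite sumEFin w1.
Qed.

HB.instance Definition _ := Measure_isProbability.Build _ _ _
  (discrete_measure w y) m_setT.

End discrete_measure.

Section transport.
Context {R : realType}.
Local Open Scope ereal_scope.

Definition coupling d1 d2 (T1 : measurableType d1) (T2 : measurableType d2)
    (mu : probability T1 R) (nu : probability T2 R) :
    set (probability (T1 * T2)%type R) :=
  [set g | (forall B, measurable B -> g (B `*` setT) = mu B) /\
           (forall B, measurable B -> g (setT `*` B) = nu B)].

(* Since g has mass 1, this is the usual relative entropy minus 1. *)
Definition KL d (T : measurableType d) (g xi : probability T R) : \bar R :=
  if `[< g `<< xi >] then
    \int[g]_z (lne (Radon_Nikodym (charge_of_finite_measure g) xi z) - 1)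
  else +oo.

Definition transport_cost d (T : measurableType d) (c : T * T -> R)
    (mu nu : probability T R) : \bar R :=
  ereal_inf [set \int[g]_z (c z)%:E | g in coupling mu nu].

Definition entropic_cost d (T : measurableType d) (c : T * T -> R) (eps : R)
    (mu nu : probability T R) : \bar R :=
  ereal_inf [set \int[g]_z (c z)%:E
                 + eps%:E * KL g (mu \x nu)
            | g in coupling mu nu].

Definition Wpp (d p : nat) : probability (euclidean R d) R ->
    probability (euclidean R d) R -> \bar R :=
  @transport_cost _ (euclidean R d)
    (fun z => enorm ((z.1 : 'rV[R]_d) - (z.2 : 'rV[R]_d)) ^+ p)%R.

Definition Wpp_real (p : nat) : probability R R -> probability R R -> \bar R :=
  @transport_cost _ R (fun z => `|z.1 - z.2| ^+ p)%R.

Definition Wepp (d p : nat) : R -> probability (euclidean R d) R ->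
    probability (euclidean R d) R -> \bar R :=
  @entropic_cost _ (euclidean R d)
    (fun z => enorm ((z.1 : 'rV[R]_d) - (z.2 : 'rV[R]_d)) ^+ p)%R.

End transport.

Section sliced.
Context {R : realType} {d : nat}.

Definition proj (theta : 'rV[R]_d) (x : euclidean R d) : R :=
  \sum_(i < d) theta 0 i * (x : 'rV[R]_d) 0 i.

Lemma measurable_coord (i : 'I_d) :
  measurable_fun setT (fun x : euclidean R d => (x : 'rV[R]_d) 0 i).
Proof.
apply: (measurability _ (measurable_realfun.RGenOpens.measurableE R)).
move=> _ [_ [a [b ->] <-]]; rewrite setTI; apply: sub_sigma_algebra.
apply: open_comp; last exact: interval_open.
by move=> x _; exact: coord_continuous.
Qed.

Lemma measurable_proj (theta : 'rV[R]_d) : measurable_fun setT (proj theta).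
Proof.
apply: measurable_sum => i; apply: measurable_realfun.measurable_funM => //.
exact: measurable_coord.
Qed.

HB.instance Definition _ (theta : 'rV[R]_d) :=
  isMeasurableFun.Build _ _ _ _ (proj theta) (measurable_proj theta).

(* The uniform probability measure on the sphere is the rotation-invariant
   one; row vectors are transformed by right multiplication. *)
Definition uniform_on_sphere (sigma : probability (euclidean R d) R) : Prop :=
  sigma esphere = 1%E /\
  forall (O : 'M[R]_d) (B : set (euclidean R d)),
    O *m O^T = 1%:M -> measurable B ->
    sigma [set x | B ((x : 'rV[R]_d) *m O)] = sigma B.

Local Open Scope ereal_scope.

Definition SWpp (sigma : probability (euclidean R d) R) (p : nat)
    (mu nu : probability (euclidean R d) R) : \bar R :=
  \int[sigma]_(theta in esphere)
    Wpp_real p (distribution mu (proj theta)) (distribution nu (proj theta)).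

Definition max_SWpp (p : nat) (mu nu : probability (euclidean R d) R) :
    \bar R :=
  ereal_sup [set Wpp_real p (distribution mu (proj theta))
                            (distribution nu (proj theta))
            | theta in esphere].

End sliced.

Inductive divergence (R : realType) (d : nat) :=
| Wasserstein
| EntropicWasserstein (eps : R) of 0 < eps
| SlicedWasserstein (sigma : probability (euclidean R d) R)
    of uniform_on_sphere sigma
| MaxSlicedWasserstein.

Section barycenter.
Context {R : realType} {d : nat}.

Definition div_pp (D : divergence R d) (p : nat) :
    probability (euclidean R d) R -> probability (euclidean R d) R -> \bar R :=
  match D with
  | Wasserstein => Wpp p
  | EntropicWasserstein eps _ => Wepp p eps
  | SlicedWasserstein sigma _ => SWpp sigma p
  | MaxSlicedWasserstein => max_SWpp p
  end.

Definition barycenter_fun (D : divergence R d) (p L : nat)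
    (mu : 'I_L -> probability (euclidean R d) R)
    (nu : probability (euclidean R d) R) : \bar R :=
  ((L%:R^-1)%:E * \sum_(l < L) div_pp D p (mu l) nu)%E.

(* In a pair (Y, w), the N points of Y are the rows of a matrix. *)
Definition atoms (N : nat) (a : 'M[R]_(N, d) * 'rV[R]_N) :
    probability (euclidean R d) R :=
  discrete_measure a.2 (fun i => row i a.1 : euclidean R d).

Definition empirical (n : nat) (x : 'I_n -> euclidean R d) :
    probability (euclidean R d) R :=
  discrete_measure (const_mx n%:R^-1) x.

Definition parameter_set (N : nat) (r : R) : set ('M[R]_(N, d) * 'rV[R]_N) :=
  [set a | (forall i, eball r (row i a.1)) /\ simplex a.2].

Definition log_integral (b K : R) : R :=
  \int[lebesgue_measure]_(t in `]0, b]) Num.sqrt (ln (2 + K / t)).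

Definition C_pR (D : divergence R d) (p : nat) (r : R) : R :=
  8 * Num.sqrt 2 *
  match D with
  | Wasserstein =>
      log_integral (2 * (2 * r) ^+ p) (32 * p%:R * r ^+ p)
  | SlicedWasserstein _ _ | MaxSlicedWasserstein =>
      log_integral (2 * (2 * r) ^+ p) (48 * p%:R * r ^+ p)
  | EntropicWasserstein _ _ =>
      log_integral ((4 * p%:R + 1) * (2 * r) ^+ p)
                   (64 * p%:R * (2 * r) ^+ p)
  end.

Definition C_dN (D : divergence R d) (N : nat) : nat :=
  match D with
  | Wasserstein | EntropicWasserstein _ _ => (N * (d + 1))%N
  | SlicedWasserstein _ _ | MaxSlicedWasserstein => (N * (d + 1) + d)%N
  end.

End barycenter.

Definition minimizer (T : Type) (R : realType) (A : set T) (f : T -> \bar R)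
    (a : T) : Prop :=
  A a /\ forall b, A b -> (f a <= f b)%E.

Definition mutually_independent (R : realType) (dO dT : measure_display)
    (Omega : measurableType dO) (T : measurableType dT)
    (P : probability Omega R) (n : nat) (X : 'I_n -> {RV P >-> T}) : Prop :=
  forall (J : {set 'I_n}) (B : 'I_n -> set T), (forall i, measurable (B i)) ->
    P (\bigcap_(i in [set` J]) (X i @^-1` B i)) =
    (\prod_(i in J) P (X i @^-1` B i))%E.

(* Main.v *)
(* For a discrete second marginal, the optimal transport cost and the entropic
   cost are given by duality over the potentials of the N atoms (a maximizer
   exists for the entropic cost, by a Sinkhorn step argument, and the transport
   cost is the limit eps -> 0). Hence D(mu, nu) - D(mu', nu) is at most the
   supremum of the integrals against mu - mu' of functions from a class that
   does not depend on the weights of nu: minima of N shifted costs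
   min_i (c(., y_i) - psi_i) for the transport costs, soft minima of N costs for
   the entropic one. The excess risk is therefore bounded by two suprema of
   empirical deviations over these classes, one for each sign, and their means
   are estimated by chaining.

   The entropy integral C_pR is only used through the lower bound
   b * sqrt (ln 2), so for the transport costs the chaining estimate must not
   deteriorate with p. With distances rescaled to [0, 1], a cost of size at least
   delta forces |x - y| ^ p >= delta: for large p this makes x and y nearly
   antipodal, which confines y to a small ball around -x. So few cells of
   centers are relevant near a given sample point, and the maximal inequality
   only counts the chaining links that do not vanish at this point. *)
From HB Require Import structures.
Require Import Defs.
From mathcomp Require Import all_boot all_order all_algebra.
From mathcomp Require Import all_classical all_reals all_analysis.
From mathcomp Require Import measurable_realfun.
From mathcomp Require Import ring lra zify.

Set Implicit Arguments.
Unset Strict Implicit.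
Unset Printing Implicit Defensive.

Import Order.TTheory GRing.Theory Num.Theory.
Import numFieldNormedType.Exports.

Local Open Scope classical_set_scope.
Local Open Scope ring_scope.

(** * Counting lattice points *)

(** The constants leave a precise budget. With [M = (2 * r) ^ p], the bound
    [log_integral >= 2 * M * sqrt (ln 2)] makes [C_pR] at least [16 * sqrt 2 * M * sqrt (ln 2)] for
    the transport costs. For costs rescaled to [0, 1], chaining yields
    [4 * Y * sqrt (N * (d + 1) * ln 2 / n)] as soon as the entropy at scale [2 ^ - (k + 1)] is at
    most [N * (d + 1) * ln 2 * (a + b * k)] with [a + 2 * b <= Y ^ 2]. So these classes must satisfy
    [a + 2 * b <= 32], with no logarithm of [d], [N] or [p]: lattice points are counted in l1 balls,
    and the mesh of the cells shrinks with [p] at the same rate as the region that they fill. The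
    entropic constant has the factor [4 * p + 1], so there [a] may grow with [p], but nothing may
    depend on the temperature, which leads to a logarithmic discretization of the weights. Neither
    the minimizer nor the suprema over parameters are known to be measurable. Suprema are replaced
    by measurable majorants of controlled mean, and integrands of unknown measurability are only
    compared pointwise. *)

Lemma le_of_eq (disp : Order.disp_t) (T : porderType disp) (x y : T) :
  x = y -> (x <= y)%O.
Proof. by move=> ->. Qed.

Lemma expR1_le4 (R : realType) : expR 1 <= 4 :> R.
Proof.
have h : expR (2^-1 : R) <= 2.
  have : 2^-1 <= expR (- 2^-1 : R).
    by apply: le_trans (expR_ge1Dx _); lra.
  by rewrite expRN lef_pV2 ?posrE ?expR_gt0.
have -> : 1 = 2^-1 + 2^-1 :> R by lra.
rewrite expRD (le_trans (ler_pM _ _ h h)) ?expR_ge0//; lra.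
Qed.

Lemma expR_le_quadratic (R : realType) (u : R) :
  -1 <= u <= 1 -> expR u <= 1 + u + u ^+ 2.
Proof.
move=> /andP[u1 u2].
have [u0|u0] := leP u 0.
  have h : 1 - u <= expR (- u) by have := expR_ge1Dx (- u).
  have u3 : 0 < 1 - u by lra.
  have : expR u <= (1 - u)^-1.
    by rewrite -[X in expR X]opprK expRN lef_pV2 ?posrE ?expR_gt0.
  move=> /le_trans; apply; rewrite -[_^-1]mul1r ler_pdivrMr//; nra.
(* On [0, 1] the quotient [g] of the two sides is nondecreasing, and it is 1 at 0. *)
pose g (x : R) := (1 + x + x ^+ 2) * expR (- x).
have dg x : is_derive x (1 : R) g ((x - x ^+ 2) * expR (- x)).
  rewrite /g; apply: is_derive_eq; rewrite /GRing.scale/=; ring.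
have /(_ 0 u) H : {in `[0, 1] &, {homo g : x y / x <= y}}.
  apply: (@ger0_derive1_le_cc R g 0 1).
  - by move=> x _; exact: ex_derive.
  - move=> x; rewrite in_itv/= => /andP[x0 x1].
    rewrite derive1E derive_val mulr_ge0 ?expR_ge0//; nra.
  - apply: derivable_within_continuous => x _; exact: ex_derive.
have {H} : g 0 <= g u by apply: H; rewrite ?in_itv/= ?lexx ?ler01//= ?(ltW u0) ?u2.
rewrite /g oppr0 expR0 addr0 expr0n/= !addr0 mulr1 expRN.
by rewrite ler_pdivlMr ?expR_gt0// mul1r.
Qed.

Lemma sum_geometric_dist (R : realType) (B c : nat) (t : R) : 0 <= t < 1 ->
  \sum_(m < B) t ^+ (`|(m : int) - (c : int)|)%N <= 2 / (1 - t).
Proof.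
move=> /andP[t0 t1]; have t1' : 0 < 1 - t by lra.
have geo n : \sum_(m < n) t ^+ m <= (1 - t)^-1.
  rewrite -[leRHS]mul1r ler_pdivlMr// mulrC.
  rewrite -opprB mulNr -subrX1 opprB lerBlDr lerDl; exact: exprn_ge0.
(* Extending the range to [c + B] only adds nonnegative terms and lets the sum split at [c] into two
   geometric series. *)
have big1 : \sum_(m < c + B) t ^+ (`|(m : int) - (c : int)|)%N <= 2 / (1 - t).
  rewrite big_split_ord/=; have -> : 2 / (1 - t) = (1 - t)^-1 + (1 - t)^-1 by lra.
  apply: lerD.
    rewrite (reindex_inj rev_ord_inj)/=.
    apply: le_trans (_ : t * \sum_(m < c) t ^+ m <= _).
      rewrite mulr_sumr; apply/le_of_eq.
      apply: eq_bigr => i _; rewrite -exprS; congr (_ ^+ _).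
      have := ltn_ord i; lia.
    apply: le_trans (geo c); rewrite ler_piMl ?(ltW t1)// sumr_ge0// => i _.
    exact: exprn_ge0.
  apply: le_trans (geo B).
  apply/le_of_eq.
  by apply: eq_bigr => i _; congr (_ ^+ _); lia.
apply: le_trans big1; rewrite addnC big_split_ord/= lerDl sumr_ge0// => i _.
exact: exprn_ge0.
Qed.

(* Exponential weights: each point of the l1 ball has weight at least
   t ^+ (d * Q) with t = Q / Q.+1, and the weights factor over coordinates.
   Unlike a covering of the ball by unit cubes in each coordinate separately,
   this loses no factor d ^ d. *)
Lemma card_l1_ball (R : realType) (d B Q : nat) (c : 'I_d -> nat) : (0 < Q)%N ->
  (#|[pred m : {ffun 'I_d -> 'I_B} |
      (\sum_(j < d) `|(m j : int) - (c j : int)| <= d * Q)%N]|%:R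
   <= (8 * Q.+1%:R) ^+ d :> R).
Proof.
move=> Q0; set A := [pred _ | _].
pose t : R := Q%:R / Q.+1%:R.
have q0 : 0 < Q%:R :> R by rewrite ltr0n.
have q1 : 0 < Q.+1%:R :> R by rewrite ltr0n.
have t0 : 0 < t by rewrite divr_gt0.
have t1 : 1 - t = Q.+1%:R^-1.
  by rewrite /t -natr1; field; rewrite natr1 gt_eqF.
have tlt1 : t < 1 by rewrite -subr_gt0 t1 invr_gt0.
(* [(1 + 1 / Q) ^ Q <= e <= 4]. The remaining factor [2 * Q.+1] of the bound is the geometric sum,
   as [1 - t = 1 / Q.+1]. *)
have tQ : 1 <= 4 * t ^+ Q.
  have h : (t^-1) ^+ Q <= 4.
    apply: le_trans (@expR1_le4 R).
    have -> : 1 = Q%:R * Q%:R^-1 :> R by rewrite mulfV// gt_eqF.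
    rewrite expRM_natl lerXn2r ?nnegrE ?expR_ge0 ?invr_ge0 ?(ltW t0)//.
    apply: le_trans (expR_ge1Dx _).
    rewrite /t invf_div -natr1 mulrDl mulfV ?gt_eqF// mul1r addrC//.
  by rewrite -ler_pdivrMr ?exprn_gt0// mul1r -exprVn.
have -> : #|A|%:R = \sum_(m in A) 1 :> R by rewrite sumr_const.
apply: le_trans (_ : \sum_(m in A) (4 ^+ d *
    \prod_(j < d) t ^+ `|(m j : int) - (c j : int)|%N) <= _).
  apply: ler_sum => m; rewrite inE => mA.
  rewrite -(expr_sum t).
  apply: le_trans (_ : (4 * t ^+ Q) ^+ d <= _); first exact: exprn_ege1.
  rewrite exprMn -exprM mulnC ler_wpM2l ?exprn_ge0//.
  by rewrite ler_wiXn2l// ?ltW.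
rewrite -mulr_sumr.
apply: le_trans (_ : 4 ^+ d * (\sum_(m : {ffun 'I_d -> 'I_B})
    \prod_(j < d) t ^+ `|(m j : int) - (c j : int)|%N) <= _).
  rewrite ler_wpM2l ?exprn_ge0// [leRHS](bigID (mem A))/= lerDl sumr_ge0// => m _.
  by rewrite prodr_ge0// => j _; rewrite exprn_ge0// ltW.
rewrite -(bigA_distr_bigA (fun j (b : 'I_B) => t ^+ `|(b : int) - (c j : int)|%N)).
have -> : (8 * Q.+1%:R) ^+ d = 4 ^+ d * \prod_(j < d) (2 * Q.+1%:R) :> R.
  by rewrite prodr_const card_ord -exprMn; congr (_ ^+ _); lra.
rewrite ler_wpM2l ?exprn_ge0// ler_prod// => j _; apply/andP; split.
  by rewrite sumr_ge0// => b _; rewrite exprn_ge0// ltW.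
apply: le_trans (sum_geometric_dist _ _ _) _; first by rewrite ltW.
by rewrite t1 invrK.
Qed.

(** * Densities and bounded measurable functions *)

Section density_measure.
Context d (T : measurableType d) (R : realType).
Variable xi : {finite_measure set T -> \bar R}.
Local Open Scope ereal_scope.

(** The hypotheses on [h] are arguments so that measure structures can be attached to the resulting
    constant. *)
Definition density_measure (h : T -> R) of measurable_fun setT h &
    (forall x, 0 <= h x)%R & xi.-integrable setT (EFin \o h) :=
  fun A => \int[xi]_(x in A) (h x)%:E.

Variables (h : T -> R) (mh : measurable_fun setT h) (h0 : forall x, (0 <= h x)%R).
Hypothesis ih : xi.-integrable setT (EFin \o h).

Let dm := density_measure mh h0 ih.

Let dm0 : dm set0 = 0. Proof. exact: integral_set0. Qed.

Let dm_ge0 A : 0 <= dm A.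
Proof. by apply: integral_ge0 => x _; rewrite lee_fin. Qed.

Let dm_sigma_additive : semi_sigma_additive dm.
Proof.
apply: (@semi_sigma_additive_nng_induced _ T R xi (EFin \o h)).
  exact/measurable_EFinP.
by move=> x; rewrite lee_fin.
Qed.

HB.instance Definition _ := isMeasure.Build _ _ _ dm dm0 dm_ge0 dm_sigma_additive.

Let dm_fin : fin_num_fun dm.
Proof.
by move=> A mA; apply: integrable_fin_num => //; exact: integrableS ih.
Qed.

HB.instance Definition _ := @Measure_isFinite.Build _ T R dm dm_fin.

Definition density_finite_measure : {finite_measure set T -> \bar R} := dm.

Lemma density_dominates : density_finite_measure `<< xi.
Proof.
apply/null_content_dominatesP => A mA A0; apply: null_set_integral => //.
exact: measurable_funTS (measurable_int _ ih).
Qed.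

Lemma density_RN : ae_eq xi setT
  (Radon_Nikodym_SigmaFinite.f density_finite_measure xi) (EFin \o h).
Proof.
apply: integral_ae_eq => //.
- exact: Radon_Nikodym_SigmaFinite.f_integrable density_dominates.
- exact/measurable_EFinP.
- by move=> A _ mA; rewrite -Radon_Nikodym_SigmaFinite.f_integral//;
    exact: density_dominates.
Qed.

Lemma ge0_integral_density (G : T -> \bar R) : (forall x, 0 <= G x) ->
  measurable_fun setT G ->
  \int[density_finite_measure]_x G x = \int[xi]_x (G x * (h x)%:E).
Proof.
move=> G0 mG.
rewrite -(Radon_Nikodym_SigmaFinite.change_of_variables density_dominates)//.
apply: ae_eq_integral => //.
- apply: emeasurable_funM => //; apply: measurable_int.
  exact: (Radon_Nikodym_SigmaFinite.f_integrable density_dominates).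
- by apply: emeasurable_funM => //; exact/measurable_EFinP.
- by apply: ae_eqe_mul2l; exact: density_RN.
Qed.

End density_measure.

Section density_probability.
Context d (T : measurableType d) (R : realType).
Variable xi : {finite_measure set T -> \bar R}.
Local Open Scope ereal_scope.
Variables (h : T -> R) (mh : measurable_fun setT h) (h0 : forall x, (0 <= h x)%R).
Hypothesis h1 : \int[xi]_x (h x)%:E = 1.

Let ih : xi.-integrable setT (EFin \o h).
Proof.
apply/integrableP; split; first exact/measurable_EFinP.
under eq_integral do rewrite /= ger0_norm//.
by rewrite h1 ltry.
Qed.

Let dp := density_measure mh h0 ih.

HB.instance Definition _ := Measure.on dp.

Let dp1 : dp setT = 1. Proof. exact: h1. Qed.

HB.instance Definition _ := Measure_isProbability.Build _ _ _ dp dp1.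

(** Serves to exhibit the optimal coupling of the entropic problem by its density, from which its
    [KL] term is then computed. *)
Lemma density_probability : exists g : probability T R,
  [/\ g `<< xi,
      ae_eq xi setT (Radon_Nikodym (charge_of_finite_measure g) xi) (EFin \o h),
      (forall A, measurable A -> g A = \int[xi]_(x in A) (h x)%:E) &
      forall G : T -> \bar R, (forall x, 0 <= G x) -> measurable_fun setT G ->
        \int[g]_x G x = \int[xi]_x (G x * (h x)%:E)].
Proof.
have dom : (dp : probability T R) `<< xi by exact: density_dominates.
exists dp; split => //.
- apply: integral_ae_eq => //.
  + exact: Radon_Nikodym_integrable.
  + exact/measurable_EFinP.
  by move=> A _ mA; rewrite -Radon_Nikodym_integral.
- by move=> G G0 mG; rewrite -ge0_integral_density.
Qed.

End density_probability.

Lemma bounded_integrable (R : realType) d (S : measurableType d)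
    (m : {finite_measure set S -> \bar R})
    (f : S -> R) (C : R) :
  measurable_fun setT f -> (forall x, `|f x| <= C) ->
  m.-integrable setT (EFin \o f).
Proof.
move=> mf fC; apply: measurable_bounded_integrable => //.
  exact: fin_num_fun_lty.
exists C; split; first exact: num_real.
by move=> M CM x _ /=; rewrite (le_trans (fC x))// ltW.
Qed.

Section bounded_measurable.
Context d (T : measurableType d) (R : realType).
Implicit Types f g : T -> R.

(** Such functions are integrable for every probability measure; the closure lemmas below discharge
    integrability side conditions. *)
Definition bounded_measurable f :=
  measurable_fun setT f /\ exists C, forall x, `|f x| <= C.

Lemma bmf_cst (c : R) : bounded_measurable (fun=> c).
Proof. by split => //; exists `|c|. Qed.

Lemma bmf_add f g : bounded_measurable f -> bounded_measurable g ->
  bounded_measurable (fun x => f x + g x).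
Proof.
move=> [mf [C fC]] [mg [D gD]]; split; first exact: measurable_funD.
by exists (C + D) => x; rewrite (le_trans (ler_normD _ _))// lerD.
Qed.

Lemma bmf_mul f g : bounded_measurable f -> bounded_measurable g ->
  bounded_measurable (fun x => f x * g x).
Proof.
move=> [mf [C fC]] [mg [D gD]]; split; first exact: measurable_funM.
by exists (C * D) => x; rewrite normrM ler_pM.
Qed.

Lemma bmf_scale (c : R) f : bounded_measurable f ->
  bounded_measurable (fun x => c * f x).
Proof. by apply: bmf_mul; exact: bmf_cst. Qed.

Lemma bmf_opp f : bounded_measurable f -> bounded_measurable (fun x => - f x).
Proof.
by move=> /(bmf_scale (-1)); under eq_fun do rewrite mulN1r.
Qed.

Lemma bmf_sub f g : bounded_measurable f -> bounded_measurable g ->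
  bounded_measurable (fun x => f x - g x).
Proof. by move=> bf bg; apply: bmf_add => //; exact: bmf_opp. Qed.

Lemma bmf_sum (I : Type) (s : seq I) (P : pred I) (F : I -> T -> R) :
  (forall i, bounded_measurable (F i)) ->
  bounded_measurable (fun x => \sum_(i <- s | P i) F i x).
Proof.
move=> bF; elim: s => [|i s IH].
  by under eq_fun do rewrite big_nil; exact: bmf_cst.
under eq_fun do rewrite big_cons; case: (P i) => //.
exact: bmf_add.
Qed.

Lemma bmf_exp f : bounded_measurable f -> bounded_measurable (fun x => expR (f x)).
Proof.
move=> [mf [C fC]]; split; first exact: measurableT_comp.
exists (expR C) => x; rewrite ger0_norm ?expR_ge0// ler_expR.
by rewrite (le_trans (ler_norm _)).
Qed.

(** The conclusion is [bounded_measurable] unfolded, since within this section that predicate is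
    tied to the type [T]. *)
Lemma bmf_comp d' (S : measurableType d') (g : S -> T) f :
  measurable_fun setT g -> bounded_measurable f ->
  measurable_fun setT (fun x => f (g x)) /\ exists C, forall x, `|f (g x)| <= C.
Proof.
by move=> mg [mf [C fC]]; split; [exact: measurableT_comp|exists C].
Qed.

Lemma bmf_indic (A : set T) : measurable A -> bounded_measurable (\1_A : T -> R).
Proof.
move=> mA; split; first exact: measurable_indic.
by exists 1 => x; rewrite indicE; case: (_ \in _); rewrite ?normr1// normr0 ler01.
Qed.

Lemma bmf_min f g : bounded_measurable f -> bounded_measurable g ->
  bounded_measurable (fun x => Num.min (f x) (g x)).
Proof.
move=> [mf [C fC]] [mg [D gD]]; split; first exact: measurable_minr.
exists (Num.max C D) => x.
by case: (leP (f x) (g x)) => _; rewrite le_max ?fC ?gD ?orbT.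
Qed.

Lemma bmf_max f g : bounded_measurable f -> bounded_measurable g ->
  bounded_measurable (fun x => Num.max (f x) (g x)).
Proof.
move=> [mf [C fC]] [mg [D gD]]; split; first exact: measurable_maxr.
exists (Num.max C D) => x.
by case: (leP (f x) (g x)) => _; rewrite le_max ?fC ?gD ?orbT.
Qed.

Variable m : probability T R.

Lemma bmf_integrable f : bounded_measurable f -> m.-integrable setT (EFin \o f).
Proof. by move=> [mf [C fC]]; exact: bounded_integrable fC. Qed.

Lemma bmf_integralE f : bounded_measurable f ->
  (\int[m]_x (f x)%:E)%E = (\int[m]_x f x)%:E.
Proof.
by move=> bf; rewrite fineK//; apply: integrable_fin_num => //; exact: bmf_integrable.
Qed.

Lemma bmf_le f g : bounded_measurable f -> bounded_measurable g ->
  (forall x, f x <= g x) -> \int[m]_x f x <= \int[m]_x g x.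
Proof. by move=> bf bg fg; apply: le_Rintegral => //; exact: bmf_integrable. Qed.

Lemma bmf_intD f g : bounded_measurable f -> bounded_measurable g ->
  \int[m]_x (f x + g x) = \int[m]_x f x + \int[m]_x g x.
Proof. by move=> bf bg; apply: RintegralD => //; exact: bmf_integrable. Qed.

Lemma bmf_intB f g : bounded_measurable f -> bounded_measurable g ->
  \int[m]_x (f x - g x) = \int[m]_x f x - \int[m]_x g x.
Proof. by move=> bf bg; apply: RintegralB => //; exact: bmf_integrable. Qed.

Lemma bmf_intZ c f : bounded_measurable f ->
  \int[m]_x (c * f x) = c * \int[m]_x f x.
Proof. by move=> bf; apply: RintegralZl => //; exact: bmf_integrable. Qed.

Lemma bmf_int_cst c : \int[m]_x c = c.
Proof.
rewrite Rintegral_cst// [X in fine X](_ : _ = 1%E) ?mulr1//.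
exact: probability_setT.
Qed.

Lemma bmf_int_sum (I : Type) (s : seq I) (P : pred I) (F : I -> T -> R) :
  (forall i, bounded_measurable (F i)) ->
  \int[m]_x (\sum_(i <- s | P i) F i x) = \sum_(i <- s | P i) \int[m]_x F i x.
Proof.
move=> bF; elim: s => [|i s IH].
  by under eq_Rintegral do rewrite big_nil; rewrite bmf_int_cst big_nil.
under eq_Rintegral do rewrite big_cons; rewrite big_cons; case: (P i) => //.
by rewrite bmf_intD ?IH//; exact: bmf_sum.
Qed.

End bounded_measurable.

(** * Maximal inequality for independent samples *)

Section iid_sample.
Context {R : realType} {dO dT : measure_display} {Omega : measurableType dO}
  {T : measurableType dT} (P : probability Omega R) (mu : probability T R).
Context {n : nat} (X : 'I_n -> {RV P >-> T}).
Hypothesis Xlaw : forall i B, measurable B -> distribution P (X i) B = mu B.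
Hypothesis Xind : mutually_independent X.

Let prod_indic (J : {set 'I_n}) (B : 'I_n -> set T) w : (forall i, i \in J) ->
  \prod_i \1_(B i) (X i w) =
  \1_(\bigcap_(i in [set` J]) (X i @^-1` B i)) w :> R.
Proof.
move=> JT; rewrite !indicE; case: (boolP (w \in _)) => [|h].
  rewrite inE => wB; rewrite big1// => i _.
  by rewrite indicE mem_set//; apply: wB; exact: JT.
have [i iB] : exists i, X i w \notin B i.
  apply/existsP; apply: contraR h; rewrite negb_exists => /forallP h.
  by rewrite inE => i _ /=; apply/set_mem; have := h i; rewrite negbK.
by rewrite (bigD1 i)//= indicE (negbTE iB) mul0r.
Qed.

Lemma measurable_prod_sample (h : 'I_n -> T -> R) (J : pred 'I_n) :
  (forall i, measurable_fun setT (h i)) ->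
  measurable_fun setT (fun w => \prod_(i | J i) h i (X i w)).
Proof.
move=> mh; under eq_fun do rewrite big_mkcond/=.
apply: measurable_prod => i _; case: (J i) => //.
exact: measurableT_comp.
Qed.

(** Independence only speaks of events, so indicators are replaced by general factors one at a time.
    If the formula holds whenever the factors of index at least [k] are indicators, then the product
    of all factors but the one of index [k] is a density whose image under [X k] is a multiple of
    [mu]; integrating [h k] against this image frees the factor [k]. *)
Lemma ge0_integral_prod_indep (h : 'I_n -> T -> R) (C : R) :
  (forall i, measurable_fun setT (h i)) ->
  (forall i x, 0 <= h i x <= C) ->
  (\int[P]_w (\prod_i h i (X i w))%:E = \prod_i \int[mu]_x (h i x)%:E)%E.
Proof.
move=> mh hC.
suff H k : forall h : 'I_n -> T -> R, (forall i, measurable_fun setT (h i)) ->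
  (exists C, forall i x, 0 <= h i x <= C) ->
  (forall i : 'I_n, (k <= i)%N -> exists2 B, measurable B & h i = \1_B) ->
  (\int[P]_w (\prod_i h i (X i w))%:E = \prod_i \int[mu]_x (h i x)%:E)%E.
  apply: (H n) => //; first by exists C.
  by move=> i; rewrite leqNgt ltn_ord.
elim: k => {C h mh hC}[|k IH] h mh [C hC] hB.
  have {hB} /choice[B /all_and2[mB hB]] i : exists B, measurable B /\ h i = \1_B.
    by have [B ? ?] := hB i isT; exists B.
  under eq_integral do under eq_bigr do rewrite hB.
  have JT (i : 'I_n) : i \in [set i : 'I_n | true]%SET by rewrite inE.
  under eq_integral do rewrite (prod_indic _ _ JT).
  have mI i : measurable (X i @^-1` B i).
    by rewrite -[_ @^-1` _]setTI; exact: measurable_funPT.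
  rewrite integral_indic//; last first.
    by apply: fin_bigcap_measurable => // i _; exact: mI.
  rewrite setIT; apply: etrans (Xind _ mB) _.
  apply: eq_big => [i|i _]; first by rewrite inE.
  by rewrite hB integral_indic// setIT; exact: Xlaw.
have [kn|nk] := ltnP k n; last first.
  apply: IH => //; first by exists C.
  by move=> i ki; apply: hB; have := ltn_ord i; rewrite ltnNge (leq_trans nk).
pose i0 := Ordinal kn.
pose Z w := \prod_(i | i != i0) h i (X i w).
have mZ : measurable_fun setT Z by exact: measurable_prod_sample.
have Z0 w : 0 <= Z w by apply: prodr_ge0 => i _; case/andP: (hC i (X i w)).
have iZ : P.-integrable setT (EFin \o Z).
  apply: (@bounded_integrable _ _ _ _ _ (\prod_(i < n | i != i0) C)) => // w.
  by rewrite ger0_norm//; apply: ler_prod => i _; exact: hC.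
pose m := density_finite_measure mZ Z0 iZ.
have Efin i : (\int[mu]_x (h i x)%:E)%E \is a fin_num.
  apply: integrable_fin_num => //.
  apply: (@bounded_integrable _ _ _ _ _ (C)) => // x.
  by case/andP: (hC i x) => ? ?; rewrite ger0_norm.
have E0 i : (0 <= \int[mu]_x (h i x)%:E)%E.
  by apply: integral_ge0 => x _; rewrite lee_fin; case/andP: (hC i x).
pose c := (\prod_(i | i != i0) \int[mu]_x (h i x)%:E)%E.
have c0 : (0 <= c)%E by apply: prode_ge0.
have cfin : c \is a fin_num.
  by apply: (big_ind (fun x => x \is a fin_num)) => // x y; exact: fin_numM.
have fc0 : 0 <= fine c by exact: fine_ge0.
have upd B : measurable B -> m (X i0 @^-1` B) = (c * mu B)%E.
  move=> mB; pose h' i := if i == i0 then \1_B else h i.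
  have h'E := IH h'.
  transitivity (\int[P]_w (\prod_i h' i (X i w))%:E)%E.
    rewrite /m /= /density_measure integral_mkcond; apply: eq_integral => w _.
    rewrite (bigD1 i0)//= /h' eqxx patchE.
    rewrite (eq_bigr (fun i => h i (X i w))); last by move=> i /negbTE ->.
    rewrite indicE -[X in _ = (X * _)%:E]/((X i0 w \in B)%:R).
    have -> : (w \in X i0 @^-1` B) = (X i0 w \in B) by apply/idP/idP; rewrite !inE.
    by case: ifP => _; rewrite ?mul1r ?mul0r.
  rewrite h'E; first last.
  - move=> i ki; rewrite /h'; case: eqP => [_|/eqP ii0]; first by exists B.
    apply: hB; rewrite ltn_neqAle ki andbT; apply: contra ii0 => /eqP ki'.
    by apply/eqP/val_inj.
  - exists (Num.max 1 C) => i x; rewrite /h'; case: eqP => _.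
      by rewrite indicE le_max; case: (_ \in _); rewrite ?lexx ?ler01.
    by case/andP: (hC i x) => -> /= ?; rewrite le_max; apply/orP; right.
  - by move=> i; rewrite /h'; case: eqP => // _; exact: measurable_indic.
  rewrite (bigD1 i0)//= /h' eqxx integral_indic// setIT muleC; congr (_ * _)%E.
  by apply: eq_bigr => i /negbTE ->.
transitivity (\int[m]_w (h i0 (X i0 w))%:E)%E.
  rewrite ge0_integral_density//.
  - by apply: eq_integral => w _; rewrite (bigD1 i0)//= EFinM.
  - by move=> w; rewrite lee_fin; case/andP: (hC i0 (X i0 w)).
  - by apply/measurable_EFinP; exact: measurableT_comp.
rewrite -(@ge0_integral_pushforward _ _ _ _ R (X i0) _ m setT (EFin \o h i0))//; first last.
- by move=> y _; rewrite lee_fin; case/andP: (hC i0 y).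
- by apply/measurable_EFinP.
rewrite (eq_measure_integral (mscale (NngNum fc0) mu)); last first.
  by move=> A mA _; apply: etrans (upd A mA) _; rewrite -{1}(fineK cfin).
rewrite ge0_integral_mscale//=; first last.
- by move=> x _; rewrite lee_fin; case/andP: (hC i0 x).
- exact/measurable_EFinP.
by rewrite fineK// [RHS](bigD1 i0)//= muleC.
Qed.

End iid_sample.

Lemma ln4_le2 (R : realType) : ln 4 <= 2 :> R.
Proof.
have -> : 4 = 2 ^+ 2 :> R by rewrite expr2; lra.
rewrite lnXn// mulr2n; have := @le_ln1Dx R 1 ltac:(lra); lra.
Qed.

(** Equivalent to [M * (M - 1) <= phi (2 * ln M)] with the [phi] of the maximal inequality; this is
    why all counts are taken to be at least 8. *)
Lemma log_le_linear (R : realType) (M : R) : 8 <= M -> 1 + 2 * ln M <= M.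
Proof.
move=> M8; have -> : M = 4 * (1 + (M / 4 - 1)) by lra.
rewrite lnM ?posrE//; try lra.
have := @ln4_le2 R; have := @le_ln1Dx R (M / 4 - 1) ltac:(lra); lra.
Qed.

(** Convexity of the exponential between 0 and [v], from its tangent at [q * v] evaluated at both
    ends. It makes an exponential moment linear in the mass [q] of a support. *)
Lemma expR_convex_weight (R : realType) (q v : R) : 0 <= q <= 1 ->
  expR (q * v) - 1 <= q * (expR v - 1).
Proof.
move=> /andP[q0 q1].
have e1 : expR (q * v) * (1 + (1 - q) * v) <= expR v.
  apply: le_trans (_ : expR (q * v) * expR ((1 - q) * v) <= _).
    by rewrite ler_wpM2l ?expR_ge0// expR_ge1Dx.
  by rewrite -expRD; apply/le_of_eq; congr expR; ring.
have e2 : expR (q * v) * (1 - q * v) <= 1.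
  have := expR_ge1Dx (- (q * v)); rewrite expRN => h.
  by rewrite mulrC -ler_pdivlMr ?expR_gt0// div1r.
have := ler_wpM2l q0 e1.
have := @ler_wpM2l R (1 - q) ltac:(lra) _ _ e2.
set E := expR (q * v); set F := expR v; nra.
Qed.

Section maximal_inequality.
Context {R : realType} {dO dT : measure_display} {Omega : measurableType dO}
  {T : measurableType dT} (P : probability Omega R) (mu : probability T R).
Context {n : nat} (X : 'I_n -> {RV P >-> T}).
Hypothesis n_gt0 : (0 < n)%N.
Hypothesis Xlaw : forall i B, measurable B -> distribution P (X i) B = mu B.
Hypothesis Xind : mutually_independent X.

Implicit Types (f : T -> R) (U V : Omega -> R).

Definition deviation (f : T -> R) (w : Omega) : R :=
  n%:R^-1 * \sum_i f (X i w) - \int[mu]_x f x.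

Let n0 : 0 < n%:R :> R. Proof. by rewrite ltr0n. Qed.

Lemma bmf_sample f i : bounded_measurable f ->
  bounded_measurable (fun w => f (X i w)).
Proof. by move=> bf; exact: (bmf_comp _ bf). Qed.

Lemma bmf_deviation f : bounded_measurable f -> bounded_measurable (deviation f).
Proof.
move=> bf; apply: bmf_sub; last exact: bmf_cst.
by apply: bmf_scale; apply: bmf_sum => i; exact: bmf_sample.
Qed.

Lemma Rintegral_sample f i : bounded_measurable f ->
  \int[P]_w f (X i w) = \int[mu]_x f x.
Proof.
move=> bf; congr fine.
transitivity (\int[distribution P (X i)]_x (f x)%:E)%E.
  rewrite integral_distribution//; first by apply/measurable_EFinP; case: bf.
  exact: bmf_integrable (bmf_sample i bf).
by apply: eq_measure_integral => A mA _; exact: Xlaw.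
Qed.

Lemma Rintegral_deviation f : bounded_measurable f ->
  \int[P]_w deviation f w = 0.
Proof.
move=> bf; have bs i := bmf_sample i bf.
rewrite /deviation bmf_intB; first last.
- exact: bmf_cst.
- by apply: bmf_scale; apply: bmf_sum => i; exact: bs.
rewrite bmf_intZ; last by apply: bmf_sum => i; exact: bs.
rewrite bmf_int_sum// bmf_int_cst.
under eq_bigr do rewrite Rintegral_sample//.
by rewrite sumr_const card_ord -[(\int[mu]_x f x) *+ n]mulr_natl mulKf ?subrr// gt_eqF.
Qed.

(** Independence turns the mean into an n-th power. The linear term of the exponential is cancelled
    by centering, and the quadratic one is supported in [A], whence the mass of [A] in the
    exponent. *)
Lemma mgf_deviation_le f (A : set T) (s theta : R) :
  bounded_measurable f -> measurable A -> (forall x, f x != 0 -> A x) ->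
  (forall x, `|f x| <= s) -> 0 <= theta -> theta * s <= 1 ->
  \int[P]_w expR (n%:R * theta * deviation f w) <=
  expR (n%:R * (\int[mu]_x \1_A x) * (theta * s) ^+ 2).
Proof.
move=> bf mA fA fs th0 ths; set q := \int[mu]_x \1_A x; set m := \int[mu]_x f x.
pose h x := expR (theta * (f x - m)).
have bh : bounded_measurable h.
  by apply: bmf_exp; apply: bmf_scale; apply: bmf_sub => //; exact: bmf_cst.
have [mh [C hC]] := bh.
have hE w : expR (n%:R * theta * deviation f w) = \prod_i h (X i w).
  rewrite -expR_sum; congr expR; rewrite -mulr_sumr sumrB sumr_const card_ord.
  by rewrite /deviation -/m -[m *+ n]mulr_natl; field; rewrite gt_eqF.
have -> : \int[P]_w expR (n%:R * theta * deviation f w) = (\int[mu]_x h x) ^+ n.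
  under eq_Rintegral do rewrite hE.
  rewrite /Rintegral (ge0_integral_prod_indep Xlaw Xind (h := fun=> h) (C := C))//.
    under eq_bigr do rewrite (bmf_integralE mu bh).
    by rewrite -(big_morph EFin (@EFinM R) erefl)/= prodr_const card_ord.
  by move=> i x; rewrite expR_ge0 (le_trans (ler_norm _)).
have -> : n%:R * q * (theta * s) ^+ 2 = n%:R * (q * (theta * s) ^+ 2) by ring.
rewrite expRM_natl lerXn2r ?nnegrE ?expR_ge0//.
  by apply: Rintegral_ge0 => x _; exact: expR_ge0.
have bA := @bmf_indic _ T R _ mA.
have b1 : bounded_measurable (fun x => theta * f x + (theta * s) ^+ 2 * \1_A x).
  by apply: bmf_add; exact: bmf_scale.
apply: le_trans (_ : expR (- (theta * m)) *
    (1 + (theta * m + (theta * s) ^+ 2 * q)) <= _); last first.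
  apply: le_trans (_ : expR (- (theta * m)) *
    expR (theta * m + (theta * s) ^+ 2 * q) <= _).
    by rewrite ler_wpM2l ?expR_ge0// expR_ge1Dx.
  rewrite -expRD; apply/le_of_eq; congr expR; ring.
rewrite -(bmf_intZ mu theta bf) -(bmf_intZ mu ((theta * s) ^+ 2) bA).
rewrite -bmf_intD//; try exact: bmf_scale.
rewrite -[X in X + _](bmf_int_cst mu) -bmf_intD//; last exact: bmf_cst.
rewrite -bmf_intZ; last by apply: bmf_add => //; exact: bmf_cst.
apply: bmf_le => //.
  by apply: bmf_scale; apply: bmf_add => //; exact: bmf_cst.
move=> x; rewrite (bmf_intZ mu theta bf) -/m /h mulrBr addrC expRD.
rewrite ler_wpM2l ?expR_ge0//.
have tf : -1 <= theta * f x <= 1.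
  rewrite -ler_norml normrM (ger0_norm th0) (le_trans _ ths)//.
  exact: ler_wpM2l.
apply: le_trans (expR_le_quadratic tf) _; rewrite addrA lerD2l.
have [->|fx0] := eqVneq (f x) 0.
  by rewrite mulr0 expr0n/= mulr_ge0 ?sqr_ge0// indicE.
rewrite indicE mem_set ?mulr1; last exact: fA.
rewrite -[leLHS]real_normK ?num_real// lerXn2r ?nnegrE ?normr_ge0//.
  by rewrite mulr_ge0// (le_trans _ (fs x)).
by rewrite normrM (ger0_norm th0) ler_wpM2l.
Qed.

(* Upper bounds that stay measurable, unlike suprema over parameters. *)
Definition mean_bounded (U : Omega -> R) (b : R) :=
  bounded_measurable U /\ \int[P]_w U w <= b.

Lemma mean_bounded_add U V a b : mean_bounded U a -> mean_bounded V b ->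
  mean_bounded (fun w => U w + V w) (a + b).
Proof.
move=> [bU Ua] [bV Vb]; split; first exact: bmf_add.
by rewrite bmf_intD// lerD.
Qed.

Lemma mean_bounded_cst c : mean_bounded (fun=> c) c.
Proof. by split; [exact: bmf_cst|rewrite bmf_int_cst]. Qed.

Lemma mean_bounded_scale c U a : 0 <= c -> mean_bounded U a ->
  mean_bounded (fun w => c * U w) (c * a).
Proof.
move=> c0 [bU Ua]; split; first exact: bmf_scale.
by rewrite bmf_intZ// ler_wpM2l.
Qed.

(* Since u |-> e^u - 1 - u is nonnegative and vanishes at 0, each function
   only contributes in proportion to the mass of its support: the number of
   functions is replaced by the number of those not vanishing at a point. *)
Lemma maximal_inequality (I : finType) (D : I -> T -> R) (s M : R) :
  0 < s -> 8 <= M -> (forall i, bounded_measurable (D i)) ->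
  (forall i x, `|D i x| <= s) ->
  (forall x, #|[pred i | D i x != 0]|%:R <= M) ->
  exists2 U, mean_bounded U (2 * s * Num.sqrt (ln M / n%:R)) &
    forall i w, deviation (D i) w <= U w.
Proof.
move=> s0 M8 bD Ds DM.
have lM0 : 0 < ln M by rewrite ln_gt0//; lra.
(* If [ln M > n], the claimed bound exceeds [2 * s], which bounds every deviation trivially.
   Otherwise [theta * s <= 1] below, as the moment bound requires. *)
have [lnMn|lnMn] := leP (ln M) n%:R; last first.
  exists (fun=> 2 * s * Num.sqrt (ln M / n%:R)); first exact: mean_bounded_cst.
  move=> i w; apply: le_trans (_ : 2 * s <= _); last first.
    rewrite ler_peMr//; first lra.
    by rewrite -{1}(sqrtr1 R) ler_wsqrtr// ler_pdivlMr// mul1r ltW.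
  have -> : 2 * s = n%:R^-1 * (\sum_(i < n) s) + s.
    rewrite sumr_const card_ord -[s *+ n]mulr_natl mulKf ?gt_eqF//; lra.
  rewrite /deviation lerD//.
    rewrite ler_wpM2l ?invr_ge0 ?(ltW n0)// ler_sum// => j _.
    by rewrite (le_trans (ler_norm _)).
  apply: le_trans (ler_norm _) _; rewrite normrN.
  apply: le_trans (le_normr_Rintegral _ _) _ => //; first exact: bmf_integrable.
  rewrite -[leRHS](bmf_int_cst mu); apply: bmf_le => //; last exact: bmf_cst.
  split; last by exists s => x; rewrite normr_id.
  by apply: measurableT_comp => //; case: (bD i).
(* Chosen so that [n * (theta * s) ^ 2 = ln M]: the moment bound becomes [expR (q * ln M)], with [q]
   the mass of a support. *)
pose theta := Num.sqrt (ln M / n%:R) / s.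
have sq0 : 0 < Num.sqrt (ln M / n%:R) by rewrite sqrtr_gt0 divr_gt0.
have th0 : 0 < theta by rewrite divr_gt0.
have thsE : theta * s = Num.sqrt (ln M / n%:R) by rewrite /theta mulfVK ?gt_eqF.
have ths : theta * s <= 1.
  by rewrite thsE -{2}(sqrtr1 R) ler_wsqrtr// ler_pdivrMr// mul1r.
have nths : n%:R * (theta * s) ^+ 2 = ln M.
  by rewrite thsE sqr_sqrtr ?divr_ge0 ?ltW// mulrC divfK// gt_eqF.
pose phi u : R := expR u - 1 - u.
pose lam := n%:R * theta.
have lam0 : 0 < lam by rewrite mulr_gt0.
(* The slope of [phi] at [u0] is [M ^ 2 - 1]. The tangent there bounds every [lam * deviation] by an
   affine function of [S], so that [U] is measurable; its mean is at most [u0 / lam] because the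
   mean of [S] is at most [phi u0]. *)
pose u0 := 2 * ln M.
have eu0 : expR u0 = M ^+ 2.
  by rewrite /u0 expRM_natl lnK// posrE; lra.
have M21 : 0 < M ^+ 2 - 1 by nra.
pose S w := \sum_i phi (lam * deviation (D i) w).
pose U w := lam^-1 * (u0 + (M ^+ 2 - 1)^-1 * (S w - phi u0)).
have bphi i : bounded_measurable (fun w => phi (lam * deviation (D i) w)).
  have b1 : bounded_measurable (fun w => lam * deviation (D i) w).
    by apply: bmf_scale; exact: bmf_deviation.
  apply: bmf_sub => //; apply: bmf_sub; last exact: bmf_cst.
  exact: bmf_exp.
have bS : bounded_measurable S by apply: bmf_sum.
have phi0 u : 0 <= phi u by have := expR_ge1Dx u; rewrite /phi; lra.
exists U; last first.
  move=> i w; set z := deviation _ _.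
  have Sz : phi (lam * z) <= S w.
    by rewrite /S (bigD1 i)//= lerDl sumr_ge0.
  have : phi u0 + (M ^+ 2 - 1) * (lam * z - u0) <= phi (lam * z).
    have := expR_ge1Dx (lam * z - u0); rewrite expRB eu0 ler_pdivlMr; last nra.
    rewrite /phi eu0; lra.
  move=> /le_trans/(_ Sz) h.
  rewrite /U ler_pdivlMl// -lerBlDl ler_pdivlMl//; lra.
split.
  apply: bmf_scale; apply: bmf_add; first exact: bmf_cst.
  by apply: bmf_scale; apply: bmf_sub => //; exact: bmf_cst.
have ES : \int[P]_w S w <= M * (M - 1).
  rewrite bmf_int_sum//.
  pose A i := D i @^-1` (~` [set 0]).
  have mA i : measurable (A i).
    rewrite -[A i]setTI; case: (bD i) => mD _; apply: mD => //.
    exact: measurableC.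
  apply: le_trans (_ : \sum_i (\int[mu]_x \1_(A i) x) * (M - 1) <= _).
    apply: ler_sum => i _.
    have q01 : 0 <= \int[mu]_x \1_(A i) x <= 1.
      apply/andP; split; first by apply: Rintegral_ge0 => x _; rewrite indicE.
      rewrite -[leRHS](bmf_int_cst mu); apply: bmf_le => //.
      - exact: bmf_indic.
      - exact: bmf_cst.
    have bd := bmf_deviation (bD i).
    have be : bounded_measurable (fun w => expR (lam * deviation (D i) w)).
      by apply: bmf_exp; exact: bmf_scale.
    rewrite /phi bmf_intB; first last.
    - exact: bmf_scale.
    - by apply: bmf_sub => //; exact: bmf_cst.
    rewrite bmf_intB//; last exact: bmf_cst.
    rewrite bmf_int_cst bmf_intZ// Rintegral_deviation// mulr0 subr0.
    have M0 : 0 < M by lra.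
    rewrite -[X in _ * (X - 1)](@lnK R)//; apply: le_trans (expR_convex_weight _ q01).
    rewrite lerD2r -nths mulrCA mulrA.
    apply: mgf_deviation_le => //; last exact: ltW.
    by move=> x Dx /=; apply/eqP.
  rewrite -mulr_suml ler_wpM2r//; first lra.
  rewrite -bmf_int_sum; last by move=> i; exact: bmf_indic.
  rewrite -[leRHS](bmf_int_cst mu); apply: bmf_le => //.
  - by apply: bmf_sum => i; exact: bmf_indic.
  - exact: bmf_cst.
  - move=> x; apply: le_trans (DM x).
    rewrite -sum1_card natr_sum [leRHS]big_mkcond/=; apply: ler_sum => i _.
    rewrite inE indicE; case: eqP => [Dx|/eqP Dx]; last by case: (_ \in _).
    by rewrite memNset//= /A/= => /(_ Dx).
rewrite bmf_intZ; last first.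
  apply: bmf_add; first exact: bmf_cst.
  by apply: bmf_scale; apply: bmf_sub => //; exact: bmf_cst.
rewrite bmf_intD; first last.
- by apply: bmf_scale; apply: bmf_sub => //; exact: bmf_cst.
- exact: bmf_cst.
rewrite bmf_int_cst bmf_intZ; last by apply: bmf_sub => //; exact: bmf_cst.
rewrite bmf_intB//; last exact: bmf_cst.
rewrite bmf_int_cst.
apply: le_trans (_ : lam^-1 * u0 <= _).
  rewrite ler_wpM2l ?invr_ge0 ?(ltW lam0)// gerDl pmulr_rle0 ?invr_gt0//.
  rewrite /phi eu0 /u0; have := log_le_linear M8; nra.
apply/le_of_eq.
have nn : n%:R != 0 :> R by rewrite gt_eqF.
have lnE : ln M = n%:R * Num.sqrt (ln M / n%:R) ^+ 2 by rewrite -thsE nths.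
rewrite /lam /theta /u0; move: sq0 lnE; set q := Num.sqrt _ => q0 ->.
by field; rewrite nn !gt_eqF.
Qed.

End maximal_inequality.

(** * Chaining *)

Section chaining.
Context {R : realType} {dO dT : measure_display} {Omega : measurableType dO}
  {T : measurableType dT} (P : probability Omega R) (mu : probability T R).
Context {n : nat} (X : 'I_n -> {RV P >-> T}).
Hypothesis n_gt0 : (0 < n)%N.
Hypothesis Xlaw : forall i B, measurable B -> distribution P (X i) B = mu B.
Hypothesis Xind : mutually_independent X.

Let dev := @deviation R _ _ Omega T P mu n X.

Let deviationD (f g : T -> R) w : bounded_measurable f -> bounded_measurable g ->
  dev (fun x => f x + g x) w = dev f w + dev g w.
Proof.
by move=> bf bg; rewrite /dev /deviation big_split/= bmf_intD//; ring.
Qed.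

Let deviationZ (c : R) (f : T -> R) w : bounded_measurable f ->
  dev (fun x => c * f x) w = c * dev f w.
Proof.
by move=> bf; rewrite /dev /deviation -mulr_sumr bmf_intZ//; ring.
Qed.

Let deviation_bound (f : T -> R) (c : R) w : bounded_measurable f ->
  (forall x, `|f x| <= c) -> `|dev f w| <= 2 * c.
Proof.
move=> bf fc; rewrite mulr2n mulrDl !mul1r (le_trans (ler_normB _ _))// lerD//.
  rewrite normrM ger0_norm ?invr_ge0 ?ler0n// ler_pdivrMl ?ltr0n//.
  rewrite (le_trans (ler_norm_sum _ _ _))// (le_trans (ler_sum _ (fun i _ => fc _)))//.
  by rewrite sumr_const card_ord mulr_natl.
apply: le_trans (le_normr_Rintegral _ _) _ => //; first exact: bmf_integrable.
rewrite -[leRHS](bmf_int_cst mu); apply: bmf_le => //; last exact: bmf_cst.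
split; last by exists c => x; rewrite normr_id.
by apply: measurableT_comp => //; case: bf.
Qed.

(** Starts at 1/2: truncation at [2 * dyadic 0 = 1] kills functions with values in [0, 1], so every
    chain starts at 0. *)
Definition dyadic (k : nat) : R := 2^-1 ^+ k.+1.

Lemma dyadicS k : dyadic k = 2 * dyadic k.+1.
Proof. by rewrite /dyadic [in RHS]exprS mulVKf// pnatr_eq0. Qed.

Lemma dyadic_gt0 k : 0 < dyadic k.
Proof. by rewrite exprn_gt0// invr_gt0. Qed.

(* Truncating at height 2 * dyadic k makes the approximants vanish wherever
   the function itself is small. *)
Let trunc k (u : R) := Num.max (u - 2 * dyadic k) 0.

Let trunc_dist k u v :
  `|trunc k.+1 u - trunc k v| <= `|u - v| + 2 * dyadic k.+1.
Proof.
rewrite /trunc (dyadicS k); have := dyadic_gt0 k.+1; set e := dyadic k.+1 => e0.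
have : -`|u - v| <= u - v <= `|u - v| by rewrite -ler_norml.
move=> /andP[h1 h2]; rewrite ler_norml.
by case: (leP (u - 2 * e) 0) => h3; case: (leP (v - 2 * (2 * e)) 0) => h4;
  apply/andP; split; lra.
Qed.

Variables (Lam : Type) (lam0 : Lam) (f : Lam -> T -> R).
Hypothesis mf : forall l, measurable_fun setT (f l).
Hypothesis f01 : forall l x, 0 <= f l x <= 1.
Variables (C : nat -> finType) (code : forall k, Lam -> C k) (M : nat -> R).
Hypothesis code_dist : forall k l l', code k l = code k l' ->
  forall x, `|f l x - f l' x| <= dyadic k.
Hypothesis M8 : forall k, 8 <= M k.
Hypothesis code_card : forall k x,
  #|[pred c : C k | `[< exists l, code k l = c /\ dyadic k <= f l x >]]|%:R <= M k.

Let rep k (c : C k) : Lam :=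
  if pselect (exists l, code k l = c) is left h then sval (cid h) else lam0.

Let repK k l : code k (rep (code k l)) = code k l.
Proof.
rewrite /rep; case: pselect => [h|/(_ (ex_intro _ l erefl))//].
by case: cid.
Qed.

Let bf l : bounded_measurable (f l).
Proof.
split=> //; exists 1 => x; case/andP: (f01 l x) => h0 h1.
by rewrite ger0_norm.
Qed.

Let btrunc k l : bounded_measurable (fun x => trunc k (f l x)).
Proof.
apply: bmf_max; last exact: bmf_cst.
by apply: bmf_sub => //; exact: bmf_cst.
Qed.

(** A link joins the representative of a code [c] at level [K.+1] to the representative of the level
    [K] code of that representative. It depends on [c] alone, so the maximal inequality sees one
    function per code. *)
Let link_bound (sg : R) (K : nat) : `|sg| = 1 ->
  exists2 U, mean_bounded P U
    (\sum_(k < K) 8 * dyadic k.+1 * Num.sqrt (ln (M k.+1) / n%:R)) &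
  forall l w, sg * dev (fun x => trunc K (f (rep (code K l)) x)) w <= U w.
Proof.
move=> sg1; elim: K => [|K [U mU hU]].
  exists (fun=> 0); first by rewrite big_ord0; exact: mean_bounded_cst.
  move=> l w; rewrite (_ : (fun x => _) = fun x : T => 0 * f l x).
    by rewrite deviationZ// mul0r mulr0.
  apply/funext => x; rewrite mul0r /trunc /dyadic expr1 mulfV ?pnatr_eq0//.
  by case/andP: (f01 (rep (code 0 l)) x) => h0 h1; apply/max_idPr; lra.
pose D (c : C K.+1) x := if `[< exists l, code K.+1 l = c >] then
  sg * (trunc K.+1 (f (rep c) x) - trunc K (f (rep (code K (rep c))) x)) else 0.
have bD c : bounded_measurable (D c).
  rewrite /D; case: asboolP => _; last exact: bmf_cst.
  by apply: bmf_scale; exact: bmf_sub.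
have frep (c : C K.+1) x : `|f (rep c) x - f (rep (code K (rep c))) x| <= dyadic K.
  by apply: code_dist; rewrite repK.
have Ds c x : `|D c x| <= 4 * dyadic K.+1.
  have e0 := dyadic_gt0 K.+1.
  rewrite /D; case: asboolP => _; last by rewrite normr0; lra.
  rewrite normrM sg1 mul1r (le_trans (trunc_dist _ _ _))//.
  have := frep c x; rewrite (dyadicS K); lra.
(* Where [f (rep c)] is below [dyadic K.+1], its parent is below three times this level, so both
   truncations, at twice and at four times the level, vanish. *)
have DM x : #|[pred c | D c x != 0]|%:R <= M K.+1.
  apply: le_trans (code_card K.+1 x); rewrite ler_nat.
  apply: subset_leq_card; apply/fintype.subsetP => c; rewrite !inE => Dc.
  have [lc|nlc] := asboolP (exists l, code K.+1 l = c); last first.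
    by move: Dc; rewrite /D asboolF// eqxx.
  have [l lcE] := lc; exists (rep c); split.
    by rewrite -lcE repK.
  rewrite leNgt; apply: contra Dc => fx; rewrite /D asboolT//.
  have := frep c x; rewrite (dyadicS K) ler_norml => /andP[h1 h2].
  have e0 := dyadic_gt0 K.+1.
  rewrite /trunc (dyadicS K).
  have -> : Num.max (f (rep c) x - 2 * dyadic K.+1) 0 = 0.
    by apply/max_idPr; lra.
  have -> : Num.max (f (rep (code K (rep c))) x - 2 * (2 * dyadic K.+1)) 0 = 0.
    by apply/max_idPr; lra.
  by rewrite subrr mulr0.
have s0 : 0 < 4 * dyadic K.+1 by rewrite mulr_gt0// dyadic_gt0.
have [V mV hV] := maximal_inequality n_gt0 Xlaw Xind s0 (M8 K.+1) bD Ds DM.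
exists (fun w => U w + V w).
  rewrite big_ord_recr/=; apply: mean_bounded_add => //.
  by move: mV; rewrite mulrA -natrM.
move=> l w; set c := code K.+1 l.
have := hV c w; have := hU (rep c) w.
have -> : @deviation R _ _ Omega T P mu n X (D c) w =
    sg * (dev (fun x => trunc K.+1 (f (rep c) x)) w -
      dev (fun x => trunc K (f (rep (code K (rep c))) x)) w).
  rewrite /D asboolT; last by exists l.
  rewrite -/dev deviationZ; last exact: bmf_sub.
  congr (_ * _); rewrite -mulN1r -deviationZ// -deviationD//.
    by congr (dev _ w); apply/funext => x; rewrite mulN1r.
  exact: bmf_scale.
move: (dev (fun x => trunc K.+1 (f (rep c) x)) w)
  (dev (fun x => trunc K (f (rep (code K (rep c))) x)) w) => a b.
rewrite mulrBr; lra.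
Qed.

Lemma chaining (sg : R) (K : nat) : `|sg| = 1 ->
  exists2 U, mean_bounded P U
    (\sum_(k < K) 8 * dyadic k.+1 * Num.sqrt (ln (M k.+1) / n%:R) + 6 * dyadic K) &
  forall l w, sg * deviation mu X (f l) w <= U w.
Proof.
move=> sg1; have [U mU hU] := link_bound K sg1.
exists (fun w => U w + 6 * dyadic K).
  by apply: mean_bounded_add => //; exact: mean_bounded_cst.
move=> l w; set t := fun x => trunc K (f (rep (code K l)) x).
have bt : bounded_measurable t by exact: btrunc.
have -> : f l = fun x => (f l x - t x) + t x by apply/funext => x; rewrite subrK.
have bft : bounded_measurable (fun x => f l x - t x) by exact: bmf_sub.
rewrite -/dev deviationD// mulrDr [leRHS]addrC.
apply: lerD; last exact: hU.
apply: le_trans (ler_norm _) _; rewrite normrM sg1 mul1r.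
(* The representative is within [dyadic K], truncation moves it by at most [2 * dyadic K], and a
   deviation doubles sup norms. *)
have -> : 6 * dyadic K = 2 * (3 * dyadic K) by lra.
apply: deviation_bound => // x.
have := @code_dist K (rep (code K l)) l (repK _ _) x.
rewrite /t /trunc ler_norml => /andP[h1 h2]; have e0 := dyadic_gt0 K.
have /andP[f0 f1] := f01 (rep (code K l)) x; have /andP[f2 f3] := f01 l x.
rewrite ler_norml.
by case: (leP (f (rep (code K l)) x - 2 * dyadic K) 0) => h3; apply/andP; split; lra.
Qed.

End chaining.

(** Jensen's inequality: under the weights [2 ^ - (k + 1)] the mean of [k + 1] is 2, hence
    [a + 2 * b]. Concavity enters through the tangent of the square root at [Y ^ 2]. *)
Lemma sum_sqrt_dyadic (R : realType) (K : nat) (a b Y : R) :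
  0 < Y -> 0 <= a -> 0 <= b -> a + 2 * b <= Y ^+ 2 ->
  \sum_(k < K) 2^-1 ^+ k.+1 * Num.sqrt (a + b * k.+1%:R) <= Y :> R.
Proof.
move=> Y0 a0 b0 abY.
have lin (z : R) : 0 <= z -> Num.sqrt z <= (z + Y ^+ 2) / (2 * Y).
  move=> z0; rewrite ler_pdivlMr; last by rewrite mulr_gt0.
  have := sqr_ge0 (Num.sqrt z - Y); rewrite sqrrB sqr_sqrtr//; lra.
have S K' : \sum_(k < K') (2^-1 : R) ^+ k.+1 * (a + b * k.+1%:R + Y ^+ 2) =
    (a + Y ^+ 2) * (1 - 2^-1 ^+ K') + b * (2 - (2 + K'%:R) * 2^-1 ^+ K').
  elim: K' => [|K' IH]; first by rewrite big_ord0; ring.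
  by rewrite big_ord_recr/= IH [2^-1 ^+ K'.+1]exprS -natr1; move: (2^-1 ^+ K') => q; field.
apply: le_trans (_ : \sum_(k < K) ((2^-1 : R) ^+ k.+1 * (a + b * k.+1%:R + Y ^+ 2)) / (2 * Y) <= _).
  apply: ler_sum => k _; rewrite -mulrA ler_wpM2l ?exprn_ge0 ?invr_ge0//.
  by apply: lin; rewrite addr_ge0// mulr_ge0.
rewrite -mulr_suml S ler_pdivrMr; last by rewrite mulr_gt0.
have h : 0 <= (2^-1 : R) ^+ K by rewrite exprn_ge0// invr_ge0.
have : 0 <= (a + Y ^+ 2) * 2^-1 ^+ K by rewrite mulr_ge0// addr_ge0// sqr_ge0.
have : 0 <= b * ((2 + K%:R) * 2^-1 ^+ K).
  by rewrite !mulr_ge0// addr_ge0.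
nra.
Qed.

(** * Duality for discrete second marginals *)

Lemma bmf_ln d (T : measurableType d) (R : realType) (f : T -> R) (l : R) :
  0 < l -> (forall x, l <= f x) -> bounded_measurable f ->
  bounded_measurable (fun x => ln (f x)).
Proof.
move=> l0 lf [mf [C fC]]; split; first by apply: measurableT_comp => //; exact: measurable_ln.
have f0 x : 0 < f x by exact: lt_le_trans (lf x).
exists (Num.max `|ln l| `|ln C|) => x; rewrite ler_norml; apply/andP; split.
  rewrite lerNl le_max -normrN; apply/orP; left.
  by rewrite (le_trans _ (ler_norm _))// lerN2 ler_ln ?posrE.
rewrite le_max; apply/orP; right; rewrite (le_trans _ (ler_norm _))//.
have fxC : f x <= C by rewrite (le_trans (ler_norm _)).
by rewrite ler_ln ?posrE//; exact: lt_le_trans fxC.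
Qed.

Lemma bmf_inv d (T : measurableType d) (R : realType) (f : T -> R) (l : R) :
  0 < l -> (forall x, l <= f x) -> bounded_measurable f ->
  bounded_measurable (fun x => (f x)^-1).
Proof.
move=> l0 lf bf; rewrite (_ : (fun x => _) = fun x => expR (- ln (f x))).
  by apply: bmf_exp; apply: bmf_opp; exact: bmf_ln l0 lf bf.
by apply/funext => x; rewrite expRN lnK// posrE; exact: lt_le_trans (lf x).
Qed.

Section sinkhorn.
Context {R : realType} {d : measure_display} {T : measurableType d}
  (mu : probability T R) {N : nat}.
Variables (w : 'I_N -> R) (k : 'I_N -> T -> R) (kap : R).
Hypotheses (w0 : forall i, 0 <= w i) (w1 : \sum_i w i = 1).
Hypotheses (bk : forall i, bounded_measurable (k i)) (kap0 : 0 < kap).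
Hypothesis k1 : forall i x, kap <= k i x <= 1.

(** For [k] the Gibbs kernel of the cost, [- ln] of this function is the potential of the first
    marginal that normalizes the potentials [s] of the atoms. *)
Definition partition_fun (s : 'I_N -> R) (x : T) : R :=
  \sum_i w i * (expR (s i) * k i x).

Let A := partition_fun.

Let k0 i x : 0 < k i x.
Proof. by case/andP: (k1 i x) => h _; exact: lt_le_trans h. Qed.

Let bA s : bounded_measurable (A s).
Proof. by apply: bmf_sum => i; do 2 apply: bmf_scale. Qed.

Let Alow s : {l : R | 0 < l & forall x, l <= A s x}.
Proof.
exists (kap * \sum_i w i * expR (s i)).
  rewrite mulr_gt0// lt_neqAle sumr_ge0 ?andbT; last first.
    by move=> i _; rewrite mulr_ge0// expR_ge0.
  apply/eqP => h; have := w1; rewrite big1 => [/eqP|i _].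
    by rewrite eq_sym oner_eq0.
  have /(_ i isT)/eqP := psumr_eq0P (fun i _ => mulr_ge0 (w0 i) (expR_ge0 (s i))) (esym h).
  by rewrite mulf_eq0 expR_eq0 orbF => /eqP.
move=> x; rewrite mulr_sumr; apply: ler_sum => i _.
rewrite mulrCA; apply: ler_wpM2l => //; rewrite mulrC ler_wpM2l ?expR_ge0//.
by case/andP: (k1 i x).
Qed.

Lemma partition_fun_gt0 s x : 0 < A s x.
Proof. by have [l l0 lA] := Alow s; exact: lt_le_trans (lA x). Qed.

Lemma bmf_partition_fun_inv s : bounded_measurable (fun x => (A s x)^-1).
Proof. by have [l l0 lA] := Alow s; exact: bmf_inv l0 lA (bA s). Qed.

Lemma bmf_ln_partition_fun s : bounded_measurable (fun x => ln (A s x)).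
Proof. by have [l l0 lA] := Alow s; exact: bmf_ln l0 lA (bA s). Qed.

(** The entropic dual objective in units of [eps], with the potential of the first marginal
    eliminated. *)
Let G s := - (\int[mu]_x ln (A s x)) + \sum_i w i * s i.

Let A_le (s t : 'I_N -> R) (e : R) : (forall i, t i <= s i + e) ->
  forall x, A t x <= expR e * A s x.
Proof.
move=> ts x; rewrite mulr_sumr; apply: ler_sum => i _.
rewrite [leRHS]mulrCA ler_wpM2l// [leRHS]mulrA ler_wpM2r ?(ltW (k0 i x))//.
by rewrite -expRD ler_expR addrC.
Qed.

Let lnA_le (s t : 'I_N -> R) (e : R) : (forall i, t i <= s i + e) ->
  forall x, ln (A t x) <= e + ln (A s x).
Proof.
move=> ts x; rewrite -[X in X + _]expRK -lnM ?posrE ?expR_gt0 ?partition_fun_gt0//.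
rewrite ler_ln ?posrE ?mulr_gt0 ?expR_gt0 ?partition_fun_gt0//.
exact: A_le.
Qed.

Let G_le (s t : 'I_N -> R) (e : R) : (forall i, `|t i - s i| <= e) -> G t <= G s + 2 * e.
Proof.
move=> ts; rewrite mulrDl mul1r addrACA lerD//.
  rewrite lerNl opprD opprK lerBlDr addrC.
  rewrite -[X in X + _](bmf_int_cst mu) -bmf_intD; first last.
  - exact: bmf_ln_partition_fun.
  - exact: bmf_cst.
  apply: bmf_le; first exact: bmf_ln_partition_fun.
    by apply: bmf_add; [exact: bmf_cst|exact: bmf_ln_partition_fun].
  by apply: lnA_le => i; have := ts i; rewrite ler_norml => /andP[]; lra.
rewrite -[e]mul1r -w1 mulr_suml -big_split/=; apply: ler_sum => i _.
by rewrite -mulrDr ler_wpM2l//; have := ts i; rewrite ler_norml => /andP[]; lra.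
Qed.

Let G_shift s c : G (fun i => s i + c) = G s.
Proof.
rewrite /G (_ : (fun x => ln _) = fun x => c + ln (A s x)); last first.
  apply/funext => x; rewrite (_ : A _ x = expR c * A s x).
    by rewrite lnM ?posrE ?expR_gt0 ?partition_fun_gt0// expRK.
  rewrite /A /partition_fun mulr_sumr; apply: eq_bigr => i _.
  by rewrite expRD; ring.
rewrite bmf_intD; first last.
- exact: bmf_ln_partition_fun.
- exact: bmf_cst.
rewrite bmf_int_cst; under [X in _ + X = _]eq_bigr do rewrite mulrDr.
rewrite big_split/= -mulr_suml w1; ring.
Qed.

Let Z s i := \int[mu]_x (expR (s i) * k i x / A s x).

Let bZ s i : bounded_measurable (fun x => expR (s i) * k i x / A s x).
Proof. by apply: bmf_mul; [exact: bmf_scale|exact: bmf_partition_fun_inv]. Qed.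

Let I s := \int[mu]_x (A s x)^-1.

Let I_gt0 s : 0 < I s.
Proof.
have [mA [C AC]] := bA s.
have C0 : 0 < C by rewrite (lt_le_trans _ (AC point))// normr_gt0 gt_eqF// partition_fun_gt0.
apply: (@lt_le_trans _ _ C^-1); first by rewrite invr_gt0.
rewrite -[leLHS](bmf_int_cst mu); apply: bmf_le.
- exact: bmf_cst.
- exact: bmf_partition_fun_inv.
- move=> x; rewrite lef_pV2 ?posrE ?partition_fun_gt0//.
  by rewrite (le_trans (ler_norm _)).
Qed.

Let Z_bounds s i : expR (s i) * kap * I s <= Z s i <= expR (s i) * I s.
Proof.
apply/andP; split; rewrite /I -bmf_intZ; try exact: bmf_partition_fun_inv.
  apply: bmf_le => //; first by apply: bmf_scale; exact: bmf_partition_fun_inv.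
  move=> x; rewrite ler_wpM2r ?invr_ge0 ?(ltW (partition_fun_gt0 _ _))// ler_wpM2l ?expR_ge0//.
  by case/andP: (k1 i x).
apply: bmf_le => //; first by apply: bmf_scale; exact: bmf_partition_fun_inv.
move=> x; rewrite ler_wpM2r ?invr_ge0 ?(ltW (partition_fun_gt0 _ _))// ler_piMr ?expR_ge0//.
by case/andP: (k1 i x).
Qed.

Let Z_gt0 s i : 0 < Z s i.
Proof.
case/andP: (Z_bounds s i) => + _; apply: lt_le_trans.
by rewrite !mulr_gt0// expR_gt0.
Qed.

Let sumZ s : \sum_i w i * Z s i = 1.
Proof.
under eq_bigr do rewrite -bmf_intZ//.
rewrite -bmf_int_sum; last by move=> i; exact: bmf_scale.
rewrite -[RHS](bmf_int_cst mu); apply: eq_Rintegral => x _.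
under eq_bigr do rewrite mulrA.
by rewrite -mulr_suml divff// gt_eqF// partition_fun_gt0.
Qed.

(* One Sinkhorn step increases G, strictly unless the marginal constraint
   already holds. *)
Let G_step s : G (fun i => s i - ln (Z s i)) >=
  G s + \sum_i w i * (Z s i - 1 - ln (Z s i)).
Proof.
pose s' i := s i - ln (Z s i); rewrite -/s'.
have A' x : A s' x = \sum_i w i / Z s i * (expR (s i) * k i x).
  by apply: eq_bigr => i _; rewrite /s' expRB lnK ?posrE//; ring.
have h : \int[mu]_x ln (A s' x) <= \int[mu]_x ln (A s x).
  rewrite -[leLHS]addr0 -lerBrDl.
  rewrite -bmf_intB; try exact: bmf_ln_partition_fun.
  have -> : 0 = \int[mu]_x (1 - \sum_i w i / Z s i * (expR (s i) * k i x / A s x)).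
    have b1 i : bounded_measurable (fun x => w i / Z s i * (expR (s i) * k i x / A s x)).
      exact: bmf_scale.
    rewrite bmf_intB; first last.
    - exact: bmf_sum.
    - exact: bmf_cst.
    rewrite bmf_int_cst bmf_int_sum//.
    rewrite (eq_bigr w) ?w1 ?subrr// => i _.
    by rewrite bmf_intZ// -/(Z s i) divfK// gt_eqF.
  apply: bmf_le.
  - apply: bmf_sub; first exact: bmf_cst.
    by apply: bmf_sum => i; exact: bmf_scale.
  - by apply: bmf_sub; exact: bmf_ln_partition_fun.
  move=> x; have As := partition_fun_gt0 s x; have As' := partition_fun_gt0 s' x.
  have -> : \sum_i w i / Z s i * (expR (s i) * k i x / A s x) = A s' x / A s x.
    by rewrite A' mulr_suml; apply: eq_bigr => i _; rewrite mulrA.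
  rewrite -[leRHS]opprB lerNr opprB -ln_div ?posrE//.
  rewrite [X in ln X](_ : _ = 1 + (A s' x / A s x - 1)); last by ring.
  by rewrite le_ln1Dx//; have := divr_gt0 As' As; lra.
rewrite /G /s'; under [X in _ <= _ + X]eq_bigr do rewrite mulrBr.
under [X in _ + X <= _]eq_bigr do rewrite mulrBr mulrBr mulr1.
rewrite !sumrB sumZ w1 subrr sub0r.
move: (\sum_i w i * s i) (\sum_i w i * ln (Z s i)) => a b.
move: (\int[mu]_x ln (A s x)) (\int[mu]_x ln (A s' x)) h => I1 I2 h.
lra.
Qed.

(** By [Z_bounds], one Sinkhorn step from any point lands in this box up to a common shift, which
    leaves [G] unchanged; hence no step can exceed the maximum of [G] over this compact set. *)
Let box := [set v : 'rV[R]_N | forall i, `[ln kap, 0]%classic (v ord0 i)].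

Lemma sinkhorn : exists s : 'I_N -> R,
  forall i, \int[mu]_x (expR (s i) * k i x / A s x) = 1.
Proof.
have kap1 : kap <= 1.
  have [i|nI] := pickP (fun i : 'I_N => true).
    by move=> _; case/andP: (k1 i point); exact: le_trans.
  by have := w1; rewrite big_pred0// => /eqP; rewrite eq_sym oner_eq0.
have lk : ln kap <= 0 by exact: ln_le0.
have box0 : box !=set0.
  by exists (\row_i 0) => i; rewrite mxE /= in_itv/= lk lexx.
have boxc : compact box.
  by apply: (@rV_compact R N (fun=> `[ln kap, 0]%classic)) => i; exact: segment_compact.
pose G' (v : 'rV[R]_N) := G (fun i => v ord0 i).
have cG : {within box, continuous G'}.
  apply: continuous_subspaceT => v.
  have FF : ProperFilter (nbhs v) by exact: nbhs_pfilter.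
  apply/(@cvgrPdist_le _ _ _ _ FF) => e e0.
  apply/nbhs_ballP; exists (e / 2) => /=; first by rewrite divr_gt0.
  move=> u /= [_ vu].
  have vu' i : `|v ord0 i - u ord0 i| <= e / 2 by apply: ltW; exact: vu.
  have := @G_le (fun i => u ord0 i) (fun i => v ord0 i) (e / 2) vu'.
  have := @G_le (fun i => v ord0 i) (fun i => u ord0 i) (e / 2).
  rewrite -/(G' u) -/(G' v) ler_norml => h1 h2.
  have {}h1 := h1 (fun i => etrans (congr1 (fun z => z <= _) (distrC _ _)) (vu' i)).
  by apply/andP; split; lra.
have [v _ vmax] := EVT_max_rV box0 boxc cG.
pose s i := v ord0 i.
have Gmax t : G (fun i => t i - ln (Z t i)) <= G s.
  pose c := ln (kap * I t).
  have -> : G (fun i => t i - ln (Z t i)) =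
      G' (\row_i (t i - ln (Z t i) + c)).
    rewrite -(G_shift _ c); congr G; apply/funext => i; by rewrite mxE.
  apply: vmax; rewrite inE => i /=; rewrite mxE in_itv/=.
  have kI : 0 < kap * I t by rewrite mulr_gt0.
  have /andP[Z1 Z2] := Z_bounds t i.
  have h1 : ln (Z t i) <= t i + ln (I t).
    by rewrite -[t i]expRK -lnM ?posrE ?expR_gt0// ler_ln ?posrE ?mulr_gt0 ?expR_gt0.
  have h2 : t i + c <= ln (Z t i).
    rewrite -[t i]expRK /c -lnM ?posrE ?expR_gt0// ler_ln ?posrE ?mulr_gt0 ?expR_gt0//.
    by rewrite mulrA.
  have h3 : c = ln kap + ln (I t) by rewrite /c lnM ?posrE.
  by apply/andP; split; lra.
(* A step from the maximizer cannot increase [G], so each nonnegative term of the gain vanishes. *)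
have wZ i : w i * (Z s i - 1 - ln (Z s i)) = 0.
  have pos j : 0 <= w j * (Z s j - 1 - ln (Z s j)).
    apply: mulr_ge0 => //; have Zj := Z_gt0 s j.
    by have := @le_ln1Dx R (Z s j - 1) ltac:(lra); rewrite subrKC; lra.
  apply: (psumr_eq0P (P := predT) (F := fun i => w i * (Z s i - 1 - ln (Z s i)))) => //.
  apply/eqP; rewrite eq_le sumr_ge0// andbT.
  have := G_step s; have := Gmax s; lra.
have wZ1 i : w i * ln (Z s i) = 0.
  have [->|Z1] := eqVneq (Z s i) 1; first by rewrite ln1 mulr0.
  have /eqP := wZ i; rewrite mulf_eq0 => /orP[/eqP->|]; first by rewrite mul0r.
  have lnZ : ln (Z s i) != 0 by rewrite ln_eq0.
  have := @expR_gt1Dx R _ lnZ; rewrite lnK ?posrE// => h /eqP h'; exfalso; lra.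
(* Maximality gives no information on [Z s i] when [w i = 0]. One more step normalizes these indices
   too and does not change [A]. *)
exists (fun i => s i - ln (Z s i)) => i.
have -> : A (fun i => s i - ln (Z s i)) = A s.
  apply/funext => x; apply: eq_bigr => j _.
  have /eqP := wZ1 j; rewrite mulf_eq0 => /orP[/eqP->|/eqP->]; first by rewrite !mul0r.
  by rewrite subr0.
under eq_Rintegral do rewrite expRB lnK ?posrE// -[_ / Z s i]mulrC -2!mulrA mulrA.
rewrite (_ : (fun x => _) = fun x => (Z s i)^-1 * (expR (s i) * k i x / A s x)); last first.
  by apply/funext => x; ring.
by rewrite bmf_intZ// -/(Z s i) mulVf// gt_eqF.
Qed.

End sinkhorn.

Section discrete_integral.
Context {R : realType} {d : measure_display} {T : measurableType d} {N : nat}.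
Variables (w : 'I_N -> R) (z : 'I_N -> T) (nu : probability T R).
Hypothesis w0 : forall i, 0 <= w i.
Hypothesis nuE : forall B, measurable B ->
  nu B = (\sum_i (w i)%:E * \d_(z i) B)%E.

Let atom (k : nat) : {measure set T -> \bar R} :=
  if insub k is Some i then mscale (NngNum (w0 i)) \d_(z i) else mzero.

Lemma ge0_integral_discrete (f : T -> \bar R) : measurable_fun setT f ->
  (forall x, 0 <= f x)%E -> (\int[nu]_x f x = \sum_i (w i)%:E * f (z i))%E.
Proof.
move=> mf f0; transitivity (\int[msum atom N]_x f x)%E.
  apply: eq_measure_integral => A mA _; apply: etrans (nuE mA) _.
  apply: eq_bigr => i _.
  by rewrite /atom valK.
rewrite ge0_integral_measure_sum//; apply: eq_bigr => i _.
by rewrite /atom valK ge0_integral_mscale//= integral_dirac// diracT mul1e.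
Qed.

Hypothesis w1 : \sum_i w i = 1.

Lemma Rintegral_discrete (f : T -> R) : bounded_measurable f ->
  \int[nu]_x f x = \sum_i w i * f (z i).
Proof.
move=> bf; have [mf [C fC]] := bf.
have := @ge0_integral_discrete (fun x => (f x + C)%:E).
rewrite bmf_integralE; last by apply: bmf_add => //; exact: bmf_cst.
rewrite bmf_intD//; last exact: bmf_cst.
rewrite bmf_int_cst => /(_ _ _)/eqP.
under eq_bigr do rewrite -EFinM mulrDr.
rewrite sumEFin big_split/= -mulr_suml w1 mul1r eqe => h.
apply: (addIr C); apply/eqP/h.
  by apply/measurable_EFinP; apply: measurable_funD.
by move=> x; rewrite lee_fin -lerBlDr sub0r; have := fC x; rewrite ler_norml => /andP[].
Qed.

End discrete_integral.

Lemma measurable_lne_fin_num d (T : measurableType d) (R : realType)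
    (f : T -> \bar R) : measurable_fun setT f -> (forall x, f x \is a fin_num) ->
  measurable_fun setT (fun x => lne (f x)).
Proof.
move=> mf ff; rewrite (_ : (fun x => _) = fun x =>
  if (fine (f x) <= 0)%R then -oo%E else (ln (fine (f x)))%:E); last first.
  by apply/funext => x; rewrite -{1}(fineK (ff x)).
have mff : measurable_fun setT (fun x => fine (f x)).
  by apply: measurableT_comp => //; exact: fine_measurable.
apply: measurable_fun_ifT => //; first exact: measurable_fun_ler.
apply/measurable_EFinP; apply: measurableT_comp => //; exact: measurable_ln.
Qed.

Section couplings.
Context {R : realType} {d : measure_display} {T : measurableType d}
  {mu nu : probability T R} {g : probability (T * T)%type R}.
Hypothesis cg : coupling mu nu g.

Lemma bmf_fst (f : T -> R) : bounded_measurable f ->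
  bounded_measurable (fun z : T * T => f z.1).
Proof. by move=> bf; exact: (bmf_comp (@measurable_fst _ _ T T) bf). Qed.

Lemma bmf_snd (f : T -> R) : bounded_measurable f ->
  bounded_measurable (fun z : T * T => f z.2).
Proof. by move=> bf; exact: (bmf_comp (@measurable_snd _ _ T T) bf). Qed.

Lemma Rintegral_coupling_fst (f : T -> R) : bounded_measurable f ->
  \int[g]_z f z.1 = \int[mu]_x f x.
Proof.
move=> bf; congr fine; have [gmu _] := cg.
rewrite -(@integral_pushforward _ _ _ _ R fst _ g setT (EFin \o f))//; first last.
- exact: (bmf_integrable g (bmf_fst bf)).
- by apply/measurable_EFinP; case: bf.
apply: eq_measure_integral => A mA _; apply: etrans _ (gmu _ mA).
by congr (g _); apply/seteqP; split => -[x y]//= [].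
Qed.

Lemma Rintegral_coupling_snd (f : T -> R) : bounded_measurable f ->
  \int[g]_z f z.2 = \int[nu]_x f x.
Proof.
move=> bf; congr fine; have [_ gnu] := cg.
rewrite -(@integral_pushforward _ _ _ _ R snd _ g setT (EFin \o f))//; first last.
- exact: (bmf_integrable g (bmf_snd bf)).
- by apply/measurable_EFinP; case: bf.
apply: eq_measure_integral => A mA _; apply: etrans _ (gnu _ mA).
by congr (g _); apply/seteqP; split => -[x y]//= [].
Qed.

End couplings.

Section duality.
Context {R : realType} {d : measure_display} {T : measurableType d} {N : nat}.
Variables (mu nu : probability T R) (w : 'I_N -> R) (z : 'I_N -> T).
Hypotheses (w0 : forall i, 0 <= w i) (w1 : \sum_i w i = 1).
Hypothesis nuE : forall B, measurable B ->
  nu B = (\sum_i (w i)%:E * \d_(z i) B)%E.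
Variables (c : T * T -> R) (M eps : R).
Hypotheses (mc : measurable_fun setT c) (c0 : forall x, 0 <= c x <= M).
Hypothesis eps0 : 0 < eps.

Definition gibbs (i : 'I_N) (x : T) : R := expR (- (c (x, z i) / eps)).

Let kap := expR (- (M / eps)).

Lemma gibbs_bounds i x : kap <= gibbs i x <= 1.
Proof.
case/andP: (c0 (x, z i)) => h0 h1; rewrite /gibbs /kap ler_expR lerN2 expR_le1.
by rewrite ler_wpM2r ?invr_ge0 ?(ltW eps0)//= oppr_le0 divr_ge0// ltW.
Qed.

Lemma bmf_cost : bounded_measurable c.
Proof.
split=> //; exists M => x; case/andP: (c0 x) => h0 h1.
by rewrite ger0_norm.
Qed.

Lemma bmf_gibbs i : bounded_measurable (gibbs i).
Proof.
split.
  apply: measurableT_comp => //; apply: measurableT_comp => //.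
  by apply: measurable_funM => //; exact: measurable_fun_pair1.
exists 1 => x; rewrite ger0_norm ?expR_ge0//.
by case/andP: (gibbs_bounds i x).
Qed.

Definition dual_value (m : probability T R) (s : 'I_N -> R) : R :=
  - eps * (\int[m]_x ln (partition_fun w gibbs s x)) + eps * \sum_i w i * s i.

(* The potential of the second marginal is a function on T, not only on the
   indices: atoms may coincide. *)
Lemma strong_duality : exists sig : T -> R, [/\ bounded_measurable sig,
  (transport_cost c mu nu <= (dual_value mu (sig \o z))%:E)%E &
  (entropic_cost c eps mu nu <= (dual_value mu (sig \o z) - eps)%:E)%E].
Proof.
have [s Hs] := sinkhorn mu w0 w1 bmf_gibbs (expR_gt0 _) gibbs_bounds.
pose A := partition_fun w gibbs s.
have A0 x : 0 < A x := partition_fun_gt0 w0 w1 (expR_gt0 _) gibbs_bounds s x.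
have bAi : bounded_measurable (fun x => (A x)^-1) :=
  bmf_partition_fun_inv w0 w1 bmf_gibbs (expR_gt0 _) gibbs_bounds s.
have blA : bounded_measurable (fun x => ln (A x)) :=
  bmf_ln_partition_fun w0 w1 bmf_gibbs (expR_gt0 _) gibbs_bounds s.
pose e (v : T * T) := expR (- (c v / eps)).
have be : bounded_measurable e.
  apply: bmf_exp; apply: bmf_opp; apply: bmf_mul; last exact: bmf_cst.
  exact: bmf_cost.
have ek v : kap <= e v <= 1.
  case/andP: (c0 v) => h0 h1; rewrite /e /kap ler_expR lerN2 expR_le1.
  by rewrite ler_wpM2r ?invr_ge0 ?(ltW eps0)//= oppr_le0 divr_ge0// ltW.
pose q (v : T * T) := e v / A v.1.
have bq : bounded_measurable q by apply: bmf_mul => //; exact: (bmf_fst bAi).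
have q0 v : 0 < q v by rewrite divr_gt0// expR_gt0.
have bqy y : bounded_measurable (fun x => q (x, y)).
  exact: (bmf_comp (pair2_measurable y) bq).
pose J y := \int[mu]_x q (x, y).
have mJ : measurable_fun setT J.
  apply/measurable_EFinP.
  rewrite (_ : EFin \o J = fun y => (\int[mu]_x (q (x, y))%:E)%E).
    apply: (@measurable_fun_fubini_tonelli_G _ _ T T R mu (EFin \o q)).
      by apply/measurable_EFinP; case: bq.
    by move=> v; rewrite lee_fin ltW.
  by apply/funext => y; rewrite bmf_integralE.
pose I0 := \int[mu]_x (A x)^-1.
have I0_gt0 : 0 < I0.
  have := Hs; have [i _] : exists i : 'I_N, true.
    have [i|nI] := pickP (fun i : 'I_N => true); first by exists i.
    by have := w1; rewrite big_pred0// => /eqP; rewrite eq_sym oner_eq0.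
  move=> /(_ i) hi; rewrite lt_neqAle andbC.
  have I0_ge0 : 0 <= I0 by apply: Rintegral_ge0 => x _; rewrite invr_ge0 ltW.
  rewrite I0_ge0/=; apply/eqP => I00.
  have : (1 : R) <= expR (s i) * I0.
    rewrite -hi /I0 -bmf_intZ//; apply: bmf_le.
    - by apply: bmf_mul => //; apply: bmf_scale; exact: bmf_gibbs.
    - exact: bmf_scale.
    - move=> x; rewrite ler_wpM2r ?invr_ge0 ?(ltW (A0 _))// ler_piMr ?expR_ge0//.
      by case/andP: (gibbs_bounds i x).
  by rewrite -I00 mulr0 ler10.
have Jlow y : kap * I0 <= J y.
  rewrite /I0 -bmf_intZ//; apply: bmf_le => //; first exact: bmf_scale.
  by move=> x; rewrite ler_wpM2r ?invr_ge0 ?(ltW (A0 _))//; case/andP: (ek (x, y)).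
have kI0 : 0 < kap * I0 by rewrite mulr_gt0// expR_gt0.
have J0 y : 0 < J y by exact: lt_le_trans (Jlow y).
have bJ : bounded_measurable J.
  split=> //; exists I0 => y; rewrite ger0_norm ?(ltW (J0 _))//.
  apply: bmf_le => // x; rewrite ler_piMl ?invr_ge0 ?(ltW (A0 _))//.
  by case/andP: (ek (x, y)).
(* The same formula at every point of [T]; at an atom it returns [s i] by the Sinkhorn condition, so
   equal atoms get equal potentials. *)
pose sig y := - ln (J y).
have bsig : bounded_measurable sig by apply: bmf_opp; exact: bmf_ln kI0 Jlow bJ.
have sigz i : sig (z i) = s i.
  have := Hs i; rewrite (_ : (fun x => _) = fun x => expR (s i) * q (x, z i)); last first.
    by apply/funext => x; rewrite /q /= -mulrA.
  rewrite bmf_intZ// -/(J (z i)) => h.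
  have : ln (expR (s i) * J (z i)) = 0 by rewrite h ln1.
  by rewrite lnM ?posrE ?expR_gt0// expRK /sig; lra.
(* Density of the optimal coupling with respect to [mu \x nu]. Both marginal conditions hold at
   every point, not only almost everywhere. *)
pose h (v : T * T) := q v / J v.2.
have bJi : bounded_measurable (fun y => (J y)^-1) by exact: bmf_inv kI0 Jlow bJ.
have bh : bounded_measurable h by apply: bmf_mul => //; exact: (bmf_snd bJi).
have h0 v : 0 < h v by rewrite divr_gt0.
have mh : measurable_fun setT h by case: bh.
have hx x : (\int[nu]_y (h (x, y))%:E = 1)%E.
  rewrite (ge0_integral_discrete w0 nuE); first last.
  - by move=> y; rewrite lee_fin ltW.
  - apply/measurable_EFinP; exact: (measurableT_comp mh (pair1_measurable x)).
  under eq_bigr do rewrite -EFinM.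
  rewrite sumEFin; congr EFin.
  rewrite (eq_bigr (fun i => w i * (expR (s i) * gibbs i x) * (A x)^-1)).
    by rewrite -mulr_suml; exact: divff (lt0r_neq0 (A0 x)).
  move=> i _; rewrite /h /q /=.
  have -> : expR (s i) = (J (z i))^-1 by rewrite -sigz /sig expRN lnK ?posrE.
  rewrite /gibbs /e; ring.
have hy y : (\int[mu]_x (h (x, y))%:E = 1)%E.
  rewrite bmf_integralE; last exact: (bmf_comp (pair2_measurable y) bh).
  rewrite (_ : (fun x => h (x, y)) = fun x => (J y)^-1 * q (x, y)); last first.
    by apply/funext => x; rewrite mulrC.
  by rewrite bmf_intZ// -/(J y) mulVf// gt_eqF.
pose xi : probability (T * T)%type R := (mu \x nu)%E.
have h1 : (\int[xi]_v (h v)%:E = 1)%E.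
  rewrite fubini_tonelli1//=; first last.
  - by move=> v; rewrite lee_fin ltW.
  - exact/measurable_EFinP.
  rewrite /fubini_F; under eq_integral do rewrite hx.
  by rewrite integral_cst// mul1e; exact: probability_setT.
have [g [gdom gRN gE gI]] := @density_probability _ _ R xi h mh (fun v => ltW (h0 v)) h1.
have cg : coupling mu nu g.
  split=> B mB.
    rewrite gE; last exact: measurableX.
    rewrite integral_mkcond fubini_tonelli1/=; first last.
    - by move=> v; rewrite patchE; case: ifP => _ //; rewrite lee_fin ltW.
    - apply/(measurable_restrictT _ _).1; first exact: measurableX.
      by apply/measurable_EFinP; exact: measurable_funTS.
    rewrite -[RHS]mul1e -integral_cst// [RHS]integral_mkcond.
    apply: eq_integral => x _; rewrite /fubini_F patchE.
    case: ifPn => xB.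
      rewrite -[RHS](hx x); apply: eq_integral => y _.
      by rewrite patchE ifT// inE; split => //; rewrite inE in xB.
    rewrite integral0_eq// => y _.
    rewrite patchE ifF//; apply/negP => /set_mem[/= xB' _].
    by move/negP: xB; apply; exact/mem_set.
  rewrite gE; last exact: measurableX.
  rewrite integral_mkcond.
  have m1 : measurable_fun setT ((fun v => (h v)%:E) \_ (setT `*` B)).
    apply/(measurable_restrictT _ _).1; first exact: measurableX.
    by apply/measurable_EFinP; exact: measurable_funTS.
  have p1 v : (0 <= ((fun v => (h v)%:E) \_ (setT `*` B)) v)%E.
    by rewrite patchE; case: ifP => _ //; rewrite lee_fin ltW.
  rewrite fubini_tonelli1//= fubini_tonelli//.
  rewrite -[RHS]mul1e -integral_cst// [RHS]integral_mkcond.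
  apply: eq_integral => y _; rewrite /fubini_G patchE.
  case: ifPn => xB.
    rewrite -[RHS](hy y); apply: eq_integral => x _.
    by rewrite patchE ifT// inE; split => //; rewrite inE in xB.
  rewrite integral0_eq// => x _.
  rewrite patchE ifF//; apply/negP => /set_mem[/= _ xB'].
  by move/negP: xB; apply; exact/mem_set.
have lhE v : ln (h v) = sig v.2 - ln (A v.1) - c v / eps.
  rewrite /h ln_div ?posrE// /q ln_div ?posrE// ?expR_gt0// expRK /sig; ring.
have blh : bounded_measurable (fun v => ln (h v)).
  rewrite (_ : (fun v => _) = fun v => sig v.2 - ln (A v.1) - c v / eps).
    apply: bmf_sub; first by apply: bmf_sub; [exact: bmf_snd|exact: (bmf_fst blA)].
    by apply: bmf_mul; [exact: bmf_cost|exact: bmf_cst].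
  exact/funext.
pose L := \int[g]_v ln (h v).
have cost : \int[g]_v c v = dual_value mu s - eps * L.
  rewrite /L (_ : (fun v => c v) =
      fun v => eps * (sig v.2 - ln (A v.1) - ln (h v))); last first.
    by apply/funext => v; rewrite lhE; field; rewrite gt_eqF.
  have bs2 := bmf_snd bsig; have bA1 := bmf_fst blA.
  rewrite bmf_intZ; last by apply: bmf_sub => //; exact: bmf_sub.
  rewrite bmf_intB//; last exact: bmf_sub.
  rewrite bmf_intB// (Rintegral_coupling_fst cg blA) (Rintegral_coupling_snd cg bsig).
  rewrite (Rintegral_discrete w0 nuE w1 bsig).
  by under eq_bigr do rewrite sigz; rewrite /dual_value -/A; ring.
(* [L] is a relative entropy; dropping it from the identity [cost] gives the bound on the transport
   cost. Nonnegativity follows from [1 - 1 / h <= ln h]. *)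
have L0 : 0 <= L.
  have hi : (\int[g]_v ((h v)^-1)%:E <= 1)%E.
    rewrite gI; first last.
    - apply/measurable_EFinP; rewrite (_ : (fun v => _) = fun v => expR (- ln (h v))).
        apply: measurableT_comp => //; apply: measurableT_comp => //.
        by case: blh.
      by apply/funext => v; rewrite expRN lnK ?posrE.
    - by move=> v; rewrite lee_fin invr_ge0 ltW.
    rewrite (eq_integral (cst 1%E)).
      by rewrite integral_cst// mul1e probability_le1.
    by move=> v _; rewrite -EFinM mulVf// gt_eqF.
  have bhi : bounded_measurable (fun v => (h v)^-1).
    rewrite (_ : (fun v => _) = fun v => expR (- ln (h v))).
      by apply: bmf_exp; exact: bmf_opp.
    by apply/funext => v; rewrite expRN lnK ?posrE.
  have : \int[g]_v (1 - (h v)^-1) <= L.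
    apply: bmf_le => //; first by apply: bmf_sub => //; exact: bmf_cst.
    move=> v; have hv : -1 < (h v)^-1 - 1 by have : 0 < (h v)^-1; [rewrite invr_gt0|lra].
    have := le_ln1Dx hv; rewrite subrKC lnV ?posrE//; lra.
  apply: le_trans; rewrite bmf_intB//; last exact: bmf_cst.
  by rewrite bmf_int_cst subr_ge0 -lee_fin -bmf_integralE.
have ss : sig \o z = s by apply/funext => i; exact: sigz.
exists sig; split => //; rewrite ss.
  apply: ge_ereal_inf; exists (\int[g]_v (c v)%:E)%E; first by exists g.
  rewrite bmf_integralE ?lee_fin ?cost; last exact: bmf_cost.
  by rewrite gerBl mulr_ge0// ltW.
apply: ge_ereal_inf; exists (\int[g]_v (c v)%:E + eps%:E * KL g xi)%E.
  by exists g.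
have -> : KL g xi = (L - 1)%:E.
  rewrite /KL asboolT//.
  transitivity (\int[g]_v (ln (h v) - 1)%:E)%E; last first.
    rewrite bmf_integralE; last by apply: bmf_sub => //; exact: bmf_cst.
    by rewrite bmf_intB// ?bmf_int_cst//; exact: bmf_cst.
  apply: ae_eq_integral => //.
  - apply: emeasurable_funB => //; apply: measurable_lne_fin_num => //.
    by move=> v; exact: Radon_Nikodym_fin_num.
  - by apply/measurable_EFinP; apply: measurable_funB => //; case: blh.
  - have := null_dominates_ae_eq measurableT gdom gRN.
    apply: filterS => v /(_ I) hv _.
    by rewrite hv -[(EFin \o h) v]/((h v)%:E) lne_EFin.
rewrite bmf_integralE; last exact: bmf_cost.
by rewrite cost -EFinM -EFinD lee_fin; apply/le_of_eq; ring.
Qed.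

End duality.

(** Holds without integrability, which the integrand of [KL] may lack. Replacing [F] by its maximum
    with [G] makes the comparison hold everywhere, and then for positive and negative parts
    separately. *)
Lemma le_integral_ae d (T : measurableType d) (R : realType)
    (m : {measure set T -> \bar R}) (F G : T -> \bar R) :
  measurable_fun setT F -> measurable_fun setT G ->
  {ae m, forall x, (G x <= F x)%E} -> (\int[m]_x G x <= \int[m]_x F x)%E.
Proof.
move=> mF mG GF.
have mH : measurable_fun setT (fun x => maxe (F x) (G x)) by exact: measurable_maxe.
have -> : (\int[m]_x F x = \int[m]_x maxe (F x) (G x))%E.
  apply: ae_eq_integral => //; apply: filterS GF => x h _.
  by rewrite max_l.
rewrite integralE [leRHS]integralE; apply: leeB.
  apply: ge0_le_integral => //.
  - exact: measurable_funepos.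
  - exact: measurable_funepos.
  - move=> x _; apply: (@funepos_le _ _ setT); last by rewrite inE.
    by move=> y _; rewrite le_max lexx orbT.
apply: ge0_le_integral => //.
- exact: measurable_funeneg.
- exact: measurable_funeneg.
- move=> x _; apply: (@funeneg_le _ _ setT); last by rewrite inE.
  by move=> y _; rewrite le_max lexx orbT.
Qed.

Section weak_duality.
Context {R : realType} {d : measure_display} {T : measurableType d} {N : nat}.
Variables (mu nu : probability T R) (w : 'I_N -> R) (z : 'I_N -> T).
Hypotheses (w0 : forall i, 0 <= w i) (w1 : \sum_i w i = 1).
Hypothesis nuE : forall B, measurable B ->
  nu B = (\sum_i (w i)%:E * \d_(z i) B)%E.
Variables (c : T * T -> R) (M : R).
Hypotheses (mc : measurable_fun setT c) (c0 : forall x, 0 <= c x <= M).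

Let bc : bounded_measurable c := bmf_cost mc c0.

(** The constraint is imposed at atoms of positive weight only, because no coupling charges the
    other values of the second coordinate; measurability of points makes their complement
    measurable. *)
Lemma weak_transport_duality (f g : T -> R) :
  (forall x : T, measurable [set x]) ->
  bounded_measurable f -> bounded_measurable g ->
  (forall x i, 0 < w i -> f x + g (z i) <= c (x, z i)) ->
  ((\int[mu]_x f x + \sum_i w i * g (z i))%:E <= transport_cost c mu nu)%E.
Proof.
move=> m1 bf bg fgc; apply: le_ereal_inf_tmp => _ [gam cg <-].
rewrite bmf_integralE// lee_fin.
have b1 := bmf_fst bf; have b2 := bmf_snd bg.
rewrite -(Rintegral_discrete w0 nuE w1 bg).
rewrite -(Rintegral_coupling_fst cg bf) -(Rintegral_coupling_snd cg bg) -bmf_intD//.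
have b12 := bmf_add b1 b2.
rewrite -lee_fin -!bmf_integralE//; apply: le_integral_ae.
- by apply/measurable_EFinP.
- by apply/measurable_EFinP; case: b12.
pose Y := \bigcup_(i in [set i | 0 < w i]) [set z i].
have mY : measurable Y by apply: fin_bigcup_measurable.
have [_ gnu] := cg.
exists (setT `*` ~` Y); split.
- by apply: measurableX => //; exact: measurableC.
- apply: etrans (gnu _ _) _; first exact: measurableC.
  rewrite nuE; last exact: measurableC.
  rewrite big1// => i _; have := w0 i; rewrite le_eqVlt => /predU1P[<-|wi].
    by rewrite mul0e.
  by rewrite diracE memNset ?mule0//= => h; apply: h; exists i.
- move=> [x y] /= h; split => // -[i /= wi yz]; apply: h.
  by rewrite yz lee_fin; exact: fgc.
Qed.

Variable eps : R.
Hypothesis eps0 : 0 < eps.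

Let kap := expR (- (M / eps)).

Let kb := gibbs_bounds z c0 eps0.
Let bg i : bounded_measurable (gibbs z c eps i) := bmf_gibbs z mc c0 eps0 i.

(** Young's inequality [h - e ^ h / rho <= ln rho - 1], where [rho] is the density of the coupling
    and [h] is the log-density built from [sig] after normalization in the first variable for [mu].
    As [e ^ h] has mass 1 for [mu \x nu], the integral of [e ^ h / rho] against the coupling is at
    most 1. *)
Lemma weak_entropic_duality (sig : T -> R) : bounded_measurable sig ->
  ((dual_value w z c eps mu (sig \o z) - eps)%:E <= entropic_cost c eps mu nu)%E.
Proof.
move=> bs; apply: le_ereal_inf_tmp => _ [g cg <-].
pose xi : probability (T * T)%type R := (mu \x nu)%E.
rewrite bmf_integralE// /KL; case: asboolP => [gdom|_]; last first.
  by rewrite gt0_muley ?lte_fin// addey// leey.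
pose s := sig \o z; pose A := partition_fun w (gibbs z c eps) s.
have A0 x : 0 < A x := partition_fun_gt0 w0 w1 (expR_gt0 _) kb s x.
have blA : bounded_measurable (fun x => ln (A x)) :=
  bmf_ln_partition_fun w0 w1 bg (expR_gt0 _) kb s.
pose h (v : T * T) := sig v.2 - ln (A v.1) - c v / eps.
have bh : bounded_measurable h.
  apply: bmf_sub; last by apply: bmf_mul => //; exact: bmf_cst.
  by apply: bmf_sub; [exact: bmf_snd|exact: (bmf_fst blA)].
pose E v := expR (h v); have bE : bounded_measurable E by exact: bmf_exp.
have E1 : (\int[xi]_v (E v)%:E = 1)%E.
  rewrite fubini_tonelli1//=; first last.
  - by move=> v; rewrite lee_fin expR_ge0.
  - by apply/measurable_EFinP; case: bE.
  transitivity (\int[mu]_x (cst 1 x))%E; last first.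
    by rewrite integral_cst// mul1e; exact: probability_setT.
  apply: eq_integral => x _; rewrite /fubini_F (ge0_integral_discrete w0 nuE); first last.
  - by move=> y; rewrite lee_fin expR_ge0.
  - apply/measurable_EFinP; case: bE => mE _.
    exact: (measurableT_comp mE (pair1_measurable x)).
  under eq_bigr do rewrite -EFinM.
  rewrite sumEFin; congr EFin.
  rewrite (eq_bigr (fun i => w i * (expR (s i) * gibbs z c eps i x) * (A x)^-1)).
    by rewrite -mulr_suml; exact: divff (lt0r_neq0 (A0 x)).
  move=> i _; rewrite /E /h /= expRB expRB lnK ?posrE// /gibbs expRN /s /=; ring.
pose rho := Radon_Nikodym_SigmaFinite.f g xi.
have rho0 v : (0 <= rho v)%E by exact: Radon_Nikodym_SigmaFinite.f_ge0.
have rhof v : rho v \is a fin_num by exact: Radon_Nikodym_SigmaFinite.f_fin_num.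
have mrho : measurable_fun setT rho.
  exact: measurable_int (Radon_Nikodym_SigmaFinite.f_integrable gdom).
have mr : measurable_fun setT (fun v => fine (rho v)).
  by apply: measurableT_comp => //; exact: fine_measurable.
(* [e ^ h / rho], set to 0 where [rho] vanishes, a set that [g] does not charge. *)
pose q v := if fine (rho v) <= 0 then 0 else E v * expR (- ln (fine (rho v))).
have mq : measurable_fun setT q.
  apply: measurable_fun_ifT => //; first exact: measurable_fun_ler.
  apply: measurable_funM; first by case: bE.
  apply: measurableT_comp => //; apply: measurableT_comp => //.
  by apply: measurableT_comp => //; exact: measurable_ln.
have q0 v : 0 <= q v by rewrite /q; case: ifP => // _; rewrite mulr_ge0 ?expR_ge0.
have q1 : (\int[g]_v (q v)%:E <= 1)%E.
  rewrite -(Radon_Nikodym_SigmaFinite.change_of_variables gdom)//; last first.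
    exact/measurable_EFinP.
  rewrite -E1; apply: ge0_le_integral => //.
  - by move=> v _; rewrite mule_ge0// lee_fin.
  - by apply: emeasurable_funM => //; exact/measurable_EFinP.
  - by apply/measurable_EFinP; case: bE.
  move=> v _; rewrite -/rho -(fineK (rhof v)) -EFinM lee_fin /q.
  case: ifPn => [_|]; first by rewrite mul0r expR_ge0.
  by rewrite -ltNge => rv; rewrite expRN lnK ?posrE// mulfVK// gt_eqF.
have iq : g.-integrable setT (EFin \o q).
  apply/integrableP; split; first exact/measurable_EFinP.
  under eq_integral do rewrite /= ger0_norm//.
  exact: le_lt_trans q1 (ltry _).
have KLge : ((\int[g]_v h v - 1)%:E <=
    \int[g]_v (lne (Radon_Nikodym (charge_of_finite_measure g) xi v) - 1))%E.
  have RNae := null_dominates_ae_eq measurableT gdom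
    (ae_eq_Radon_Nikodym_SigmaFinite gdom measurableT).
  apply: (@le_trans _ _ (\int[g]_v (h v - q v)%:E)%E).
    rewrite integralB_EFin//; last exact: bmf_integrable.
    rewrite EFinB bmf_integralE//; apply: leeB => //.
  apply: le_integral_ae.
  - apply: emeasurable_funB => //; apply: measurable_lne_fin_num => //.
    by move=> v; exact: Radon_Nikodym_fin_num.
  - by apply/measurable_EFinP; apply: measurable_funB => //; case: bh.
  have pos : {ae g, forall v, 0 < fine (rho v)}.
    pose B := [set v | fine (rho v) <= 0].
    have mB : measurable B.
      have := measurable_fun_ler mr (@measurable_cst _ _ _ _ setT (0 : R)).
      move=> /(_ measurableT [set true] I); rewrite setTI.
      by congr (measurable _); apply/seteqP; split => v /=.
    exists B; split => //.
      apply: etrans (Radon_Nikodym_SigmaFinite.f_integral gdom mB) _.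
      apply: integral0_eq => v Bv; apply/eqP; rewrite eq_le rho0 andbT.
      by rewrite -/rho -(fineK (rhof v)) lee_fin.
    by move=> v /= /negP; rewrite -leNgt.
  apply: filterS2 RNae pos => v /(_ I) <- rv.
  rewrite -/rho -(fineK (rhof v)) lne_EFin// -EFinB lee_fin /q (leNgt _ 0) rv/=.
  have := expR_ge1Dx (h v - ln (fine (rho v))).
  rewrite expRB -expRN -/(E v); lra.
rewrite /= -/xi.
have cE : \int[g]_v c v + eps * (\int[g]_v h v - 1) = dual_value w z c eps mu s - eps.
  have bs2 := bmf_snd bs; have bA1 := bmf_fst blA.
  have bce : bounded_measurable (fun v => c v / eps).
    by apply: bmf_mul => //; exact: bmf_cst.
  rewrite /h bmf_intB//; last exact: bmf_sub.
  rewrite bmf_intB// (Rintegral_coupling_fst cg blA) (Rintegral_coupling_snd cg bs).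
  rewrite (Rintegral_discrete w0 nuE w1 bs).
  have -> : (fun v => c v / eps) = (fun v => eps^-1 * c v).
    by apply/funext => v; rewrite mulrC.
  rewrite bmf_intZ// /dual_value -/A /s /=; field; rewrite gt_eqF//.
rewrite -/s -cE EFinD EFinM; apply: leeD => //.
by rewrite lee_pmul2l ?lte_fin.
Qed.

End weak_duality.

(** * Stability of the costs in the first marginal *)

Section stability.
Context {R : realType} {d : measure_display} {T : measurableType d} {N : nat}.
Variables (mu mu' nu : probability T R) (w : 'I_N -> R) (z : 'I_N -> T).
Hypotheses (w0 : forall i, 0 <= w i) (w1 : \sum_i w i = 1).
Hypothesis nuE : forall B, measurable B ->
  nu B = (\sum_i (w i)%:E * \d_(z i) B)%E.
Variables (c : T * T -> R) (M S : R).
Hypotheses (mc : measurable_fun setT c) (c0 : forall x, 0 <= c x <= M).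

Definition softmin_fun (eps : R) (v : 'I_N -> R) (x : T) : R :=
  - eps * ln (\sum_i v i * gibbs z c eps i x).

(** The optimal potential for [mu] is a competitor for [mu'], so the terms in [s] cancel and one
    log-partition function is integrated against both measures. Absorbing [expR (s i)] into
    normalized weights removes the potentials, which would otherwise be unbounded parameters as
    [eps] tends to 0. *)
Lemma entropic_cost_stable (eps : R) : 0 < eps ->
  (forall v : 'I_N -> R, (forall i, 0 <= v i) -> \sum_i v i = 1 ->
    \int[mu]_x softmin_fun eps v x - \int[mu']_x softmin_fun eps v x <= S) ->
  (entropic_cost c eps mu nu <= entropic_cost c eps mu' nu + S%:E)%E.
Proof.
move=> eps0 HS.
have [sig [bsig _ /le_trans]] := strong_duality mu w0 w1 nuE mc c0 eps0; apply.
have := weak_entropic_duality mu' w0 w1 nuE mc c0 eps0 bsig.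
move=> /(leeD2r S%:E); apply: le_trans; rewrite -EFinD lee_fin.
pose s := sig \o z; rewrite /dual_value -/s.
pose Z := \sum_i w i * expR (s i).
have Z0 : 0 < Z.
  rewrite lt_neqAle sumr_ge0 ?andbT; last by move=> i _; rewrite mulr_ge0// expR_ge0.
  apply/eqP => h; have := w1; rewrite big1 => [/eqP|i _].
    by rewrite eq_sym oner_eq0.
  have /(_ i isT)/eqP := psumr_eq0P (fun i _ => mulr_ge0 (w0 i) (expR_ge0 (s i))) (esym h).
  by rewrite mulf_eq0 expR_eq0 orbF => /eqP.
pose v i := w i * expR (s i) / Z.
have v0 i : 0 <= v i by rewrite divr_ge0 ?mulr_ge0 ?expR_ge0// ltW.
have v1 : \sum_i v i = 1 by rewrite -mulr_suml divff// gt_eqF.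
have kb := gibbs_bounds z c0 eps0.
have A0 x : 0 < partition_fun w (gibbs z c eps) s x :=
  partition_fun_gt0 w0 w1 (expR_gt0 _) kb s x.
have blA : bounded_measurable (fun x => ln (partition_fun w (gibbs z c eps) s x)) :=
  bmf_ln_partition_fun w0 w1 (bmf_gibbs z mc c0 eps0) (expR_gt0 _) kb s.
have sE x : softmin_fun eps v x =
    eps * ln Z + (- eps) * ln (partition_fun w (gibbs z c eps) s x).
  rewrite /softmin_fun (_ : \sum_i _ = partition_fun w (gibbs z c eps) s x / Z).
    by rewrite ln_div ?posrE//; ring.
  by rewrite /partition_fun mulr_suml; apply: eq_bigr => i _; rewrite /v; ring.
have := HS v v0 v1.
rewrite (_ : softmin_fun eps v = fun x =>
    eps * ln Z + (- eps) * ln (partition_fun w (gibbs z c eps) s x)); last exact/funext.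
rewrite !bmf_intD; try exact: bmf_cst; try exact: bmf_scale.
rewrite !bmf_int_cst !bmf_intZ//; lra.
Qed.

Definition min_fun (j : 'I_N -> 'I_N) (psi : 'I_N -> R) (x : T) : R :=
  \big[Num.min/M]_i (c (x, z (j i)) - psi i).

Lemma bmf_cost_section y : bounded_measurable (fun x => c (x, y)).
Proof. exact: (bmf_comp (pair2_measurable y) (bmf_cost mc c0)). Qed.

Lemma bmf_min_fun j psi : bounded_measurable (min_fun j psi).
Proof.
rewrite /min_fun; elim: (index_enum _) => [|i s IH].
  by under eq_fun do rewrite big_nil; exact: bmf_cst.
under eq_fun do rewrite big_cons; apply: bmf_min => //.
by apply: bmf_sub; [exact: bmf_cost_section|exact: bmf_cst].
Qed.

(** The maximizer of the entropic dual at [mu] is inserted into the transport dual at [mu']. The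
    soft minimum exceeds the minimum over atoms of positive weight by at most [- eps * ln (w i)],
    whence the error [eps * C], removed by letting [eps] tend to 0. *)
Lemma transport_cost_stable : (forall x : T, measurable [set x]) ->
  (forall j psi i0, psi i0 = 0 -> (forall i, - M <= psi i <= 0) ->
    \int[mu]_x min_fun j psi x - \int[mu']_x min_fun j psi x <= S) ->
  (transport_cost c mu nu <= transport_cost c mu' nu + S%:E)%E.
Proof.
move=> m1 HS.
pose C := \sum_(i | 0 < w i) - ln (w i).
have w_le1 i : w i <= 1 by rewrite -w1 (bigD1 i)//= lerDl sumr_ge0.
have C0 : 0 <= C by apply: sumr_ge0 => i _; rewrite oppr_ge0 ln_le0.
have wC i : 0 < w i -> - ln (w i) <= C.
  move=> wi; rewrite /C (bigD1 i)//= lerDl; apply: sumr_ge0 => i' _.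
  by rewrite oppr_ge0 ln_le0.
suff H eps : 0 < eps ->
    (transport_cost c mu nu <= transport_cost c mu' nu + S%:E + (eps * C)%:E)%E.
  apply/lee_addgt0Pr => e e0.
  have eC : 0 < e / (C + 1) by rewrite divr_gt0// ltr_wpDl.
  apply: le_trans (H _ eC) _; rewrite leeD2l// lee_fin mulrAC ler_pdivrMr ?ltr_wpDl//.
  by rewrite ler_pM2l//; lra.
move=> eps0.
have [sig [bsig + _]] := strong_duality mu w0 w1 nuE mc c0 eps0.
move=> /le_trans; apply.
have [i1 wi1] : exists i, 0 < w i.
  apply/existsP; apply: contra_eqT w1; rewrite negb_exists => /forallP h.
  rewrite big1 ?[0 == 1]eq_sym ?oner_eq0// => i _.
  by apply/eqP; have := h i; rewrite -leNgt eq_le w0 andbT.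
pose i0 := [arg max_(i > i1 | 0 < w i) sig (z i)]%O.
have [wi0 i0max] : 0 < w i0 /\ forall i, 0 < w i -> sig (z i) <= sig (z i0).
  by rewrite /i0; case: arg_maxP => // i wi h; split.
(* For an atom of weight 0 the soft minimum gives no bound, as [ln (w i)] is not controlled.
   Redirecting its index to [i0] merely repeats a term of the minimum. *)
pose j i := if 0 < w i then i else i0.
have wj i : 0 < w (j i) by rewrite /j; case: ifPn.
pose m := eps * sig (z i0).
pose g y := Num.max (eps * sig y - m) (- M).
pose psi i := g (z (j i)).
have M0 : 0 <= M by case/andP: (c0 (point, point)); exact: le_trans.
have ji0 : j i0 = i0 by rewrite /j; case: ifP.
have psii0 : psi i0 = 0.
  by rewrite /psi ji0 /g subrr; apply/max_idPl; rewrite oppr_le0.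
have psib i : - M <= psi i <= 0.
  rewrite /psi /g le_max lexx orbT ge_max oppr_le0 M0 andbT/= subr_le0.
  by rewrite ler_pM2l//; exact: i0max.
have bg : bounded_measurable g.
  apply: bmf_max; last exact: bmf_cst.
  by apply: bmf_sub; [exact: bmf_scale|exact: bmf_cst].
have bF := bmf_min_fun j psi.
have F_le x i : min_fun j psi x <= c (x, z (j i)) - psi i.
  by rewrite /min_fun (bigD1 i)//= ge_min lexx.
have := @weak_transport_duality R d T N mu' nu w z w0 w1 nuE c M mc c0 _ g m1 bF bg.
have fgc x i : 0 < w i -> min_fun j psi x + g (z i) <= c (x, z i).
  by move=> wi; have := F_le x i; rewrite /psi /j wi; lra.
move=> /(_ fgc) weak.
apply: (@le_trans _ _ ((\int[mu']_x min_fun j psi x + \sum_i w i * g (z i))%:E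
   + S%:E + (eps * C)%:E)%E); last by rewrite leeD2r// leeD2r.
rewrite -!EFinD lee_fin /dual_value.
pose s := sig \o z.
have kb := gibbs_bounds z c0 eps0.
have A0 x : 0 < partition_fun w (gibbs z c eps) s x :=
  partition_fun_gt0 w0 w1 (expR_gt0 _) kb s x.
have blA : bounded_measurable (fun x => ln (partition_fun w (gibbs z c eps) s x)) :=
  bmf_ln_partition_fun w0 w1 (bmf_gibbs z mc c0 eps0) (expR_gt0 _) kb s.
have lnA x i : 0 < w i -> - eps * ln (partition_fun w (gibbs z c eps) s x) <=
    c (x, z i) - eps * s i + eps * C.
  move=> wi.
  have : w i * (expR (s i) * gibbs z c eps i x) <= partition_fun w (gibbs z c eps) s x.
    rewrite /partition_fun (bigD1 i)//= lerDl sumr_ge0// => i' _.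
    by rewrite !mulr_ge0// expR_ge0.
  rewrite -ler_ln ?posrE//; last by rewrite !mulr_gt0// expR_gt0.
  rewrite lnM ?posrE ?mulr_gt0 ?expR_gt0// lnM ?posrE ?expR_gt0// !expRK => h.
  have : eps * (ln (w i) + (s i + - (c (x, z i) / eps))) <=
      eps * ln (partition_fun w (gibbs z c eps) s x) by rewrite ler_pM2l.
  have : eps * - ln (w i) <= eps * C by rewrite ler_pM2l// wC.
  have -> : eps * (ln (w i) + (s i + - (c (x, z i) / eps))) =
      eps * ln (w i) + eps * s i - c (x, z i) by field; rewrite gt_eqF.
  rewrite !mulrN mulNr; lra.
have AF x : - eps * ln (partition_fun w (gibbs z c eps) s x) + m - eps * C <=
    min_fun j psi x.
  have i0x := lnA x i0 wi0.
  have c01 y : c y <= M by case/andP: (c0 y).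
  have c00 y : 0 <= c y by case/andP: (c0 y).
  (* An index whose potential is truncated at [- M] contributes at least [M] to the minimum; the
     index [i0] shows that the left side never exceeds this value. *)
  have top : - eps * ln (partition_fun w (gibbs z c eps) s x) + m - eps * C <= M.
    have := c01 (x, z i0); rewrite /m -/(s i0) in i0x *; rewrite /s /= in i0x *; lra.
  rewrite /min_fun; elim/big_ind: _ => // [a b ha hb|i _]; first by rewrite le_min ha.
  rewrite /psi /g -/m; have ix := lnA x _ (wj i); rewrite /s /= in ix.
  case: (leP (eps * sig (z (j i)) - m) (- M)) => h; last lra.
  have := c00 (x, z (j i)); lra.
have intF : - eps * (\int[mu]_x ln (partition_fun w (gibbs z c eps) s x)) + m - eps * C
    <= \int[mu]_x min_fun j psi x.
  rewrite -bmf_intZ// -[X in _ + X - _](bmf_int_cst mu) -[X in _ - X](bmf_int_cst mu).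
  rewrite -bmf_intD; [|exact: bmf_scale|exact: bmf_cst].
  rewrite -bmf_intB; [|by apply: bmf_add; [exact: bmf_scale|exact: bmf_cst]|exact: bmf_cst].
  apply: bmf_le => //; apply: bmf_sub; last exact: bmf_cst.
  by apply: bmf_add; [exact: bmf_scale|exact: bmf_cst].
have sumg : eps * (\sum_i w i * (sig \o z) i) - m <= \sum_i w i * g (z i).
  rewrite mulr_sumr -[m]mul1r -w1 mulr_suml -sumrB; apply: ler_sum => i _.
  have := w0 i; rewrite le_eqVlt => /predU1P[<-|wi]; first by rewrite !mul0r mulr0 subrr.
  by rewrite mulrCA -mulrBr ler_pM2l// /g le_max lexx.
have := HS j psi i0 psii0 psib; rewrite -/s in sumg *; lra.
Qed.

End stability.

(** * Minima of shifted costs *)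

Section empirical_classes.
Context {R : realType} {dO dT : measure_display} {Omega : measurableType dO}
  {T : measurableType dT} (P : probability Omega R) (mu : probability T R).
Context {n : nat} (X : 'I_n -> {RV P >-> T}).
Hypothesis n_gt0 : (0 < n)%N.
Hypothesis Xlaw : forall i B, measurable B -> distribution P (X i) B = mu B.
Hypothesis Xind : mutually_independent X.

(** A bound on the mean of the supremum of the deviations, for either sign; the slack [e] absorbs
    the remainder of a finite chain. *)
Definition deviation_bounded (Lam : Type) (f : Lam -> T -> R) (b : R) :=
  forall (sg e : R), `|sg| = 1 -> 0 < e ->
  exists2 U, mean_bounded P U (b + e) &
  forall l w, sg * deviation mu X (f l) w <= U w.

Lemma dyadic_small (e : R) : 0 < e -> exists K, 6 * dyadic K <= e :> R.
Proof.
move=> e0; exists (Num.truncn (6 / e)).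
have h : 6 / e < (Num.truncn (6 / e)).+1%:R by exact: truncnS_gt.
have h2 : (Num.truncn (6 / e)).+1%:R <= 2 ^+ (Num.truncn (6 / e)).+1 :> R.
  by rewrite -natrX ler_nat ltnW// ltn_expl.
rewrite /dyadic exprVn ler_pdivrMr ?exprn_gt0// mulrC -ler_pdivrMr//.
by apply: ltW; exact: lt_le_trans h2.
Qed.

(** The entropy is taken affine in [k], with [ln 2] factored out to match the lower bound
    [b * sqrt (ln 2)] of the entropy integral. *)
Lemma chaining_bound (Lam : Type) (f : Lam -> T -> R) (C : nat -> finType)
    (code : forall k, Lam -> C k) (M : nat -> R) (W a b Y : R) :
  (forall l, measurable_fun setT (f l)) -> (forall l x, 0 <= f l x <= 1) ->
  (forall k l l', code k l = code k l' ->
    forall x, `|f l x - f l' x| <= dyadic k) ->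
  (forall k, 8 <= M k) ->
  (forall k x, #|[pred c : C k |
    `[< exists l, code k l = c /\ dyadic k <= f l x >]]|%:R <= M k) ->
  0 <= W -> 0 <= a -> 0 <= b -> 0 < Y -> a + 2 * b <= Y ^+ 2 ->
  (forall k, ln (M k) <= W * ln 2 * (a + b * k%:R)) ->
  deviation_bounded f (4 * Y * Num.sqrt (W * ln 2 / n%:R)).
Proof.
move=> mf f01 fcode M8 fcard W0 a0 b0 Y0 abY MW sg e sg1 e0.
have [lam0|noLam] := pselect (exists l : Lam, True); last first.
  exists (fun=> 0); last by move=> l; exfalso; apply: noLam; exists l.
  split; first exact: bmf_cst.
  by rewrite bmf_int_cst addr_ge0 ?(ltW e0)// !mulr_ge0 ?sqrtr_ge0// ltW.
have [l0 _] := lam0.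
have [K Ke] := dyadic_small e0.
have [U [bU mU] hU] := chaining n_gt0 Xlaw Xind l0 mf f01 fcode M8 fcard K sg1.
exists U => //; split => //; apply: le_trans mU _; apply: lerD => //.
have l2 : 0 <= ln 2 :> R by rewrite ln_ge0// ler1n.
have q0 : 0 <= W * ln 2 / n%:R by rewrite divr_ge0// mulr_ge0.
apply: (@le_trans _ _ (4 * Num.sqrt (W * ln 2 / n%:R) *
    \sum_(k < K) 2^-1 ^+ k.+1 * Num.sqrt (a + b * k.+1%:R))); last first.
  rewrite [leRHS]mulrAC ler_wpM2l ?mulr_ge0 ?sqrtr_ge0//.
  exact: sum_sqrt_dyadic.
rewrite mulr_sumr; apply: ler_sum => k _.
have -> : 4 * Num.sqrt (W * ln 2 / n%:R) * (2^-1 ^+ k.+1 * Num.sqrt (a + b * k.+1%:R)) =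
    8 * dyadic k.+1 * (Num.sqrt (W * ln 2 / n%:R) * Num.sqrt (a + b * k.+1%:R)).
  by rewrite /dyadic [2^-1 ^+ k.+2]exprS; field.
apply: ler_wpM2l; first by rewrite mulr_ge0// ltW// dyadic_gt0.
by rewrite -sqrtrM// ler_wsqrtr// mulrAC ler_wpM2r ?invr_ge0.
Qed.

Section min_class.
Variables (N : nat) (Lam : Type) (g : Lam -> T -> R).
Hypothesis N_gt0 : (0 < N)%N.
Hypothesis mg : forall l, measurable_fun setT (g l).
Hypothesis g01 : forall l x, 0 <= g l x <= 1.
Variables (Q : nat -> finType) (cell : forall k, Lam -> Q k) (D : nat -> nat).
Hypothesis cell_dist : forall k l l', cell k l = cell k l' ->
  forall x, `|g l x - g l' x| <= dyadic k.+1.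
Hypothesis D_gt0 : forall k, (0 < D k)%N.
(* Counting every cell would make the bound grow with the exponent p of the cost. *)
Hypothesis cell_card : forall k x, (#|[pred q : Q k | `[< exists l1 x' l,
  [/\ cell k l = q, dyadic k.+1 <= g l1 x, dyadic k.+1 <= g l1 x' &
      dyadic k.+1 <= g l x']%R >]]| <= D k)%N.

(** The largest shift is normalized to 0: an unshifted cost dominates the minimum, so the minimum is
    large only where that cost is large. *)
Record min_param := MinParam {
  mp_point : 'I_N -> Lam;
  mp_shift : 'I_N -> R;
  mp_bounds : forall i, -1 <= mp_shift i <= 0;
  mp_top : exists i, mp_shift i = 0 }.

Definition min_class (l : min_param) (x : T) : R :=
  \big[Num.min/1]_i (g (mp_point l i) x - mp_shift l i).

Let min_class_le l i x : min_class l x <= g (mp_point l i) x - mp_shift l i.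
Proof. by rewrite /min_class (bigD1 i)//= ge_min lexx. Qed.

Let min_class_ge l x y : y <= 1 ->
  (forall i, y <= g (mp_point l i) x - mp_shift l i) -> y <= min_class l x.
Proof.
move=> y1 yg; rewrite /min_class; elim/big_ind: _ => // a b ya yb.
by rewrite le_min ya.
Qed.

Let min_class01 l x : 0 <= min_class l x <= 1.
Proof.
apply/andP; split.
  apply: min_class_ge => // i; case/andP: (g01 (mp_point l i) x) => h0 _.
  by case/andP: (mp_bounds l i) => _ h1; lra.
have [i i0] := mp_top l; apply: le_trans (min_class_le l i x) _.
by rewrite i0 subr0; case/andP: (g01 (mp_point l i) x).
Qed.

Let measurable_min_class l : measurable_fun setT (min_class l).
Proof.
rewrite /min_class; elim: (index_enum _) => [|i s IH].
  by under eq_fun do rewrite big_nil; exact: measurable_cst.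
under eq_fun do rewrite big_cons; apply: measurable_minr => //.
exact: measurable_funB.
Qed.

(** If [i] is not relevant, its cost is below [dyadic k.+1] wherever the minimum is above that
    level, so recording [None] locates the cost as precisely as its cell would. If it is, then at
    any [x] where the minimum is at least [dyadic k], the links from [x] to an unshifted parameter,
    on to [x'] and then to the parameter of [i] are those of [cell_card]. *)
Let relevant k (l : min_param) i := `[< exists x' i0, [/\ mp_shift l i0 = 0,
  dyadic k.+1 <= g (mp_point l i0) x' & dyadic k.+1 <= g (mp_point l i) x'] >].

Let C k : finType := {ffun 'I_N -> 'I_(2 ^ k.+2).+1 * option (Q k)}.

Let code k (l : min_param) : C k := [ffun i =>
  (inord (Num.truncn (- mp_shift l i / dyadic k.+1)),
   if relevant k l i then Some (cell k (mp_point l i)) else None)].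

Let shift_cell k l i :
  (Num.truncn (- mp_shift l i / dyadic k.+1 : R) < (2 ^ k.+2).+1)%N.
Proof.
rewrite ltnS -(ler_nat R); case/andP: (mp_bounds l i) => h1 h2.
apply: le_trans (_ : - mp_shift l i / dyadic k.+1 <= _).
  by rewrite truncn_le// divr_ge0 ?oppr_ge0// ltW// dyadic_gt0.
rewrite ler_pdivrMr ?dyadic_gt0// natrX /dyadic exprVn mulfV; last first.
  by rewrite expf_neq0// pnatr_eq0.
lra.
Qed.

Let shift_dist k l l' i : code k l i = code k l' i ->
  `|mp_shift l i - mp_shift l' i| <= dyadic k.+1.
Proof.
rewrite !ffunE => -[/(congr1 (@nat_of_ord _)) + _].
rewrite !inordK ?shift_cell// => h; have e0 := @dyadic_gt0 R k.+1.
case/andP: (mp_bounds l i) => h1 h2; case/andP: (mp_bounds l' i) => h3 h4.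
have b (t : R) : t <= 0 -> (Num.truncn (- t / dyadic k.+1))%:R * dyadic k.+1 <= - t <
    ((Num.truncn (- t / dyadic k.+1))%:R + 1) * dyadic k.+1.
  move=> t0; rewrite -ler_pdivlMr// -ltr_pdivrMr// natr1 truncnS_gt andbT.
  by rewrite truncn_le// divr_ge0 ?oppr_ge0// ltW.
have /andP[b1 b2] := b _ h2; have /andP[b3 b4] := b _ h4.
rewrite h in b1 b2; rewrite ler_norml; apply/andP; split; lra.
Qed.

Let code_dist k l l' : code k l = code k l' ->
  forall x, `|min_class l x - min_class l' x| <= dyadic k.
Proof.
suff H l1 l2 : code k l1 = code k l2 ->
    forall x, min_class l1 x - dyadic k <= min_class l2 x.
  move=> cl x; have := H _ _ cl x; have := H _ _ (esym cl) x.
  by rewrite ler_norml => h1 h2; apply/andP; split; lra.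
move=> cl x; have e0 := @dyadic_gt0 R k.+1.
have /andP[f0 f1] := min_class01 l1 x.
have g_ge0 l0 y : 0 <= g l0 y by case/andP: (g01 l0 y).
apply: min_class_ge => [|i]; first by rewrite (dyadicS k); lra.
have sh := shift_dist (congr1 (fun c : C k => c i) cl).
have /andP[s1 s2] := mp_bounds l2 i.
rewrite (dyadicS k); have [fe|fe] := leP (min_class l1 x) (dyadic k.+1).
  have := g_ge0 (mp_point l2 i) x; lra.
have gi := min_class_le l1 i x.
move: sh; rewrite ler_norml => /andP[sh1 sh2].
have := congr1 (fun c : C k => (c i).2) cl; rewrite !ffunE /=.
case: ifPn => [r1|nr1]; case: ifPn => // r2.
  move=> [/cell_dist/(_ x)]; rewrite ler_norml => /andP[]; lra.
move=> _; have := g_ge0 (mp_point l2 i) x.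
suff : g (mp_point l1 i) x < dyadic k.+1 by lra.
rewrite ltNge; apply: contra nr1 => gx; apply/asboolP.
have [i0 si0] := mp_top l1; exists x, i0; split => //.
apply: le_trans (ltW fe) (le_trans (min_class_le l1 i0 x) _).
by rewrite si0 subr0.
Qed.

Let base k := ((2 ^ k.+2).+1 * (D k).+1)%N.

Let code_card k x : (#|[pred c : C k |
    `[< exists l, code k l = c /\ (dyadic k <= min_class l x)%R >]]| <= base k ^ N)%N.
Proof.
pose B := [pred q : Q k | `[< exists l1 x' l,
  [/\ cell k l = q, dyadic k.+1 <= g l1 x, dyadic k.+1 <= g l1 x' &
      dyadic k.+1 <= g l x'] >]].
pose BO := [predU1 None & [seq Some q | q in B]].
pose B2 := [predX [pred u : 'I_(2 ^ k.+2).+1 | true] & BO].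
have cBO : (#|BO| <= (D k).+1)%N.
  rewrite cardU1 -(add1n (D k)) leq_add ?leq_b1//.
  by rewrite fintype.card_image ?cell_card// => u v [].
have cB2 : (#|B2| <= base k)%N.
  rewrite cardX leq_mul// -[leqRHS]card_ord; exact: max_card.
have cF : #|@ffun_on_mem 'I_N _ (mem B2)| = (#|B2| ^ N)%N.
  by rewrite card_ffun_on card_ord.
apply: (@leq_trans (#|B2| ^ N)); last by rewrite leq_exp2r.
rewrite -cF.
apply: subset_leq_card; apply/fintype.subsetP => c; rewrite inE => -[l [<- fx]].
apply/ffun_onP => i; rewrite ffunE inE /=; case: ifPn => [|_]; last first.
  by rewrite inE eqxx.
move=> /asboolP[x' [i0 [si0 gi0 gi]]]; rewrite !inE /=; apply/fintype.imageP.
exists (cell k (mp_point l i)) => //; rewrite inE.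
exists (mp_point l i0), x', (mp_point l i); split => //.
have := le_trans fx (min_class_le l i0 x); rewrite si0 subr0; apply: le_trans.
by rewrite (dyadicS k); have := @dyadic_gt0 R k.+1; lra.
Qed.

Lemma min_class_bounded (V a b Y : R) :
  0 <= V -> 0 <= a -> 0 <= b -> 0 < Y -> a + 2 * b <= Y ^+ 2 ->
  (forall k, ln ((2 ^ k.+2).+1 * (D k).+1)%:R <= V * ln 2 * (a + b * k%:R)) ->
  deviation_bounded min_class (4 * Y * Num.sqrt (N%:R * V * ln 2 / n%:R)).
Proof.
move=> V0 a0 b0 Y0 abY DV.
apply: (@chaining_bound _ _ C code (fun k => (base k ^ N)%:R) (N%:R * V) a b Y) => //.
- move=> k; rewrite ler_nat; apply: (@leq_trans (base k)); last first.
    by rewrite -{1}(expn1 (base k)) leq_pexp2l// muln_gt0.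
  rewrite /base (@leq_trans (5 * 2))// leq_mul// ltnS//.
  by rewrite (@leq_pexp2l 2 2 k.+2).
- by move=> k x; rewrite ler_nat; exact: code_card.
- by rewrite mulr_ge0.
- move=> k; rewrite natrX lnXn; last by rewrite ltr0n muln_gt0.
  have -> : N%:R * V * ln 2 * (a + b * k%:R) = N%:R * (V * ln 2 * (a + b * k%:R)).
    by ring.
  by rewrite -[leLHS]mulr_natl ler_wpM2l//; exact: DV.
Qed.

End min_class.

End empirical_classes.

(** * Geometry of nearly maximal costs *)

Section dot_product.
Context {R : realType} {d : nat}.
Implicit Types x y z : 'rV[R]_d.

Definition dot x y : R := \sum_(i < d) x 0 i * y 0 i.

Lemma dotC x y : dot x y = dot y x.
Proof. by apply: eq_bigr => i _; rewrite mulrC. Qed.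

Lemma dotDl x y z : dot (x + y) z = dot x z + dot y z.
Proof. by rewrite -big_split; apply: eq_bigr => i _; rewrite mxE mulrDl. Qed.

Lemma dotZl (c : R) x y : dot (c *: x) y = c * dot x y.
Proof. by rewrite mulr_sumr; apply: eq_bigr => i _; rewrite mxE mulrA. Qed.

Lemma dotDr x y z : dot x (y + z) = dot x y + dot x z.
Proof. by rewrite dotC dotDl !(dotC x). Qed.

Lemma dotZr (c : R) x y : dot x (c *: y) = c * dot x y.
Proof. by rewrite dotC dotZl dotC. Qed.

Lemma dotNl x y : dot (- x) y = - dot x y.
Proof. by rewrite -scaleN1r dotZl mulN1r. Qed.

Lemma dotNr x y : dot x (- y) = - dot x y.
Proof. by rewrite dotC dotNl dotC. Qed.

Definition dotE := (dotDl, dotDr, dotNl, dotNr, dotZl, dotZr).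

Lemma dot_ge0 x : 0 <= dot x x.
Proof. by apply: sumr_ge0 => i _; rewrite -expr2 sqr_ge0. Qed.

Lemma enormE x : enorm x = Num.sqrt (dot x x).
Proof. by congr Num.sqrt; apply: eq_bigr => i _; rewrite expr2. Qed.

Lemma enorm_sqr x : enorm x ^+ 2 = dot x x.
Proof. by rewrite enormE sqr_sqrtr// dot_ge0. Qed.

Lemma enorm_ge0 x : 0 <= enorm x.
Proof. by rewrite enormE sqrtr_ge0. Qed.

Lemma enormZ (c : R) x : enorm (c *: x) = `|c| * enorm x.
Proof.
rewrite !enormE dotZl dotZr mulrA -expr2 sqrtrM ?sqr_ge0// sqrtr_sqr//.
Qed.

Lemma coord_le (x : 'rV[R]_d) (c : R) j : 0 <= c -> dot x x <= c ^+ 2 ->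
  `|x 0 j| <= c.
Proof.
move=> c0 xc; rewrite -(@ler_pXn2r R 2)// ?nnegrE// real_normK ?num_real//.
apply: le_trans xc; rewrite /dot (bigD1 j)//= -expr2 lerDl.
by apply: sumr_ge0 => i _; rewrite -expr2 sqr_ge0.
Qed.

Lemma dot_young (al : R) x y : 0 < al ->
  2 * dot x y <= al * dot x x + dot y y / al.
Proof.
move=> al0; have := dot_ge0 (al *: x - y); rewrite !dotE (dotC y x) => h.
rewrite -(@ler_pM2l R al)// mulrDr mulrCA (mulrC (dot y y)) mulVKf ?gt_eqF//; nra.
Qed.

Lemma dot_sum3_le x y z (S : R) : dot x x <= S -> dot y y <= S -> dot z z <= S ->
  dot (x + y + z) (x + y + z) <= 9 * S.
Proof.
move=> xS yS zS.
have := @dot_young 1 x y ltr01; have := @dot_young 1 x z ltr01.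
have := @dot_young 1 y z ltr01; rewrite !invr1 !mulr1 !mul1r => h1 h2 h3.
rewrite !dotE (dotC y x) (dotC z x) (dotC z y); lra.
Qed.

End dot_product.

Lemma expr_sub_le (R : realType) (p : nat) (a b : R) : 0 <= b <= a -> a <= 1 ->
  a ^+ p - b ^+ p <= p%:R * (a - b).
Proof.
move=> /andP[b0 ba] a1; have a0 := le_trans b0 ba.
elim: p => [|p IH]; first by rewrite !expr0 subrr mul0r.
have ap : 0 <= b ^+ p <= 1 by rewrite exprn_ge0//= exprn_ile1// (le_trans ba).
have bp : b ^+ p <= a ^+ p by rewrite lerXn2r.
rewrite !exprS -natr1; have := exprn_ge0 p a0.
by move: IH ap bp; move: (a ^+ p) (b ^+ p) (p%:R) => u v q; nra.
Qed.

Lemma bernoulli_decay (R : realType) (p : nat) (u : R) : 0 <= u <= 1 ->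
  (1 - u) ^+ p * (1 + p%:R * u) <= 1.
Proof.
move=> /andP[u0 u1]; elim: p => [|p IH]; first by rewrite expr0 mul0r addr0 mulr1.
have : (1 - u) * (1 + p.+1%:R * u) <= 1 + p%:R * u.
  have : 0 <= p%:R :> R by [].
  rewrite -natr1; move: (p%:R) => q q0; nra.
move=> h; rewrite exprS -mulrA mulrCA; apply: le_trans IH.
by rewrite ler_wpM2l// exprn_ge0// subr_ge0.
Qed.

Section ball_cells.
Context {R : realType} {d p : nat} (del : R).
Hypotheses (p_gt0 : (0 < p)%N) (del0 : 0 < del) (del1 : del <= 4^-1).
Implicit Types x y : 'rV[R]_d.

Let p0 : 0 < p%:R :> R. Proof. by rewrite ltr0n. Qed.

(** The source of uniformity in [p]: the region where a cost is not small shrinks like [1 / q], and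
    so may the mesh of the cells. *)
Let deficit (q : nat) (a e : R) : 0 <= a <= 1 -> 0 < e -> (0 < q)%N -> e <= a ^+ q ->
  1 - a <= 1 / (q%:R * e).
Proof.
move=> /andP[a0 a1] e0 q_gt0 ea; have q0 : 0 < q%:R :> R by rewrite ltr0n.
have /(bernoulli_decay q) : 0 <= 1 - a <= 1 by apply/andP; split; lra.
rewrite opprB addrC subrK => h; rewrite ler_pdivlMr ?mulr_gt0//.
have : e * (1 + q%:R * (1 - a)) <= 1.
  by apply: le_trans h; rewrite ler_wpM2r// addr_ge0// mulr_ge0// subr_ge0.
nra.
Qed.

Lemma dot_sub_le1 x y : dot x x <= 4^-1 -> dot y y <= 4^-1 ->
  dot (x - y) (x - y) <= 1.
Proof.
move=> hx hy; have := dot_ge0 (x + y); rewrite !dotE (dotC y x); lra.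
Qed.

(* Parallelogram law: points of a ball of diameter 1 that are nearly at
   distance 1 are nearly antipodal. *)
Lemma far_antipodal x y : dot x x <= 4^-1 -> dot y y <= 4^-1 ->
  del <= enorm (x - y) ^+ p ->
  dot (x + y) (x + y) <= 1 / (p%:R * del ^+ 2) /\
  4^-1 - 1 / (p%:R * del ^+ 2) / 2 <= dot y y.
Proof.
move=> hx hy far.
have A1 := dot_sub_le1 hx hy.
have far2 : del ^+ 2 <= dot (x - y) (x - y) ^+ p.
  rewrite -enorm_sqr -exprM mulnC exprM lerXn2r ?nnegrE ?exprn_ge0 ?enorm_ge0//.
  exact: ltW.
have := @deficit p _ (del ^+ 2) _ (exprn_gt0 _ del0) p_gt0 far2.
rewrite dot_ge0 A1 => /(_ isT); set S := 1 / _.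
have := dot_ge0 (x + y); rewrite !dotE (dotC y x); split; lra.
Qed.

(** A Lipschitz bound would ask for a mesh of order [1 / p] in every coordinate. Here [y] needs only
    order [p ^ (-1/2)]: in [a ^ 2 - b ^ 2] the point [x] is written as [(x + y1) - y1], where
    [x + y1] is itself of order [p ^ (-1/2)], and what remains depends on [dot y y], a single scalar
    controlled to order [1 / p]. *)
Lemma far_ball_dist x y y' : dot x x <= 4^-1 -> dot y y <= 4^-1 -> dot y' y' <= 4^-1 ->
  dot (y - y') (y - y') <= del ^+ 6 / (9 * p%:R) ->
  `|dot y y - dot y' y'| <= del ^+ 2 / (8 * p%:R) ->
  `|enorm (x - y) ^+ p - enorm (x - y') ^+ p| <= del.
Proof.
suff H y1 y2 : dot x x <= 4^-1 -> dot y1 y1 <= 4^-1 -> dot y2 y2 <= 4^-1 ->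
    dot (y1 - y2) (y1 - y2) <= del ^+ 6 / (9 * p%:R) ->
    `|dot y1 y1 - dot y2 y2| <= del ^+ 2 / (8 * p%:R) ->
    enorm (x - y1) ^+ p - enorm (x - y2) ^+ p <= del.
  move=> hx hy hy' h1 h2; rewrite ler_norml; apply/andP; split; last exact: H.
  rewrite lerNl opprB; apply: H => //; last by rewrite distrC.
  by move: h1; rewrite !dotE (dotC y' y); lra.
move=> hx hy1 hy2; set a := enorm (x - y1); set b := enorm (x - y2) => h1 h2.
have a0 : 0 <= a := enorm_ge0 _; have b0 : 0 <= b := enorm_ge0 _.
have bp0 : 0 <= b ^+ p by exact: exprn_ge0.
have [ap|ap] := ltP (a ^+ p) del; first lra.
have [ab|ba] := leP a b.
  have : a ^+ p <= b ^+ p by rewrite lerXn2r.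
  have := del0; lra.
have a1 : a <= 1.
  by rewrite -(@ler_pXn2r R 2)// ?nnegrE// expr1n enorm_sqr dot_sub_le1.
have da : del <= a.
  by apply: le_trans ap _; rewrite -[leRHS]expr1 ler_wiXn2l.
have [ant _] := far_antipodal hx hy1 ap.
have al0 : 0 < del ^+ 4 / 3 by rewrite divr_gt0// exprn_gt0.
have young := dot_young (- (x + y1)) (y1 - y2) al0.
have e1 : del ^+ 4 / 3 * dot (- (x + y1)) (- (x + y1)) <= del ^+ 2 / (3 * p%:R).
  have -> : del ^+ 2 / (3 * p%:R) = del ^+ 4 / 3 * (1 / (p%:R * del ^+ 2)).
    by field; rewrite !gt_eqF.
  rewrite ler_wpM2l ?(ltW al0)//; apply: le_trans ant.
  by rewrite !dotE; lra.
have e2 : dot (y1 - y2) (y1 - y2) / (del ^+ 4 / 3) <= del ^+ 2 / (3 * p%:R).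
  rewrite ler_pdivrMr//; apply: le_trans h1 _.
  apply/le_of_eq.
  by field; rewrite !gt_eqF.
have e3 : del ^+ 6 / (9 * p%:R) <= del ^+ 2 / p%:R / 72.
  have -> : del ^+ 6 / (9 * p%:R) = del ^+ 4 * (del ^+ 2 / p%:R / 9).
    by field; rewrite !gt_eqF.
  have -> : del ^+ 2 / p%:R / 72 = 8^-1 * (del ^+ 2 / p%:R / 9) by field; rewrite !gt_eqF.
  rewrite ler_wpM2r ?divr_ge0 ?exprn_ge0 ?(ltW del0)//.
  have : del ^+ 4 <= (4^-1) ^+ 4 by rewrite lerXn2r ?nnegrE ?(ltW del0)//; lra.
  rewrite !exprS expr0; lra.
(* [a ^ 2 - b ^ 2] equals twice the difference of [dot y1 y1] and [dot y2 y2], plus the squared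
   distance, plus the product estimated by [young]. In units of [del ^ 2 / p] the sum is at most 2/8
   + 1/72 + 1/3 + 1/3. *)
have diff2 : a ^+ 2 - b ^+ 2 <= del ^+ 2 / p%:R.
  move: h2; rewrite ler_norml => /andP[_ h2]; move: h2 young e1 e2 e3 h1.
  have -> : del ^+ 2 / (8 * p%:R) = del ^+ 2 / p%:R / 8 by field; rewrite !gt_eqF.
  have -> : del ^+ 2 / (3 * p%:R) = del ^+ 2 / p%:R / 3 by field; rewrite !gt_eqF.
  set E := del ^+ 2 / p%:R => h2 young e1 e2 e3 h1.
  have E0 : 0 <= E by rewrite divr_ge0// ?exprn_ge0// ltW.
  move: h2 young h1 e1 e2; rewrite /a /b !enorm_sqr.
  set w2 := dot (y1 - y2) (y1 - y2) / _.
  set w1 := _ / 3 * _.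
  rewrite !dotE (dotC y1 x) (dotC y2 x) (dotC y2 y1); lra.
have ab0 : 0 <= b <= a by rewrite b0 ltW.
apply: le_trans (expr_sub_le p ab0 a1) _.
have apos : 0 < a by exact: lt_le_trans da.
have : a - b <= (a ^+ 2 - b ^+ 2) / a.
  have -> : a ^+ 2 - b ^+ 2 = (a - b) * (a + b) by ring.
  by rewrite ler_pdivlMr// ler_wpM2l ?subr_ge0 ?(ltW ba)// lerDl.
move=> /le_trans h; rewrite -ler_pdivlMl//; apply: h.
rewrite ler_pdivrMr//; apply: le_trans diff2 _.
have -> : p%:R^-1 * del * a = del * a / p%:R by field; rewrite gt_eqF.
by rewrite ler_wpM2r ?invr_ge0 ?(ltW p0)// expr2 ler_wpM2l// ltW.
Qed.

(** The pairs [x, y1], then [x', y1], then [x', y] are nearly antipodal, so [y] is near [- x]; three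
    links give 9 for squared norms. *)
Lemma far_ball_chain x x' y y1 :
  dot x x <= 4^-1 -> dot x' x' <= 4^-1 -> dot y y <= 4^-1 -> dot y1 y1 <= 4^-1 ->
  del <= enorm (x - y1) ^+ p -> del <= enorm (x' - y1) ^+ p ->
  del <= enorm (x' - y) ^+ p ->
  dot (y + x) (y + x) <= 9 * (1 / (p%:R * del ^+ 2)).
Proof.
move=> hx hx' hy hy1 f1 f2 f3.
have [a1 _] := far_antipodal hx hy1 f1; have [a2 _] := far_antipodal hx' hy1 f2.
have [a3 _] := far_antipodal hx' hy f3.
have -> : y + x = (x + y1) + - (x' + y1) + (x' + y).
  rewrite opprD !addrA -(addrA x) [y1 - x']addrC !addrA addrK [x - x' + x']subrK.
  by rewrite addrC.
by apply: dot_sum3_le => //; rewrite dotNl dotNr opprK.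
Qed.

(* The slice |<theta, x> - t| is close to 1 only if theta is close to 2x or
   -2x; as theta is a unit vector, <theta - theta', theta> is quadratic. *)
Lemma far_slice_antipodal (th x : 'rV[R]_d) (t : R) :
  dot th th = 1 -> dot x x <= 4^-1 -> `|t| <= 2^-1 ->
  del <= `|dot th x - t| ^+ p ->
  exists sg : bool, [/\ `|dot th x - t| = (-1) ^+ sg * (dot th x - t),
    dot (th - (2 * (-1) ^+ sg) *: x) (th - (2 * (-1) ^+ sg) *: x) <= 4 / (p%:R * del) &
    2^-1 - 1 / (p%:R * del) <= - (-1) ^+ sg * t <= 2^-1].
Proof.
move=> hth hx ht; move: ht; rewrite ler_norml => /andP[t1 t2] far.
have c1 : - 2^-1 <= dot th x <= 2^-1.
  have := dot_ge0 (th - 2 *: x); have := dot_ge0 (th + 2 *: x).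
  rewrite !dotE (dotC x th) hth => h1 h2; apply/andP; split; lra.
move: c1 => /andP[c1 c2].
have a1 : 0 <= `|dot th x - t| <= 1.
  by rewrite normr_ge0/= ler_norml; apply/andP; split; lra.
have def := deficit a1 del0 p_gt0 far; move: def.
have -> : 4 / (p%:R * del) = 4 * (1 / (p%:R * del)) by rewrite mul1r.
set S := 1 / _.
have [h|h] := leP 0 (dot th x - t) => def.
  rewrite ger0_norm// in def *.
  exists false; rewrite expr0 mulr1 mul1r; split => //.
    rewrite !dotE (dotC x th) hth; lra.
  by apply/andP; split; lra.
rewrite ltr0_norm// in def *.
exists true; rewrite expr1 mulrN1 mulN1r; split => //.
  rewrite !dotE (dotC x th) hth; lra.
by apply/andP; split; lra.
Qed.

(** As for the ball, with the unit norm in place of the control of [dot y y]: up to sign, [2 * x] is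
    [th1] minus the small vector [z], and [2 * dot th1 (th1 - th2)] is the squared distance of the
    directions. *)
Lemma far_slice_dist (th th' x : 'rV[R]_d) (t t' : R) :
  dot th th = 1 -> dot th' th' = 1 -> dot x x <= 4^-1 ->
  `|t| <= 2^-1 -> `|t'| <= 2^-1 ->
  dot (th - th') (th - th') <= del ^+ 4 / (4 * p%:R) ->
  `|t - t'| <= del / (4 * p%:R) ->
  `| `|dot th x - t| ^+ p - `|dot th' x - t'| ^+ p| <= del.
Proof.
suff H (th1 th2 : 'rV[R]_d) (t1 t2 : R) : dot th1 th1 = 1 -> dot th2 th2 = 1 ->
    dot x x <= 4^-1 -> `|t1| <= 2^-1 -> `|t2| <= 2^-1 ->
    dot (th1 - th2) (th1 - th2) <= del ^+ 4 / (4 * p%:R) ->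
    `|t1 - t2| <= del / (4 * p%:R) ->
    `|dot th1 x - t1| ^+ p - `|dot th2 x - t2| ^+ p <= del.
  move=> hth hth' hx ht ht' h1 h2.
  rewrite ler_norml; apply/andP; split; last exact: H.
  rewrite lerNl opprB; apply: H => //; last by rewrite distrC.
  by move: h1; rewrite !dotE (dotC th' th); lra.
move=> hth1 hth2 hx ht1 ht2 h1 h2.
pose a := `|dot th1 x - t1|; pose b := `|dot th2 x - t2|.
rewrite -/a -/b.
have a0 : 0 <= a := normr_ge0 _; have b0 : 0 <= b := normr_ge0 _.
have bp0 : 0 <= b ^+ p by exact: exprn_ge0.
have [ap|ap] := ltP (a ^+ p) del; first lra.
have [ab|ba] := leP a b.
  have : a ^+ p <= b ^+ p by rewrite lerXn2r.
  have := del0; lra.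
have [sg [aE near _]] := far_slice_antipodal hth1 hx ht1 ap.
rewrite -/a in aE.
have a1 : a <= 1.
  move: ht1; rewrite ler_norml => /andP[u1 u2].
  have := dot_ge0 (th1 - 2 *: x); have := dot_ge0 (th1 + 2 *: x).
  rewrite !dotE (dotC x th1) hth1 => g1 g2.
  by rewrite /a ler_norml; apply/andP; split; lra.
have al0 : 0 < del ^+ 2 / 4 by rewrite divr_gt0// exprn_gt0.
set z := th1 - _ in near.
have young := dot_young (- z) (th1 - th2) al0.
have D0 : 0 < del / p%:R by rewrite divr_gt0.
have e1 : del ^+ 2 / 4 * dot (- z) (- z) <= del / p%:R.
  rewrite dotNl dotNr opprK.
  have -> : del / p%:R = del ^+ 2 / 4 * (4 / (p%:R * del)).
    by field; rewrite !gt_eqF.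
  by rewrite ler_wpM2l ?(ltW al0).
have e2 : dot (th1 - th2) (th1 - th2) / (del ^+ 2 / 4) <= del / p%:R / 4.
  rewrite ler_pdivrMr//; apply: le_trans h1 _.
  have -> : del ^+ 4 / (4 * p%:R) = del * (del ^+ 3 / (4 * p%:R)).
    by field; rewrite gt_eqF.
  have -> : del / p%:R / 4 * (del ^+ 2 / 4) = 4^-1 * (del ^+ 3 / (4 * p%:R)).
    by field; rewrite gt_eqF.
  by rewrite ler_wpM2r// divr_ge0 ?exprn_ge0 ?mulr_ge0// ltW.
have e3 : dot (th1 - th2) (th1 - th2) <= del / p%:R / 4.
  apply: le_trans h1 _.
  have -> : del ^+ 4 / (4 * p%:R) = del ^+ 3 * (del / p%:R / 4).
    by field; rewrite gt_eqF.
  rewrite ler_piMl ?divr_ge0 ?(ltW del0)// exprn_ile1 ?(ltW del0)//.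
  have := del1; lra.
have b_ge : (-1) ^+ sg * (dot th2 x - t2) <= b.
  by rewrite /b (le_trans (ler_norm _))// normrM normr_sign mul1r.
have tt : - ((-1) ^+ sg * (t1 - t2)) <= del / p%:R / 4.
  rewrite (le_trans (ler_norm _))// normrN normrM normr_sign mul1r.
  by apply: le_trans h2 _; rewrite invfM mulrA mulrAC.
have zw : 2 * dot (- z) (th1 - th2) =
    - dot (th1 - th2) (th1 - th2) + 4 * ((-1) ^+ sg * (dot th1 x - dot th2 x)).
  rewrite /z !dotE (dotC x th1) (dotC x th2) (dotC th2 th1) hth1 hth2; ring.
have ab0 : 0 <= b <= a by rewrite b0 ltW.
apply: le_trans (expr_sub_le p ab0 a1) _.
rewrite -ler_pdivlMl// [p%:R^-1 * _]mulrC.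
move: D0 aE b_ge tt zw young e1 e2 e3.
move: (dot (th1 - th2) (th1 - th2) / (del ^+ 2 / 4)) (del ^+ 2 / 4 * dot (- z) (- z)).
move: (dot (th1 - th2) (th1 - th2)) (dot (- z) (th1 - th2)) => w2 zz u1 u2.
move: (dot th1 x) (dot th2 x) (del / p%:R) (b) (a) ((-1) ^+ sg : R).
move=> q1 q2 E b' a' s; lra.
Qed.

Lemma far_slice_chain (th th1 x x' : 'rV[R]_d) (t t1 : R) :
  dot th th = 1 -> dot th1 th1 = 1 -> dot x x <= 4^-1 -> dot x' x' <= 4^-1 ->
  `|t| <= 2^-1 -> `|t1| <= 2^-1 ->
  del <= `|dot th1 x - t1| ^+ p -> del <= `|dot th1 x' - t1| ^+ p ->
  del <= `|dot th x' - t| ^+ p ->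
  exists s s' : bool, dot (th - (2 * (-1) ^+ s) *: x) (th - (2 * (-1) ^+ s) *: x)
      <= 9 * (4 / (p%:R * del)) /\
    2^-1 - 1 / (p%:R * del) <= - (-1) ^+ s' * t <= 2^-1.
Proof.
move=> hth hth1 hx hx' ht ht1 f1 f2 f3.
have [s1 [_ a1 _]] := far_slice_antipodal hth1 hx ht1 f1.
have [s2 [_ a2 _]] := far_slice_antipodal hth1 hx' ht1 f2.
have [s3 [_ a3 b3]] := far_slice_antipodal hth hx' ht f3.
(* Signs multiply along the chain from [x] to [th], whereas the offset [t] is determined by the last
   link alone. *)
exists (s1 (+) (s2 (+) s3)), s3; split => //.
set z := (X in dot X X <= _).
have -> : z = (th - (2 * (-1) ^+ s3) *: x') +
   (- (-1) ^+ (s2 (+) s3)) *: (th1 - (2 * (-1) ^+ s2) *: x') +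
   ((-1) ^+ (s2 (+) s3)) *: (th1 - (2 * (-1) ^+ s1) *: x).
  apply/rowP => i; rewrite /z !mxE !signr_addb.
  have : (-1) ^+ s2 * (-1) ^+ s2 = 1 :> R by rewrite -signr_addb addbb.
  move: ((-1) ^+ s2 : R) ((-1) ^+ s1 : R) ((-1) ^+ s3 : R) => u v w uu.
  have -> : th 0 i - 2 * w * x' 0 i + - (u * w) * (th1 0 i - 2 * u * x' 0 i) +
     u * w * (th1 0 i - 2 * v * x 0 i) = th 0 i - 2 * w * x' 0 i +
     2 * (u * u) * w * x' 0 i - 2 * (u * w * v) * x 0 i by ring.
  by rewrite uu; ring.
have sq (s : bool) y : dot (((-1) ^+ s) *: y) (((-1) ^+ s) *: y) = dot y y.
  by rewrite dotZl dotZr mulrA -signr_addb addbb mul1r.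
apply: dot_sum3_le => //; last by rewrite sq.
by rewrite scaleNr dotNl dotNr opprK sq.
Qed.

End ball_cells.

(** * Grids and the number of cells near given centers *)

Section grid.
Context {R : realType}.
Implicit Types s t : R.

Definition grid_index s t : nat := Num.truncn ((t + 1) / s).

Definition grid_size s : nat := (Num.truncn (2 / s)).+1.

Lemma grid_index_lt s t : 0 < s -> -1 <= t <= 1 -> (grid_index s t < grid_size s)%N.
Proof.
move=> s0 /andP[t0 t1]; rewrite ltnS; apply: le_truncn.
by rewrite ler_wpM2r ?invr_ge0 ?(ltW s0)//; lra.
Qed.

Lemma grid_index_itv s t : 0 < s -> -1 <= t ->
  (grid_index s t)%:R <= (t + 1) / s < (grid_index s t)%:R + 1.
Proof.
move=> s0 t0; rewrite natr1 truncnS_gt andbT truncn_le// divr_ge0 ?(ltW s0)//.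
lra.
Qed.

Lemma grid_index_dist s t t' : 0 < s -> -1 <= t -> -1 <= t' ->
  grid_index s t = grid_index s t' -> `|t - t'| <= s.
Proof.
move=> s0 t0 t0' tt; have := grid_index_itv s0 t0; have := grid_index_itv s0 t0'.
rewrite tt !ler_pdivlMr// !ltr_pdivrMr// => /andP[h1 h2] /andP[h3 h4].
by rewrite ler_norml; apply/andP; split; nra.
Qed.

Lemma grid_index_near s t t' : 0 < s -> -1 <= t -> -1 <= t' ->
  (`|(grid_index s t : int) - (grid_index s t' : int)|%N)%:R <= `|t - t'| / s + 1.
Proof.
move=> s0 t0 t0'; have := grid_index_itv s0 t0; have := grid_index_itv s0 t0'.
have -> : `|t - t'| / s = `|(t + 1) / s - (t' + 1) / s|.
  rewrite -mulrBl normrM (ger0_norm (x := s^-1)) ?invr_ge0 ?(ltW s0)//.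
  by congr (`|_| * _); ring.
move: ((t + 1) / s) ((t' + 1) / s) (grid_index s t) (grid_index s t') => x y a b.
move=> /andP[h1 h2] /andP[h3 h4].
have := ler_norm (x - y); have := ler_norm (y - x); rewrite (distrC y x).
wlog ba : a b x y h1 h2 h3 h4 / (b <= a)%N => [H h5 h6|h5 h6].
  have [ba|/ltnW ab] := leqP b a; first exact: H.
  rewrite distnC [`|x - y|]distrC in h5 h6 *.
  exact: H h3 h4 h1 h2 ab h6 h5.
have -> : `|(a : int) - (b : int)|%N = (a - b)%N by rewrite distnEl.
rewrite natrB//; lra.
Qed.

Context {d : nat} (eta rho : R).
Hypotheses (eta0 : 0 < eta) (rho0 : 0 < rho).

(** One vector and one scalar, each with its own mesh: a point and its squared norm for the ball
    costs, a direction and an offset for the slice costs. *)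
Definition cell_type : finType :=
  ({ffun 'I_d -> 'I_(grid_size eta)} * 'I_(grid_size rho))%type.

Definition unit_point (v : 'rV[R]_d * R) :=
  (forall j, -1 <= v.1 0 j <= 1) /\ -1 <= v.2 <= 1.

Definition grid_cell (v : 'rV[R]_d * R) : cell_type :=
  ([ffun j => inord (grid_index eta (v.1 0 j))], inord (grid_index rho v.2)).

Lemma grid_cell_dist v v' : unit_point v -> unit_point v' ->
  grid_cell v = grid_cell v' ->
  dot (v.1 - v'.1) (v.1 - v'.1) <= d%:R * eta ^+ 2 /\ `|v.2 - v'.2| <= rho.
Proof.
move=> [uv uv2] [uv' uv2'] [/ffunP h1 /(congr1 (@nat_of_ord _)) h2].
rewrite !inordK ?grid_index_lt// in h2; split; last first.
  case/andP: uv2 => ? _; case/andP: uv2' => ? _; exact: grid_index_dist h2.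
rewrite /dot mulr_natl -[X in _ *+ X]card_ord -sumr_const; apply: ler_sum => j _.
have := congr1 (@nat_of_ord _) (h1 j); rewrite !ffunE !inordK ?grid_index_lt//.
case/andP: (uv j) => ? _; case/andP: (uv' j) => ? _.
move=> /grid_index_dist h; rewrite !mxE -expr2 -[leLHS]real_normK ?num_real//.
by rewrite lerXn2r ?nnegrE ?(ltW eta0)// h.
Qed.

Lemma card_ord_itv (B c K : nat) : (#|[pred t : 'I_B | (c <= t < c + K)%N]| <= K)%N.
Proof.
rewrite cardE -(size_map (@nat_of_ord B)) -[leqRHS](size_iota c).
apply: uniq_leq_size; first by rewrite (map_inj_uniq val_inj) enum_uniq.
by move=> t /mapP[i]; rewrite mem_enum inE => /andP[h1 h2] ->; rewrite mem_iota h1.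
Qed.

Lemma l1_le_l2 (x : 'rV[R]_d) (c : R) : 0 < c -> dot x x <= d%:R * c ^+ 2 ->
  \sum_j `|x 0 j| <= d%:R * c.
Proof.
move=> c0 xc.
have h j : `|x 0 j| <= (x 0 j * x 0 j / c + c) / 2.
  rewrite ler_pdivlMr// -(ler_pM2r c0) mulrDl divfK ?gt_eqF//.
  have := sqr_ge0 (`|x 0 j| - c); rewrite sqrrB real_normK ?num_real// !expr2.
  lra.
apply: le_trans (ler_sum _ (fun j _ => h j)) _.
rewrite -mulr_suml big_split/= sumr_const card_ord -mulr_suml -/(dot x x).
rewrite ler_pdivrMr// -[c *+ d]mulr_natl.
have : dot x x / c <= d%:R * c by rewrite ler_pdivrMr// -mulrA -expr2.
lra.
Qed.

(** Euclidean balls are enlarged to l1 balls of grid indices, to which [card_l1_ball] applies.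
    Rounding adds 1 per coordinate, whence [Q.+2], and an interval of [m] meshes meets at most
    [m.+1] cells. *)
Lemma grid_cell_card (A : finType) (Q m : nat) (v0 : A -> 'rV[R]_d) (s0 : A -> R)
    (S : pred cell_type) : (0 < Q)%N ->
  (forall a j, -1 <= v0 a 0 j <= 1) ->
  (forall q, S q -> exists v a, [/\ unit_point v, grid_cell v = q,
    dot (v.1 - v0 a) (v.1 - v0 a) <= d%:R * (Q%:R * eta) ^+ 2 &
    s0 a <= v.2 <= s0 a + m%:R * rho]) ->
  (#|S| <= #|A| * ((8 * Q.+2) ^ d * m.+1))%N.
Proof.
move=> Q0 uv0 HS.
pose idx a j := grid_index eta (v0 a 0 j).
pose ball a := [pred c : {ffun 'I_d -> 'I_(grid_size eta)} |
  (\sum_(j < d) `|(c j : int) - (idx a j : int)| <= d * Q.+1)%N].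
pose itv a := [pred t : 'I_(grid_size rho) |
  (grid_index rho (s0 a) <= t < grid_index rho (s0 a) + m.+1)%N].
have bal a : (#|ball a| <= (8 * Q.+2) ^ d)%N.
  rewrite -(ler_nat R) natrX natrM.
  exact: (@card_l1_ball R d _ Q.+1 (idx a)).
apply: (@leq_trans (\sum_a #|[predX ball a & itv a]|)); last first.
  rewrite -[#|A|]sum1_card big_distrl/= leq_sum// => a _.
  by rewrite cardX mul1n; apply: leq_mul; [exact: bal|exact: card_ord_itv].
rewrite -sum1_card [leqLHS]big_mkcond/=.
under [leqRHS]eq_bigr do rewrite -sum1_card big_mkcond/=.
rewrite exchange_big/=; apply: leq_sum => q _; case: ifPn => // Sq.
have [v [a [[uv uv2] vq vb /andP[sv vs]]]] := HS q Sq.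
rewrite (bigD1 a)//= (_ : q \in _ = true)// -vq !inE /=.
apply/andP; split.
  rewrite -(ler_nat R) natr_sum natrM.
  apply: (@le_trans _ _ (\sum_(j < d) (`|(v.1 - v0 a) 0 j| / eta + 1))).
    apply: ler_sum => j _; rewrite ffunE inordK ?grid_index_lt// !mxE.
    by case/andP: (uv j) => ? _; case/andP: (uv0 a j) => ? _; exact: grid_index_near.
  have := @l1_le_l2 (v.1 - v0 a) (Q%:R * eta) _ vb.
  rewrite mulr_gt0 ?ltr0n// => /(_ isT) h.
  rewrite big_split/= -mulr_suml sumr_const card_ord -[Q.+1]addn1 natrD mulrDr mulr1.
  by rewrite lerD2r ler_pdivrMr// -mulrA.
have rv := grid_index_lt rho0 uv2; case/andP: uv2 => v1 v2.
rewrite inordK// /grid_index le_truncn; last first.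
  by rewrite ler_wpM2r ?invr_ge0 ?(ltW rho0)// lerD2r.
rewrite addnS ltnS -ltnS -(ltr_nat R).
apply: (@le_lt_trans _ _ ((v.2 + 1) / rho)).
  by rewrite truncn_le// divr_ge0 ?(ltW rho0)//; lra.
apply: (@le_lt_trans _ _ ((s0 a + 1) / rho + m%:R)).
  have -> : (s0 a + 1) / rho + m%:R = (s0 a + 1 + m%:R * rho) / rho.
    by field; rewrite gt_eqF.
  by rewrite ler_wpM2r ?invr_ge0 ?(ltW rho0)//; lra.
by rewrite -addSn natrD ltrD2r truncnS_gt.
Qed.

End grid.

(** For [d >= 1] the exponent is at most [d.+1 * (16 + 9 / 2 * k)], the affine entropy used for the
    transport classes. On the left are the shifts, four families of cells for the sign patterns, and
    one more code for [None]. *)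
Lemma grid_count_le (d k : nat) :
  ((2 ^ k.+2).+1 * (4 * ((8 * (9 * 2 ^ (4 * k.+2)).+2) ^ d * (4 * 2 ^ (4 * k.+2)).+1)).+1
    <= 2 ^ ((4 * k + 15) * d + (5 * k + 17)))%N.
Proof.
have t0 : (2 ^ 8 <= 2 ^ (4 * k.+2))%N by rewrite leq_exp2l//; lia.
have e1 : (8 * (9 * 2 ^ (4 * k.+2)).+2 <= 2 ^ (4 * k + 15))%N.
  have -> : (2 ^ (4 * k + 15) = 2 ^ (4 * k.+2) * 128)%N.
    by rewrite (_ : 128 = 2 ^ 7)%N// -expnD; congr (2 ^ _)%N; lia.
  by move: t0; rewrite (_ : 2 ^ 8 = 256)%N//; lia.
have e2 : ((4 * 2 ^ (4 * k.+2)).+1 <= 2 ^ (4 * k + 11))%N.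
  have -> : (2 ^ (4 * k + 11) = 2 ^ (4 * k.+2) * 8)%N.
    by rewrite (_ : 8 = 2 ^ 3)%N// -expnD; congr (2 ^ _)%N; lia.
  by move: t0; rewrite (_ : 2 ^ 8 = 256)%N//; lia.
have e3 : ((2 ^ k.+2).+1 <= 2 ^ (k + 3))%N.
  have -> : (2 ^ (k + 3) = 2 ^ k.+2 * 2)%N by rewrite -expnSr; congr (2 ^ _)%N; lia.
  have u0 : (0 < 2 ^ k.+2)%N by rewrite expn_gt0.
  by move: (2 ^ k.+2)%N u0 => u; lia.
have e4 : ((8 * (9 * 2 ^ (4 * k.+2)).+2) ^ d <= 2 ^ ((4 * k + 15) * d))%N.
  have [->|d0] := posnP d; first by rewrite muln0 !expn0.
  by rewrite [leqRHS]expnM leq_exp2r.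
have -> : ((4 * k + 15) * d + (5 * k + 17) =
    (k + 3) + (1 + (2 + ((4 * k + 15) * d + (4 * k + 11)))))%N by lia.
rewrite expnD leq_mul// expnD.
have -> : (2 ^ (2 + ((4 * k + 15) * d + (4 * k + 11))) =
    4 * (2 ^ ((4 * k + 15) * d) * 2 ^ (4 * k + 11)))%N by rewrite !expnD.
have := leq_mul (leqnn 4) (leq_mul e4 e2).
have : (0 < 4 * (2 ^ ((4 * k + 15) * d) * 2 ^ (4 * k + 11)))%N.
  by rewrite !muln_gt0 !expn_gt0.
set u := (4 * (2 ^ _ * _))%N; set v := (4 * _)%N; rewrite expn1; lia.
Qed.

Section geometric_classes.
Context {R : realType} {dO dT : measure_display} {Omega : measurableType dO}
  {T : measurableType dT} (P : probability Omega R) (mu : probability T R).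
Context {n : nat} (X : 'I_n -> {RV P >-> T}).
Hypothesis n_gt0 : (0 < n)%N.
Hypothesis Xlaw : forall i B, measurable B -> distribution P (X i) B = mu B.
Hypothesis Xind : mutually_independent X.

(** With [del = dyadic k.+1], the factor [2 ^ (4 * k.+2)] is [del ^ -4], the order of the ratio
    between the relevant region and the mesh, free of [p]. The pair of Booleans carries the two
    signs of the slices. With [a = 16] and [b = 9 / 2] the chaining condition reads 25 <= 32. *)
Lemma geometric_class_bounded (N d : nat) (Lam : Type) (g : Lam -> T -> R)
    (V : Lam -> 'rV[R]_d * R) (eta rho : nat -> R) :
  (0 < N)%N -> (0 < d)%N ->
  (forall l, measurable_fun setT (g l)) -> (forall l x, 0 <= g l x <= 1) ->
  (forall l, unit_point (V l)) ->
  (forall k, 0 < eta k) -> (forall k, 0 < rho k) ->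
  (forall k l l', dot ((V l).1 - (V l').1) ((V l).1 - (V l').1) <= d%:R * eta k ^+ 2 ->
    `|(V l).2 - (V l').2| <= rho k ->
    forall x, `|g l x - g l' x| <= dyadic k.+1) ->
  (forall k x, exists (v0 : bool * bool -> 'rV[R]_d) (s0 : bool * bool -> R),
    (forall a j, -1 <= v0 a 0 j <= 1) /\
    forall l1 x' l, dyadic k.+1 <= g l1 x -> dyadic k.+1 <= g l1 x' ->
      dyadic k.+1 <= g l x' -> exists a,
      dot ((V l).1 - v0 a) ((V l).1 - v0 a) <=
        d%:R * ((9 * 2 ^ (4 * k.+2))%:R * eta k) ^+ 2 /\
      s0 a <= (V l).2 <= s0 a + (4 * 2 ^ (4 * k.+2))%:R * rho k) ->
  deviation_bounded mu X (min_class (N := N) g)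
    (4 * Num.sqrt 32 * Num.sqrt (N%:R * d.+1%:R * ln 2 / n%:R)).
Proof.
move=> N0 d0 mg g01 uV eta0 rho0 gdist gcount.
have s32 : 0 < Num.sqrt 32 :> R by rewrite sqrtr_gt0.
apply: (@min_class_bounded R _ _ Omega T P mu n X n_gt0 Xlaw Xind N Lam g N0 mg g01
  (fun k => cell_type (d := d) (eta k) (rho k))
  (fun k l => grid_cell (eta k) (rho k) (V l))
  (fun k => 4 * ((8 * (9 * 2 ^ (4 * k.+2)).+2) ^ d * (4 * 2 ^ (4 * k.+2)).+1))%N
  _ _ _ d.+1%:R 16 (9 / 2)) => //; try lra.
- move=> k l l' /(grid_cell_dist (eta0 k) (rho0 k) (uV l) (uV l'))[h1 h2].
  exact: gdist.
- by move=> k; rewrite !muln_gt0 expn_gt0 muln_gt0.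
- move=> k x; have [v0 [s0 [uv0 H]]] := gcount k x.
  have cA : #|{: bool * bool}| = 4%N by rewrite card_prod card_bool.
  rewrite -[X in (X * _)%N]cA.
  have Q0 : (0 < 9 * 2 ^ (4 * k.+2))%N by rewrite muln_gt0 expn_gt0.
  apply: (@grid_cell_card _ _ _ _ (eta0 k) (rho0 k) _ _ _ v0 s0 _ Q0) => //.
  move=> q /asboolP[l1 [x' [l [<- h1 h2 h3]]]].
  by have [a [b1 b2]] := H l1 x' l h1 h2 h3; exists (V l), a; split.
- rewrite sqr_sqrtr//; lra.
- move=> k; have l2 : 0 < ln 2 :> R by rewrite ln_gt0// ltr1n.
  apply: (@le_trans _ _ (ln ((2 ^ ((4 * k + 15) * d + (5 * k + 17)))%:R : R))).
    rewrite ler_ln ?posrE ?ltr0n ?muln_gt0 ?expn_gt0// ler_nat.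
    exact: grid_count_le.
  rewrite natrX lnXn ?ltr0n// -[leLHS]mulr_natr [d.+1%:R * _]mulrC -mulrA.
  rewrite ler_wpM2l ?(ltW l2)//.
  have : (1 : R) <= d%:R by rewrite ler1n.
  have k0 : (0 : R) <= k%:R by [].
  have -> : ((4 * k + 15) * d + (5 * k + 17))%:R =
      (4 * k%:R + 15) * d%:R + (5 * k%:R + 17) :> R.
    by rewrite natrD natrM (natrD _ (5 * k)) (natrD _ (4 * k)) !natrM.
  rewrite -(natr1 d); move: (d%:R) (k%:R) k0 => u v v0 u1.
  have : 0 <= (u - 1) * v by rewrite mulr_ge0// subr_ge0.
  lra.
Qed.

End geometric_classes.

(** * Classes of rescaled ball and slice costs *)

Section euclidean_classes.
Context {R : realType} {dO : measure_display} {Omega : measurableType dO} {d : nat}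
  (P : probability Omega R) (mu : probability (euclidean R d) R).
Context {n : nat} (X : 'I_n -> {RV P >-> euclidean R d}).
Hypothesis n_gt0 : (0 < n)%N.
Hypothesis Xlaw : forall i B, measurable B -> distribution P (X i) B = mu B.
Hypothesis Xind : mutually_independent X.
Variables (N p : nat) (r : R).
Hypotheses (N_gt0 : (0 < N)%N) (d_gt0 : (0 < d)%N) (p_gt0 : (0 < p)%N) (r0 : 0 < r).

Lemma measurable_dist (y : 'rV[R]_d) :
  measurable_fun setT (fun x : euclidean R d => enorm ((x : 'rV[R]_d) - y)).
Proof.
rewrite /enorm; apply: (@measurableT_comp _ _ _ _ _ _ (@Num.sqrt R)).
  by apply: continuous_measurable_fun; exact: sqrt_continuous.
apply: measurable_sum => i; apply: measurable_funX.
under eq_fun do rewrite !mxE.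
by apply: measurable_funB => //; exact: measurable_coord.
Qed.

Lemma measurable_eball : measurable (eball r : set (euclidean R d)).
Proof.
have := measurable_dist 0.
under eq_fun do rewrite subr0; move=> me.
have := measurable_fun_ler me (@measurable_cst _ _ _ _ setT r).
move=> /(_ measurableT [set true] I); rewrite setTI.
by congr (measurable _); apply/seteqP; split => x.
Qed.

Definition rescale (x : 'rV[R]_d) : 'rV[R]_d := (2 * r)^-1 *: x.

Let r2 : 0 < 2 * r. Proof. by rewrite mulr_gt0. Qed.

Lemma dot_rescale x : enorm x <= r -> dot (rescale x) (rescale x) <= 4^-1.
Proof.
move=> xr; rewrite -enorm_sqr /rescale enormZ ger0_norm ?invr_ge0 ?(ltW r2)//.
have -> : 4^-1 = (2^-1) ^+ 2 :> R by rewrite expr2; lra.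
rewrite lerXn2r ?nnegrE ?mulr_ge0 ?invr_ge0 ?enorm_ge0 ?(ltW r2)//.
by rewrite ler_pdivrMl// mulrAC divff// mul1r.
Qed.

Lemma enorm_rescale x y :
  enorm (rescale x - rescale y) = enorm (x - y) / (2 * r).
Proof.
by rewrite /rescale -scalerBr enormZ ger0_norm ?invr_ge0 ?(ltW r2)// mulrC.
Qed.

(** Distances are divided by the diameter of the ball; the indicator keeps the values in [0, 1] on
    the whole space. *)
Definition ball_cost (y : {y : 'rV[R]_d | enorm y <= r}) (x : euclidean R d) : R :=
  \1_(eball r) x * (enorm ((x : 'rV[R]_d) - sval y) / (2 * r)) ^+ p.

Lemma ball_costE y x : enorm (x : 'rV[R]_d) <= r ->
  ball_cost y x = enorm (rescale x - rescale (sval y)) ^+ p.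
Proof.
by move=> xr; rewrite /ball_cost indicE mem_set// mul1r enorm_rescale.
Qed.

Lemma ball_cost_out y x : ~ enorm (x : 'rV[R]_d) <= r -> ball_cost y x = 0.
Proof. by move=> xr; rewrite /ball_cost indicE memNset// mul0r. Qed.

Lemma measurable_ball_cost y : measurable_fun setT (ball_cost y).
Proof.
apply: measurable_funM; first by apply: measurable_indic; exact: measurable_eball.
apply: measurable_funX; apply: measurable_funM => //; exact: measurable_dist.
Qed.

Lemma enorm_rescale_itv (x y : 'rV[R]_d) : enorm x <= r -> enorm y <= r ->
  0 <= enorm (rescale x - rescale y) <= 1.
Proof.
move=> hx hy; rewrite enorm_ge0/= -(@ler_pXn2r R 2)// ?nnegrE ?enorm_ge0//.
by rewrite expr1n enorm_sqr dot_sub_le1// dot_rescale.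
Qed.

Lemma ball_cost_itv y x : 0 <= ball_cost y x <= 1.
Proof.
have [xr|xr] := pselect (enorm (x : 'rV[R]_d) <= r).
  have /andP[h1 h2] := enorm_rescale_itv xr (svalP y).
  by rewrite ball_costE// exprn_ge0//= exprn_ile1.
by rewrite ball_cost_out// lexx ler01.
Qed.

Let slack (k : nat) : 0 < dyadic k.+1 :> R /\ dyadic k.+1 <= 4^-1 :> R.
Proof.
split; first exact: dyadic_gt0.
rewrite /dyadic exprSr exprSr -mulrA -[leRHS]mul1r.
have -> : 2^-1 * 2^-1 = 4^-1 :> R by lra.
by rewrite ler_wpM2r ?invr_ge0// exprn_ile1 ?invr_ge0// invf_le1 ?ler1n.
Qed.

Let dyadic_inv (k : nat) : (2 ^ (4 * k.+2))%:R * dyadic k.+1 ^+ 4 = 1 :> R.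
Proof.
by rewrite /dyadic -exprM mulnC natrX -exprMn mulfV ?pnatr_eq0// expr1n.
Qed.

Let coord_unit (x : 'rV[R]_d) j : dot x x <= 1 -> -1 <= x 0 j <= 1.
Proof. by move=> h; rewrite -ler_norml; apply: coord_le => //; rewrite expr1n. Qed.

Let p0 : 0 < p%:R :> R. Proof. by rewrite ltr0n. Qed.
Let d0 : 0 < d%:R :> R. Proof. by rewrite ltr0n. Qed.

Lemma ball_class_bounded :
  deviation_bounded mu X (min_class (N := N) ball_cost)
    (4 * Num.sqrt 32 * Num.sqrt (N%:R * d.+1%:R * ln 2 / n%:R)).
Proof.
(* The squared norm is recorded separately, since [far_ball_dist] needs it to order [1 / p] and the
   point only to order [p ^ (-1/2)]. *)
pose V (y : {y : 'rV[R]_d | enorm y <= r}) :=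
  (rescale (sval y), dot (rescale (sval y)) (rescale (sval y))).
have Vle (y : {y : 'rV[R]_d | enorm y <= r}) : (V y).2 <= 4^-1.
  exact: dot_rescale (svalP y).
pose eta k : R := Num.sqrt (dyadic k.+1 ^+ 6 / (9 * p%:R * d%:R)).
pose rho k : R := dyadic k.+1 ^+ 2 / (8 * p%:R).
have eta2 k : d%:R * eta k ^+ 2 = dyadic k.+1 ^+ 6 / (9 * p%:R).
  rewrite sqr_sqrtr; first by field; rewrite !gt_eqF.
  by rewrite divr_ge0 ?exprn_ge0 ?(ltW (dyadic_gt0 _))// !mulr_ge0// ltW.
apply: (@geometric_class_bounded R _ _ _ _ P mu n X n_gt0 Xlaw Xind N d _ ball_cost
  V eta rho) => //.
- exact: measurable_ball_cost.
- exact: ball_cost_itv.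
- move=> y; have h := Vle y; split => /=.
    by move=> j; apply: coord_unit; apply: le_trans h _; lra.
  by have := dot_ge0 (rescale (sval y)); move: h => /=; lra.
- move=> k; rewrite sqrtr_gt0 divr_gt0 ?exprn_gt0 ?dyadic_gt0//.
  by rewrite !mulr_gt0.
- by move=> k; rewrite divr_gt0 ?exprn_gt0 ?dyadic_gt0// mulr_gt0.
- move=> k y y'; rewrite eta2 => h1 h2 x.
  have [s1 s2] := slack k.
  have [xr|xr] := pselect (enorm (x : 'rV[R]_d) <= r); last first.
    by rewrite !ball_cost_out// subrr normr0 ltW.
  rewrite !ball_costE//; apply: far_ball_dist => //; try exact: dot_rescale.
    exact: dot_rescale (svalP y).
  exact: dot_rescale (svalP y').
move=> k x; have [s1 s2] := slack k.
have [xr|xr] := pselect (enorm (x : 'rV[R]_d) <= r); last first.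
  exists (fun=> 0), (fun=> 0); split; first by move=> a j; rewrite mxE; lra.
  by move=> l1 x' l; rewrite ball_cost_out// => /(lt_le_trans s1); rewrite ltxx.
(* By [far_ball_chain] the relevant points are near [- x], and by [far_antipodal] their squared
   norms are just below 1/4. *)
exists (fun=> - rescale x), (fun=> 4^-1 - 1 / (p%:R * dyadic k.+1 ^+ 2) / 2); split.
  move=> a j; apply: coord_unit; rewrite dotNl dotNr opprK.
  by apply: le_trans (dot_rescale xr) _; lra.
move=> y1 x' y; have [xr'|xr'] := pselect (enorm (x' : 'rV[R]_d) <= r); last first.
  by rewrite (@ball_cost_out y1 x')// => _ /(lt_le_trans s1); rewrite ltxx.
rewrite !ball_costE// => f1 f2 f3; exists (true, true); split.
  rewrite opprK.
  apply: le_trans (far_ball_chain p_gt0 s1 (dot_rescale xr) (dot_rescale xr')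
    (dot_rescale (svalP y)) (dot_rescale (svalP y1)) f1 f2 f3) _.
  rewrite [X in _ <= _ * X]exprMn [leRHS]mulrCA eta2.
  have e4 := dyadic_inv k; have dn : dyadic k.+1 != 0 :> R by rewrite gt_eqF.
  have -> : (9 * 2 ^ (4 * k.+2))%:R = 9 * (dyadic k.+1 ^+ 4)^-1 :> R.
    rewrite natrM; congr (_ * _).
    by apply: (mulIf (expf_neq0 4 dn)); rewrite e4 mulVf// expf_neq0.
  move: (dyadic k.+1) dn => D dn.
  apply/le_of_eq.
  by field; rewrite dn gt_eqF.
have [_ low] := far_antipodal p_gt0 s1 (dot_rescale xr') (dot_rescale (svalP y)) f3.
rewrite low /=; apply: le_trans (Vle y) _.
have -> : (4 * 2 ^ (4 * k.+2))%:R * rho k = 1 / (p%:R * dyadic k.+1 ^+ 2) / 2.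
  have e4 := dyadic_inv k; have dn : dyadic k.+1 != 0 :> R by rewrite gt_eqF.
  have -> : (4 * 2 ^ (4 * k.+2))%:R = 4 * (dyadic k.+1 ^+ 4)^-1 :> R.
    rewrite natrM; congr (_ * _).
    by apply: (mulIf (expf_neq0 4 dn)); rewrite e4 mulVf// expf_neq0.
  by rewrite /rho; field; rewrite dn gt_eqF.
by rewrite subrK.
Qed.

(** The direction is a parameter, so a single random bound covers all slices, averaged or maximal.
    Each of the N costs carries its own direction; the entropy is still governed by
    [N * (d + 1)]. *)
Definition slice_param := {v : 'rV[R]_d * R | enorm v.1 = 1 /\ `|v.2| <= r}.

Definition slice_cost (v : slice_param) (x : euclidean R d) : R :=
  \1_(eball r) x * (`|Defs.proj (sval v).1 x - (sval v).2| / (2 * r)) ^+ p.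

Lemma slice_costE v x : enorm (x : 'rV[R]_d) <= r ->
  slice_cost v x = `|dot (sval v).1 (rescale x) - (sval v).2 / (2 * r)| ^+ p.
Proof.
move=> xr; rewrite /slice_cost indicE mem_set// mul1r /rescale dotZr.
rewrite [_^-1 * _]mulrC -mulrBl normrM (ger0_norm (x := (2 * r)^-1))//.
by rewrite invr_ge0 ltW.
Qed.

Lemma slice_cost_out v x : ~ enorm (x : 'rV[R]_d) <= r -> slice_cost v x = 0.
Proof. by move=> xr; rewrite /slice_cost indicE memNset// mul0r. Qed.

Lemma measurable_slice_cost v : measurable_fun setT (slice_cost v).
Proof.
apply: measurable_funM; first by apply: measurable_indic; exact: measurable_eball.
apply: measurable_funX; apply: measurable_funM => //.
apply: (@measurableT_comp _ _ _ _ _ _ (@Num.norm R R)) => //.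
by apply: measurable_funB => //; exact: Defs.measurable_proj.
Qed.

Lemma slice_direction (v : slice_param) : dot (sval v).1 (sval v).1 = 1.
Proof. by case: (svalP v) => h _; rewrite -enorm_sqr h expr1n. Qed.

Lemma slice_offset (v : slice_param) : `|(sval v).2 / (2 * r)| <= 2^-1.
Proof.
case: (svalP v) => _ h; rewrite normrM (ger0_norm (x := (2 * r)^-1)).
  by rewrite ler_pdivrMr// mulrA mulVf// mul1r.
by rewrite invr_ge0 ltW.
Qed.

Lemma slice_cost_itv v x : 0 <= slice_cost v x <= 1.
Proof.
have [hx|hx] := pselect (enorm (x : 'rV[R]_d) <= r); last first.
  by rewrite slice_cost_out// lexx ler01.
rewrite slice_costE// exprn_ge0//=; apply: exprn_ile1 => //.
have := dot_rescale hx; have := slice_direction v; have := slice_offset v.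
move: (sval v) (rescale x) => [th t] z /=; rewrite ler_norml.
move: (t / (2 * r)) => u /andP[t1 t2] h1 h2; rewrite ler_norml.
have := dot_ge0 (th - 2 *: z); have := dot_ge0 (th + 2 *: z).
rewrite !dotE (dotC z th) h1 => g1 g2; apply/andP; split; lra.
Qed.

Lemma slice_class_bounded :
  deviation_bounded mu X (min_class (N := N) slice_cost)
    (4 * Num.sqrt 32 * Num.sqrt (N%:R * d.+1%:R * ln 2 / n%:R)).
Proof.
pose V (v : slice_param) := ((sval v).1, (sval v).2 / (2 * r)).
pose eta k : R := Num.sqrt (dyadic k.+1 ^+ 4 / (4 * p%:R * d%:R)).
pose rho k : R := dyadic k.+1 / (4 * p%:R).
have eta2 k : d%:R * eta k ^+ 2 = dyadic k.+1 ^+ 4 / (4 * p%:R).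
  rewrite sqr_sqrtr; first by field; rewrite !gt_eqF.
  by rewrite divr_ge0 ?exprn_ge0 ?(ltW (dyadic_gt0 _))// !mulr_ge0// ltW.
apply: (@geometric_class_bounded R _ _ _ _ P mu n X n_gt0 Xlaw Xind N d _ slice_cost
  V eta rho) => //.
- exact: measurable_slice_cost.
- exact: slice_cost_itv.
- move=> v; split; first by move=> j; apply: coord_unit; rewrite slice_direction.
  by have := slice_offset v; rewrite /= ler_norml => /andP[h1 h2]; apply/andP; split; lra.
- move=> k; rewrite sqrtr_gt0 divr_gt0 ?exprn_gt0 ?dyadic_gt0//.
  by rewrite !mulr_gt0.
- by move=> k; rewrite divr_gt0 ?dyadic_gt0// mulr_gt0.
- move=> k v v'; rewrite eta2 => h1 h2 x.
  have [s1 s2] := slack k.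
  have [xr|xr] := pselect (enorm (x : 'rV[R]_d) <= r); last first.
    by rewrite !slice_cost_out// subrr normr0 ltW.
  rewrite !slice_costE//; apply: far_slice_dist => //; try exact: dot_rescale;
    by [exact: slice_direction|exact: slice_offset].
move=> k x; have [s1 s2] := slack k.
have [xr|xr] := pselect (enorm (x : 'rV[R]_d) <= r); last first.
  exists (fun=> 0), (fun=> 0); split; first by move=> a j; rewrite mxE; lra.
  by move=> l1 x' l; rewrite slice_cost_out// => /(lt_le_trans s1); rewrite ltxx.
pose w : R := 1 / (p%:R * dyadic k.+1).
(* The first sign selects directions near [2 * x] or [- 2 * x], the second one offsets near 1/2 or
   near -1/2. *)
exists (fun a : bool * bool => (2 * (-1) ^+ a.1) *: rescale x),
  (fun a : bool * bool => if a.2 then 2^-1 - w else - 2^-1); split.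
  move=> a j; apply: coord_unit; rewrite dotZl dotZr.
  have -> : 2 * (-1) ^+ a.1 * (2 * (-1) ^+ a.1 * dot (rescale x) (rescale x)) =
      ((-1) ^+ a.1 * (-1) ^+ a.1) * (4 * dot (rescale x) (rescale x)) by ring.
  rewrite -signr_addb addbb mul1r; have := dot_rescale xr; lra.
move=> v1 x' v; have [xr'|xr'] := pselect (enorm (x' : 'rV[R]_d) <= r); last first.
  by rewrite (@slice_cost_out v1 x')// => _ /(lt_le_trans s1); rewrite ltxx.
rewrite !slice_costE// => f1 f2 f3.
have [s [s' [h1 h2]]] := far_slice_chain p_gt0 s1 (slice_direction v)
  (slice_direction v1) (dot_rescale xr)
  (dot_rescale xr') (slice_offset v) (slice_offset v1) f1 f2 f3.
have e4 := dyadic_inv k; have dn : dyadic k.+1 != 0 :> R by rewrite gt_eqF.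
have inv4 : (2 ^ (4 * k.+2))%:R = (dyadic k.+1 ^+ 4)^-1 :> R.
  by apply: (mulIf (expf_neq0 4 dn)); rewrite e4 mulVf// expf_neq0.
have i0 : 0 < (dyadic k.+1 : R)^-1 by rewrite invr_gt0.
have i4 : 4 <= (dyadic k.+1 : R)^-1.
  by rewrite -[4]invrK lef_pV2 ?posrE ?invr_gt0.
exists (s, s'); split => /=.
  apply: le_trans h1 _; rewrite [X in _ <= _ * X]exprMn [leRHS]mulrCA eta2 natrM inv4.
  move: (dyadic k.+1) dn i0 i4 s1 s2 => D dn i0 i4 s1 s2.
  have -> : (9%:R * (D ^+ 4)^-1) ^+ 2 * (D ^+ 4 / (4 * p%:R)) =
     (p%:R * D)^-1 * (81 / 4 * (D^-1) ^+ 3) :> R.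
    by field; rewrite dn gt_eqF.
  have -> : 9 * (4 / (p%:R * D)) = (p%:R * D)^-1 * 36 :> R.
    by field; rewrite dn gt_eqF.
  rewrite ler_wpM2l ?invr_ge0 ?mulr_ge0 ?(ltW s1)//.
  have : 4 ^+ 3 <= (D^-1) ^+ 3 :> R.
    by rewrite lerXn2r ?nnegrE ?(ltW i0).
  rewrite !exprS expr0; lra.
have -> : (4 * 2 ^ (4 * k.+2))%:R * rho k = w * ((dyadic k.+1)^-1) ^+ 2.
  by rewrite natrM inv4 /rho /w; field; rewrite dn gt_eqF.
have w0 : 0 < w by rewrite divr_gt0// mulr_gt0.
have ww : w <= w * ((dyadic k.+1)^-1) ^+ 2.
  by rewrite ler_peMr ?(ltW w0)// exprn_ege1//; lra.
move: ((sval v).2 / (2 * r)) h2 => t; rewrite -/w.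
case: (s'); rewrite ?expr1 ?expr0 => /andP[b1 b2]; apply/andP; split; lra.
Qed.

End euclidean_classes.

(** * Soft minima of costs *)

Section softmin.
Context {R : realType} {N : nat}.
Variable tau : R.
Hypothesis tau0 : 0 < tau.
Implicit Types (g w h t : 'I_N -> R) (x y s D : R).

Definition softmin w g : R := - tau * ln (\sum_i w i * expR (- (g i / tau))).

Definition weights w := (forall i, 0 <= w i) /\ \sum_i w i = 1.

Let kappa := expR (- tau^-1).

Let kappa0 : 0 < kappa. Proof. exact: expR_gt0. Qed.

Let kappa1 : kappa <= 1.
Proof. by rewrite /kappa -expR0 ler_expR oppr_le0 invr_ge0 ltW. Qed.

Let kappa_itv g : (forall i, 0 <= g i <= 1) ->
  forall i, kappa <= expR (- (g i / tau)) <= 1.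
Proof.
move=> g01 i; have /andP[g0 g1] := g01 i.
apply/andP; split; last by rewrite -[leRHS]expR0 ler_expR oppr_le0 divr_ge0 ?(ltW tau0).
by rewrite ler_expR lerN2 -[leRHS]mul1r ler_wpM2r ?invr_ge0 ?(ltW tau0).
Qed.

Let sum_itv w h : weights w -> (forall i, kappa <= h i <= 1) ->
  kappa <= \sum_i w i * h i <= 1.
Proof.
move=> [w0 w1] h01; apply/andP; split.
  rewrite -[leLHS]mul1r -w1 mulr_suml; apply: ler_sum => i _.
  by rewrite ler_wpM2l//; case/andP: (h01 i).
rewrite -[leRHS]w1; apply: ler_sum => i _; rewrite -[leRHS]mulr1 ler_wpM2l//.
by case/andP: (h01 i).
Qed.

Lemma softmin_itv w g : weights w -> (forall i, 0 <= g i <= 1) ->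
  0 <= softmin w g <= 1.
Proof.
move=> ww g01; have /andP[s0 s1] := sum_itv ww (kappa_itv g01).
have sp := lt_le_trans kappa0 s0; rewrite /softmin mulNr.
have l0 := ln_le0 s1; have : - tau^-1 <= ln (\sum_i w i * expR (- (g i / tau))).
  by rewrite -[leLHS]expRK ler_ln// posrE expR_gt0.
rewrite -(ler_pM2l tau0) mulrN mulfV ?gt_eqF// => h.
by have := mulr_ge0_le0 (ltW tau0) l0; move: h => h1 h2; apply/andP; split; lra.
Qed.

Lemma softmin_shift w g g' D : weights w -> (forall i, 0 <= g i <= 1) ->
  (forall i, 0 <= g' i <= 1) -> (forall i, g' i <= g i + D) ->
  softmin w g' <= softmin w g + D.
Proof.
move=> ww g01 g01' gg.
have /andP[s0 _] := sum_itv ww (kappa_itv g01).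
have /andP[s0' _] := sum_itv ww (kappa_itv g01').
have sp := lt_le_trans kappa0 s0; have sp' := lt_le_trans kappa0 s0'.
have : ln (\sum_i w i * expR (- (g i / tau))) <=
    D / tau + ln (\sum_i w i * expR (- (g' i / tau))).
  rewrite -[D / tau]expRK -lnM ?posrE ?expR_gt0// ler_ln ?posrE ?mulr_gt0 ?expR_gt0//.
  rewrite mulr_sumr; apply: ler_sum => i _; rewrite mulrCA -expRD.
  have [w0 _] := ww; rewrite ler_wpM2l// ler_expR -mulrBl -mulNr.
  rewrite ler_wpM2r ?invr_ge0 ?(ltW tau0)//; have := gg i; lra.
rewrite -(ler_pM2l tau0) mulrDr mulrCA mulfV ?gt_eqF// mulr1 /softmin !mulNr; lra.
Qed.

(* Weights are discretized on the logarithmic scale, shifted so that weights of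
   order kappa / N or less are not distinguished. *)
Definition weight_scale D := D / (4 * Num.min 1 tau).

Definition log_weight w i := ln (1 + w i * N%:R / kappa).

Let ms0 : 0 < Num.min 1 tau. Proof. by rewrite lt_min ltr01. Qed.

Lemma weight_scale_gt0 D : 0 < D -> 0 < weight_scale D.
Proof. by move=> D0; rewrite divr_gt0// mulr_gt0. Qed.

(** The logarithmic weights compare [w i + kappa / N] with [w' i + kappa / N] up to the factor
    [expR s]; the shifts [kappa / N] add up to [kappa * c]. *)
Let sum_weight_dist w w' t c s : (0 < N)%N -> (forall i, 0 <= w i) ->
  (forall i, 0 <= w' i) -> 0 <= s ->
  (forall i, log_weight w i <= s + log_weight w' i) -> (forall i, 0 <= t i <= c) ->
  \sum_i w i * t i - \sum_i w' i * t i <=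
  (expR s - 1) * (\sum_i w' i * t i + kappa * c).
Proof.
move=> N0 w0 w0' s0 ww' tc.
have Np : 0 < N%:R :> R by rewrite ltr0n.
have e1 : 0 <= expR s - 1 by rewrite subr_ge0 -expR0 ler_expR.
have H i : w i - w' i <= (expR s - 1) * (w' i + kappa / N%:R).
  have pos (v : R) : 0 <= v -> 0 < 1 + v * N%:R / kappa.
    by move=> v0; rewrite ltr_wpDr// !mulr_ge0// invr_ge0 ltW.
  have := ww' i; rewrite /log_weight -[s]expRK -lnM ?posrE ?expR_gt0 ?pos// expRK.
  rewrite ler_ln ?posrE ?mulr_gt0 ?expR_gt0 ?pos//.
  have kN : 0 < kappa / N%:R by rewrite divr_gt0.
  rewrite -(ler_pM2r kN).
  have E (v : R) : (1 + v * N%:R / kappa) * (kappa / N%:R) = v + kappa / N%:R.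
    by field; rewrite !gt_eqF.
  by rewrite -[X in _ <= X -> _]mulrA !E; lra.
rewrite -sumrB.
apply: (@le_trans _ _ (\sum_i (expR s - 1) * (w' i * t i + kappa / N%:R * c))).
  apply: ler_sum => i _; have /andP[t0 t1] := tc i; rewrite -mulrBl.
  apply: le_trans (ler_wpM2r t0 (H i)) _; rewrite -[leLHS]mulrA ler_wpM2l// mulrDl lerD2l.
  by rewrite ler_wpM2l// divr_ge0// ltW.
rewrite -mulr_sumr big_split/= sumr_const card_ord ler_wpM2l// lerD2l.
by rewrite -[_ *+ N]mulr_natr mulrAC divfK ?gt_eqF.
Qed.

(** The estimate is uniform in [tau]. For a small scale [s] the prefactor [tau] is compensated by
    the oscillation [1 - kappa <= 1 / tau] of the exponentials; a scale above 1 occurs only at low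
    temperature, where a crude comparison of logarithms is affordable. *)
Lemma softmin_weight w w' g D : (0 < N)%N -> weights w -> weights w' ->
  (forall i, 0 <= g i <= 1) -> 0 < D <= 1 ->
  (forall i, log_weight w i <= weight_scale D + log_weight w' i) ->
  softmin w' g <= softmin w g + D.
Proof.
move=> N0 ww ww' g01 /andP[D0 D1] H.
pose h i := expR (- (g i / tau)).
have h01 i : kappa <= h i <= 1 := kappa_itv g01 i.
have /andP[a0 a1] := sum_itv ww h01; have /andP[b0 b1] := sum_itv ww' h01.
set a := \sum_i w i * h i in a0 a1; set b := \sum_i w' i * h i in b0 b1.
have ap := lt_le_trans kappa0 a0; have bp := lt_le_trans kappa0 b0.
set s := weight_scale D in H; have s0 : 0 < s := weight_scale_gt0 D0.
have sD : 4 * Num.min 1 tau * s = D.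
  by rewrite /s /weight_scale mulrC divfK// gt_eqF// mulr_gt0.
suff : tau * (ln a - ln b) <= D by rewrite /softmin -/a -/b !mulNr; lra.
have [w0 w1] := ww; have [w0' w1'] := ww'.
have [s1|s1] := leP s 1.
  have es : expR s - 1 <= 2 * s.
    have := @expR_le_quadratic R s; rewrite s1 andbT (le_trans _ (ltW s0)) ?lerN10//.
    by move=> /(_ isT); rewrite expr2; nra.
  (* Both weights sum to 1, so the constant [kappa] can be subtracted before comparing, which leaves
     terms of size [1 - kappa]. *)
  have tc i : 0 <= h i - kappa <= 1 - kappa.
    by have /andP[? ?] := h01 i; apply/andP; split; lra.
  have := sum_weight_dist N0 w0 w0' (ltW s0) H tc.
  have sB (v : 'I_N -> R) : \sum_i v i = 1 ->
      \sum_i v i * (h i - kappa) = \sum_i v i * h i - kappa.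
    move=> v1; under eq_bigr do rewrite mulrBr.
    by rewrite sumrB -mulr_suml v1 mul1r.
  rewrite !sB// -/a -/b => ab.
  have k1 : 0 <= 1 - kappa by rewrite subr_ge0.
  have c1 : b - kappa + kappa * (1 - kappa) <= 2 * (1 - kappa) * b by nra.
  have c0 : 0 <= b - kappa + kappa * (1 - kappa).
    by rewrite addr_ge0 ?subr_ge0// mulr_ge0 ?(ltW kappa0).
  have ab2 : a / b - 1 <= 4 * s * (1 - kappa).
    rewrite -[X in _ - X](mulfV (lt0r_neq0 bp)) -mulrBl ler_pdivrMr//.
    have e0 : 0 <= expR s - 1 by rewrite subr_ge0 -expR0 ler_expR ltW.
    have := ler_pM e0 c0 es c1; lra.
  have lab : ln a - ln b <= a / b - 1.
    rewrite -lnV ?posrE// -lnM ?posrE ?invr_gt0//.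
    have := @le_ln1Dx R (a / b - 1); rewrite [1 + _]addrC subrK; apply.
    by have := divr_gt0 ap bp; lra.
  have tk : tau * (1 - kappa) <= Num.min 1 tau.
    rewrite le_min; apply/andP; split; last first.
      by rewrite mulrBr mulr1 gerBl mulr_ge0 ?(ltW tau0) ?(ltW kappa0).
    rewrite -[leRHS](mulfV (lt0r_neq0 tau0)) ler_wpM2l ?(ltW tau0)//.
    by have := expR_ge1Dx (- tau^-1); rewrite -/kappa; lra.
  apply: le_trans (ler_wpM2l (ltW tau0) (le_trans lab ab2)) _.
  by have := ler_wpM2l (ltW s0) tk; rewrite -sD; lra.
(* Since [4 * Num.min 1 tau * s = D <= 1], a scale above 1 forces [tau < 1 / 4], and [tau * (1 + s)]
   is then at most [4 * tau * s = D]. *)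
have m1 : Num.min 1 tau < 4^-1 by nra.
have mt : Num.min 1 tau = tau.
  by rewrite /Num.min; move: m1; rewrite /Num.min; case: ifP => // _; lra.
have h1 i : 0 <= h i <= 1.
  by have /andP[k0 ->] := h01 i; rewrite (le_trans (ltW kappa0)).
have := sum_weight_dist N0 w0 w0' (ltW s0) H h1; rewrite -/a -/b mulr1 => ab.
have e1 : 1 <= expR s by rewrite -expR0 ler_expR ltW.
have l2 : ln 2 <= 1 :> R by have := @le_ln1Dx R 1; apply; lra.
have : ln a <= ln 2 + s + ln b.
  rewrite -[s]expRK -!lnM ?posrE ?mulr_gt0 ?expR_gt0// ler_ln ?posrE ?mulr_gt0 ?expR_gt0//.
  by nra.
rewrite mt in sD m1; move=> lab.
have : tau * (ln a - ln b) <= tau * (1 + s) by rewrite ler_wpM2l ?(ltW tau0)//; lra.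
by move: sD; nra.
Qed.

(** Jensen's inequality at the average weight [1 / N], through the tangent of the logarithm at [A];
    [ln A <= 1 + 1 / tau] makes the product bounded uniformly in [tau]. The discretized weights thus
    lie in an l1 ball of radius proportional to [N], counted without a factor [ln N] in the
    entropy. *)
Lemma sum_log_weight w : (0 < N)%N -> weights w ->
  Num.min 1 tau * (\sum_i log_weight w i) <= 2 * N%:R.
Proof.
move=> N0 [w0 w1]; have Np : 0 < N%:R :> R by rewrite ltr0n.
have ik : 0 < kappa^-1 by rewrite invr_gt0.
pose A := 1 + kappa^-1; have A0 : 0 < A by rewrite addr_gt0.
have tang i : log_weight w i <= ln A + (w i * N%:R - 1) / kappa / A.
  have p0 : 0 < 1 + w i * N%:R / kappa.
    by rewrite ltr_wpDr// !mulr_ge0// ltW.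
  rewrite -lerBlDl -lnV ?posrE// -lnM ?posrE ?invr_gt0//.
  have := @le_ln1Dx R ((1 + w i * N%:R / kappa) / A - 1).
  rewrite [1 + (_ - 1)]addrC subrK => /(_ _)/le_trans; apply.
    by have := divr_gt0 p0 A0; lra.
  apply/le_of_eq.
  rewrite /A; field; rewrite gt_eqF//= gt_eqF//.
  by rewrite -[1]mulr1 ltr_pwDl.
have sA : \sum_i log_weight w i <= N%:R * ln A.
  apply: le_trans (ler_sum _ (fun i _ => tang i)) _.
  rewrite big_split/= sumr_const card_ord -[_ *+ N]mulr_natl gerDl.
  by rewrite -!mulr_suml sumrB -mulr_suml w1 mul1r sumr_const card_ord subrr !mul0r.
have lA : ln A <= 1 + tau^-1.
  have l2 : ln 2 <= 1 :> R by have := @le_ln1Dx R 1; apply; lra.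
  have : ln A <= ln (2 * kappa^-1).
    by rewrite ler_ln ?posrE ?mulr_gt0// /A; have := invf_ge1 kappa0; rewrite kappa1; lra.
  rewrite lnM ?posrE// lnV ?posrE// /kappa expRK opprK; lra.
have mA : Num.min 1 tau * (1 + tau^-1) <= 2.
  have [h1 h2] : Num.min 1 tau <= 1 /\ Num.min 1 tau <= tau.
    by rewrite !ge_min !lexx orbT.
  rewrite mulrDr mulr1; apply: (@le_trans _ _ (1 + tau * tau^-1)); last first.
    by rewrite mulfV ?gt_eqF.
  by rewrite lerD// ler_wpM2r// invr_ge0 ltW.
apply: le_trans (ler_wpM2l (ltW ms0) sA) _.
have := ler_wpM2l (ltW ms0) lA; move: (Num.min 1 tau) mA => m mA h; nra.
Qed.

End softmin.

Lemma enorm_eq0 (R : realType) (d : nat) (x : 'rV[R]_d) : enorm x = 0 -> x = 0.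
Proof.
move=> x0; apply/rowP => j; rewrite mxE; apply/eqP; rewrite -normr_le0.
by apply: coord_le; rewrite // -enorm_sqr x0.
Qed.

Lemma enormD (R : realType) (d : nat) (x y : 'rV[R]_d) :
  enorm (x + y) <= enorm x + enorm y.
Proof.
have [/enorm_eq0 ->|x0] := eqVneq (enorm x) 0; first by rewrite add0r lerDr enorm_ge0.
have [/enorm_eq0 ->|y0] := eqVneq (enorm y) 0; first by rewrite addr0 lerDl enorm_ge0.
have xp : 0 < enorm x by rewrite lt_neqAle eq_sym x0 enorm_ge0.
have yp : 0 < enorm y by rewrite lt_neqAle eq_sym y0 enorm_ge0.
rewrite -(@ler_pXn2r R 2)// ?nnegrE ?addr_ge0 ?enorm_ge0//.
rewrite sqrrD !enorm_sqr !dotE (dotC y x).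
have := @dot_young R d (enorm y / enorm x) x y (divr_gt0 yp xp).
rewrite -!enorm_sqr invf_div.
have -> : enorm y / enorm x * enorm x ^+ 2 + enorm y ^+ 2 * (enorm x / enorm y) =
  2 * (enorm x * enorm y) by field; rewrite x0 y0.
by rewrite mulr2n; lra.
Qed.

Section softmin_class.
Context {R : realType} {dO : measure_display} {Omega : measurableType dO} {d : nat}
  (P : probability Omega R) (mu : probability (euclidean R d) R).
Context {n : nat} (X : 'I_n -> {RV P >-> euclidean R d}).
Hypothesis n_gt0 : (0 < n)%N.
Hypothesis Xlaw : forall i B, measurable B -> distribution P (X i) B = mu B.
Hypothesis Xind : mutually_independent X.
Variables (N p : nat) (r tau : R).
Hypotheses (N_gt0 : (0 < N)%N) (d_gt0 : (0 < d)%N) (p_gt0 : (0 < p)%N) (r0 : 0 < r).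
Hypothesis tau0 : 0 < tau.

Record weighted_points := WeightedPoints {
  wp_point : 'I_N -> {y : 'rV[R]_d | enorm y <= r};
  wp_weight : 'I_N -> R;
  wp_weights : weights wp_weight }.

Definition softmin_class (l : weighted_points) (x : euclidean R d) : R :=
  softmin tau (wp_weight l) (fun i => ball_cost p (wp_point l i) x).

Let g01 l x i : 0 <= ball_cost p (wp_point l i) x <= 1.
Proof. exact: ball_cost_itv. Qed.

Let p0 : 0 < p%:R :> R. Proof. by rewrite ltr0n. Qed.
Let d0 : 0 < d%:R :> R. Proof. by rewrite ltr0n. Qed.

Lemma bmf_softmin_class l : bounded_measurable (softmin_class l).
Proof.
have [w0 w1] := wp_weights l.
apply: bmf_scale; apply: (@bmf_ln _ _ _ _ (expR (- tau^-1))).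
- exact: expR_gt0.
- move=> x; rewrite -[leLHS]mul1r -w1 mulr_suml; apply: ler_sum => i _.
  rewrite ler_wpM2l// ler_expR lerN2 -[leRHS]mul1r ler_wpM2r ?invr_ge0 ?(ltW tau0)//.
  by case/andP: (g01 l x i).
apply: bmf_sum => i; apply: bmf_scale; apply: bmf_exp; apply: bmf_opp.
under eq_fun do rewrite mulrC.
apply: bmf_scale; split; first exact: measurable_ball_cost.
by exists 1 => x; rewrite ger0_norm; case/andP: (g01 l x i).
Qed.

Let dyadic_inv (k : nat) : (2 ^ k.+2)%:R * dyadic k.+1 = 1 :> R.
Proof. by rewrite /dyadic natrX -exprMn mulfV ?pnatr_eq0// expr1n. Qed.

Let slack (k : nat) : 0 < dyadic k.+1 :> R /\ dyadic k.+1 <= 1 :> R.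
Proof.
split; first exact: dyadic_gt0.
by rewrite /dyadic exprn_ile1 ?invr_ge0// invf_le1 ?ler1n.
Qed.

(** A Lipschitz bound with constant [p] is affordable here because the entropic constant grows with
    [p]; all cells of the ball are counted. *)
Lemma ball_cost_dist (y y' : {y : 'rV[R]_d | enorm y <= r}) (D : R) :
  dot (rescale r (sval y) - rescale r (sval y'))
      (rescale r (sval y) - rescale r (sval y')) <= (D / p%:R) ^+ 2 ->
  0 <= D -> forall x, ball_cost p y x <= ball_cost p y' x + D.
Proof.
move=> yy D0 x; have [xr|xr] := pselect (enorm (x : 'rV[R]_d) <= r); last first.
  by rewrite !ball_cost_out// add0r.
rewrite !ball_costE//; have := enorm_rescale_itv r0 xr (svalP y).
have := enorm_rescale_itv r0 xr (svalP y').
set a := rescale r x - _; set b := rescale r x - _ => /andP[a0 a1] /andP[b0 b1].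
have [ba|/ltW ab] := leP (enorm b) (enorm a).
  by rewrite ler_wpDr// lerXn2r.
have ab0 : 0 <= enorm a <= enorm b by rewrite a0.
rewrite -lerBlDl; apply: le_trans (expr_sub_le p ab0 b1) _.
rewrite -ler_pdivlMl// mulrC lerBlDl.
have -> : b = a + (b - a) by rewrite addrC subrK.
apply: le_trans (enormD _ _) _; rewrite lerD2l.
rewrite -(@ler_pXn2r R 2)// ?nnegrE ?enorm_ge0 ?divr_ge0// enorm_sqr.
apply: le_trans yy; rewrite /a /b opprB addrC addrA subrK.
by rewrite -opprB dotNl dotNr opprK lexx.
Qed.

Let eta k : R := dyadic k.+1 / (p%:R * Num.sqrt d%:R).

Let eta0 k : 0 < eta k.
Proof. by rewrite divr_gt0 ?dyadic_gt0// mulr_gt0// sqrtr_gt0. Qed.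

Let eta2 k : d%:R * eta k ^+ 2 = (dyadic k.+1 / p%:R) ^+ 2.
Proof.
have s2 : Num.sqrt d%:R ^+ 2 = d%:R :> R by rewrite sqr_sqrtr// ltW.
have sn : Num.sqrt d%:R != 0 :> R by rewrite gt_eqF// sqrtr_gt0.
rewrite -[in LHS]s2 /eta; move: (dyadic k.+1) (Num.sqrt _) sn => D s sn.
by field; rewrite sn gt_eqF.
Qed.

Let pt (y : {y : 'rV[R]_d | enorm y <= r}) : 'rV[R]_d * R := (rescale r (sval y), 0).

Let unit_pt y : unit_point (pt y).
Proof.
split => [j|] /=; last by rewrite lerN10 ler01.
rewrite -ler_norml; apply: coord_le => //; rewrite expr1n.
by apply: le_trans (dot_rescale r0 (svalP y)) _; lra.
Qed.

Let point_cells k : pred (cell_type (d := d) (eta k) 1) :=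
  fun q => `[< exists y, grid_cell (eta k) 1 (pt y) = q >].

Let card_point_cells k : (#|@point_cells k| <= (2 ^ (k + p + 5)) ^ d)%N.
Proof.
have Q0 : (0 < p * 2 ^ k.+1)%N by rewrite muln_gt0 p_gt0 expn_gt0.
apply: leq_trans (@grid_cell_card R d _ _ (eta0 k) ltr01 unit (p * 2 ^ k.+1) 0
  (fun=> 0) (fun=> 0) (@point_cells k) Q0 _ _) _.
- by move=> _ j; rewrite mxE lerN10 ler01.
- move=> q /asboolP[y <-]; exists (pt y), tt; split => //=.
    rewrite subr0; apply: le_trans (dot_rescale r0 (svalP y)) _.
    rewrite [X in _ <= _ * X]exprMn mulrCA eta2 -exprMn.
    have := dyadic_inv k; rewrite expnS natrM => h.
    rewrite natrM; have -> : p%:R * (2 ^ k.+1)%:R * (dyadic k.+1 / p%:R) = 2^-1 :> R.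
      have -> : p%:R * (2 ^ k.+1)%:R * (dyadic k.+1 / p%:R) = (2 ^ k.+1)%:R * dyadic k.+1 :> R.
        by field; rewrite gt_eqF.
      by lra.
    by rewrite expr2; lra.
  by rewrite mul0r addr0 lexx.
rewrite card_unit mul1n muln1 leq_exp2r//.
have := ltn_expl p (isT : (1 < 2)%N) => pp.
have h2 : (2 <= p * 2 ^ k.+1)%N.
  by rewrite expnS mulnCA leq_pmulr// muln_gt0 p_gt0 expn_gt0.
apply: (@leq_trans (8 * (2 * (p * 2 ^ k.+1)))%N).
  by move: (p * 2 ^ k.+1)%N h2 => u; lia.
have -> : (2 ^ (k + p + 5) = 2 ^ p * (16 * 2 ^ k.+1))%N.
  by rewrite (_ : 16 = 2 ^ 4)%N// -!expnD; congr (2 ^ _)%N; lia.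
have : (p * 2 ^ k.+1 <= 2 ^ p * 2 ^ k.+1)%N by rewrite leq_mul2r ltnW ?orbT.
by move: (2 ^ p)%N (2 ^ k.+1)%N => u v; nia.
Qed.

Let weight_index k (l : weighted_points) i : nat :=
  Num.truncn (log_weight tau (wp_weight l) i / weight_scale tau (dyadic k.+1)).

Let log_weight_ge0 (l : weighted_points) i : 0 <= log_weight tau (wp_weight l) i.
Proof.
have [w0 _] := wp_weights l.
by rewrite ln_ge0// lerDl !mulr_ge0// invr_ge0 expR_ge0.
Qed.

Let weight_index_itv k l i :
  (weight_index k l i)%:R * weight_scale tau (dyadic k.+1) <=
    log_weight tau (wp_weight l) i <
  (weight_index k l i)%:R * weight_scale tau (dyadic k.+1) +
    weight_scale tau (dyadic k.+1).
Proof.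
rewrite /weight_index; set s := weight_scale _ _.
have s0 : 0 < s by apply: weight_scale_gt0 => //; exact: dyadic_gt0.
rewrite -ler_pdivlMr// -[X in _ + X]mul1r -mulrDl -ltr_pdivrMr// natr1 truncnS_gt.
by rewrite andbT truncn_le// divr_ge0// ltW.
Qed.

Let sum_weight_index k l : (\sum_i weight_index k l i <= N * 2 ^ (k + 5))%N.
Proof.
have s0 : 0 < weight_scale tau (dyadic k.+1).
  by apply: weight_scale_gt0 => //; exact: dyadic_gt0.
rewrite -(ler_nat R) natr_sum -(ler_pM2r s0) mulr_suml.
apply: (@le_trans _ _ (\sum_i log_weight tau (wp_weight l) i)).
  by apply: ler_sum => i _; case/andP: (weight_index_itv k l i).
have m0 : 0 < Num.min 1 tau by rewrite lt_min ltr01.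
rewrite -(ler_pM2l m0); apply: le_trans (sum_log_weight tau0 N_gt0 (wp_weights l)) _.
have := dyadic_inv k; rewrite natrM.
have -> : (2 ^ (k + 5))%:R = (2 ^ k.+2)%:R * 8 :> R.
  rewrite -natrM (_ : 8 = 2 ^ 3)%N// -expnD; congr (2 ^ _)%:R; lia.
rewrite /weight_scale.
move: (dyadic k.+1) ((2 ^ k.+2)%:R : R) (Num.min 1 tau) m0 => D u m m0 uD.
have -> : m * (N%:R * (u * 8) * (D / (4 * m))) = 2 * N%:R * (u * D).
  by field; rewrite gt_eqF.
by rewrite uD mulr1.
Qed.

Let weight_code k : finType := {ffun 'I_N -> 'I_(N * 2 ^ (k + 5)).+1}.

Let code k (l : weighted_points) : {ffun 'I_N -> cell_type (d := d) (eta k) 1} * weight_code k :=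
  ([ffun i => grid_cell (eta k) 1 (pt (wp_point l i))],
   [ffun i => inord (weight_index k l i)]).

Let weight_index_lt k l i : (weight_index k l i < (N * 2 ^ (k + 5)).+1)%N.
Proof.
rewrite ltnS; apply: leq_trans (sum_weight_index k l).
by rewrite (bigD1 i)//= leq_addr.
Qed.

Let code_dist k l l' : code k l = code k l' ->
  forall x, `|softmin_class l x - softmin_class l' x| <= dyadic k.
Proof.
suff H l1 l2 : code k l1 = code k l2 ->
    forall x, softmin_class l1 x <= softmin_class l2 x + dyadic k.
  move=> ll x; have := H _ _ ll x; have := H _ _ (esym ll) x.
  rewrite ler_norml; move: (softmin_class l x) (softmin_class l' x) (dyadic k).
  by move=> a b D h1 h2; apply/andP; split; lra.
move=> [/ffunP e1 /ffunP e2] x; have [D0 D1] := slack k.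
have h1 : softmin_class l1 x <= softmin tau (wp_weight l1)
    (fun i => ball_cost p (wp_point l2 i) x) + dyadic k.+1.
  apply: (softmin_shift tau0 (wp_weights l1)) => // i.
  apply: ball_cost_dist; last exact: ltW.
  have := e1 i; rewrite !ffunE => /(grid_cell_dist (eta0 k) ltr01 (unit_pt _) (unit_pt _)).
  by move=> [/= h _]; rewrite eta2 in h.
apply: le_trans h1 _; rewrite (dyadicS k) mulr_natl mulr2n addrA lerD2r.
apply: (softmin_weight tau0 N_gt0 (wp_weights l2) (wp_weights l1)) => //.
  by rewrite D0.
move=> i; have := congr1 (@nat_of_ord _) (e2 i).
rewrite !ffunE !inordK// => qq.
have /andP[_ /ltW a2] := weight_index_itv k l2 i.
have /andP[b1 _] := weight_index_itv k l1 i.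
by apply: le_trans a2 _; rewrite addrC lerD2l -qq.
Qed.

Let bound k : nat := (((2 ^ (k + p + 5)) ^ d * 2 ^ (k + 9)) ^ N)%N.

Let code_card k (S : pred ({ffun 'I_N -> cell_type (d := d) (eta k) 1} * weight_code k)) :
  (forall c, S c -> exists l, code k l = c) -> (#|S|%:R <= (bound k)%:R :> R).
Proof.
move=> HS; pose A : pred {ffun 'I_N -> cell_type (d := d) (eta k) 1} :=
  ffun_on (@point_cells k).
pose B := [pred m : weight_code k |
  (\sum_(j < N) `|(m j : int) - ((fun=> 0%N) j : int)| <= N * 2 ^ (k + 5))%N].
have Q0 : (0 < 2 ^ (k + 5))%N by rewrite expn_gt0.
have cB : (#|B|%:R <= (2 ^ (k + 9))%:R ^+ N :> R).
  apply: le_trans (card_l1_ball R _ (fun=> 0%N) Q0) _.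
  rewrite lerXn2r ?nnegrE ?mulr_ge0// -natrM ler_nat.
  have -> : (2 ^ (k + 9) = 8 * (2 * 2 ^ (k + 5)))%N.
    by rewrite (_ : 8 = 2 ^ 3)%N// -expnS -expnD; congr (2 ^ _)%N; lia.
  by move: (2 ^ (k + 5))%N Q0 => u; lia.
have cA : (#|A|%:R <= ((2 ^ (k + p + 5)) ^ d)%:R ^+ N :> R).
  rewrite -natrX ler_nat card_ffun_on card_ord.
  by rewrite leq_exp2r// card_point_cells.
apply: (@le_trans _ _ (#|A|%:R * #|B|%:R)).
  rewrite -natrM ler_nat -cardX; apply/subset_leq_card/fintype.subsetP => c /HS[l <-].
  rewrite !inE /=; apply/andP; split.
    apply/ffun_onP => i; rewrite ffunE /point_cells; apply/asboolP.
    by exists (wp_point l i).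
  apply: leq_trans (sum_weight_index k l); apply: leq_sum => i _.
  by rewrite ffunE inordK// addn0.
by rewrite /bound natrX natrM exprMn ler_pM.
Qed.

Lemma softmin_class_bounded :
  deviation_bounded mu X softmin_class
   (8 * Num.sqrt 2 * (4 * p%:R + 1) * Num.sqrt (N%:R * d.+1%:R * ln 2 / n%:R)).
Proof.
have sq2 : 0 < Num.sqrt 2 :> R by rewrite sqrtr_gt0.
have sq22 : Num.sqrt 2 ^+ 2 = 2 :> R by rewrite sqr_sqrtr.
have -> : 8 * Num.sqrt 2 * (4 * p%:R + 1) = 4 * (2 * Num.sqrt 2 * (4 * p%:R + 1)) :> R.
  by ring.
have p1 : 1 <= p%:R :> R by rewrite ler1n.
(* The entropy condition reads [(k + p + 5) * d + (k + 9) <= d.+1 * (9 + p + k)], and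
   [a + 2 * b = 11 + p] is well below [8 * (4 * p + 1) ^ 2]. *)
apply: (@chaining_bound R _ _ Omega _ P mu n X n_gt0 Xlaw Xind _ softmin_class _ code
  (fun k => (bound k)%:R) (N%:R * d.+1%:R) (9 + p%:R) 1) => //.
- by move=> l; case: (bmf_softmin_class l).
- by move=> l x; apply: (softmin_itv tau0 (wp_weights l)).
- move=> k; rewrite ler_nat /bound; set a := ((2 ^ (k + p + 5)) ^ d)%N.
  have a0 : (0 < a)%N by rewrite !expn_gt0.
  apply: (@leq_trans (a * 2 ^ (k + 9))%N).
    by apply: (@leq_trans (1 * 2 ^ 3)%N) => //; rewrite leq_mul// leq_pexp2l//; lia.
  by rewrite -{1}(expn1 (a * _)) leq_pexp2l// muln_gt0 a0 expn_gt0.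
- by move=> k x; apply: code_card => c; rewrite inE => /asboolP[l [lc _]]; exists l.
- by rewrite !exprMn sq22; nra.
move=> k; have l2 : 0 < ln 2 :> R by rewrite ln_gt0// ltr1n.
have -> : bound k = (2 ^ (((k + p + 5) * d + (k + 9)) * N))%N.
  by rewrite /bound -expnM -expnD -expnM.
rewrite natrX lnXn ?ltr0n// -[leLHS]mulr_natr mul1r.
have -> : N%:R * d.+1%:R * ln 2 * (9 + p%:R + k%:R) =
  ln 2 * (d.+1%:R * (9 + p%:R + k%:R) * N%:R) :> R by ring.
rewrite ler_wpM2l ?(ltW l2)// natrM ler_wpM2r//.
rewrite -(natr1 d) natrD natrM !(natrD _ k) (natrD _ (k + p)) natrD.
have := mulr_ge0 (ltW d0) (ler0n R k); move: d0 => d1; nra.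
Qed.

End softmin_class.

(** * Stability of the divergences *)

(** Valid for arbitrary functions: nonnegative integrals are suprema over the simple functions below
    the integrand. *)
Lemma le_integral_ge0 d (T : measurableType d) (R : realType)
    (m : {measure set T -> \bar R}) (f g : T -> \bar R) :
  (forall x, 0 <= f x <= g x)%E -> (\int[m]_x f x <= \int[m]_x g x)%E.
Proof.
move=> fg; have f0 x : (0 <= f x)%E by case/andP: (fg x).
have g0 x : (0 <= g x)%E by case/andP: (fg x) => h1 /(le_trans h1).
rewrite !ge0_integralTE//; apply: le_ereal_sup => _ [h /= hf <-]; exists h => //.
by move=> x; apply: le_trans (hf x) _; case/andP: (fg x).
Qed.

Lemma Rintegral_eq_on d (T : measurableType d) (R : realType) (m : probability T R)
    (K : set T) (f g : T -> R) : measurable K -> m K = 1%E ->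
  bounded_measurable f -> bounded_measurable g ->
  (forall x, K x -> f x = g x) -> \int[m]_x f x = \int[m]_x g x.
Proof.
move=> mK mK1 bf bg fg; apply: EFin_inj; rewrite -!bmf_integralE//.
apply: ae_eq_integral => //; [by apply/measurable_EFinP; case: bf|
  by apply/measurable_EFinP; case: bg|].
exists (~` K); split; first exact: measurableC.
  by apply: etrans (probability_setC m mK) _; rewrite mK1 subee.
by move=> x /= nfg xK; apply: nfg => _; rewrite fg.
Qed.

Import HBSimple HBNNSimple.

(* No measurability is assumed: the slices [theta |-> Wpp_real p _ _] are only
   compared pointwise. *)
Lemma integral_le_cst d (T : measurableType d) (R : realType)
    (m : probability T R) (D : set T) (f g : T -> \bar R) (S : R) :
  measurable D -> m D = 1%E ->
  (forall x, D x -> 0 <= f x)%E -> (forall x, D x -> 0 <= g x)%E ->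
  (forall x, D x -> f x <= g x + S%:E)%E ->
  (\int[m]_(x in D) f x <= \int[m]_(x in D) g x + S%:E)%E.
Proof.
move=> mD mD1 f0 g0 fg.
have res0 (h : T -> \bar R) : (forall x, D x -> 0 <= h x)%E -> (forall x, 0 <= (h \_ D) x)%E.
  by move=> h0 x; rewrite patchE; case: ifPn => // /set_mem; exact: h0.
rewrite integral_mkcond [X in (_ <= X + _)%E]integral_mkcond.
rewrite ge0_integralTE; last exact: res0.
apply: ge_ereal_sup => _ [h /= hf <-].
pose k x : R := h x.
have bk : bounded_measurable k.
  split; first exact: measurable_funTS.
  have [C [_ hC]] := simple_bounded h; exists (C + 1) => x; apply: hC => //.
  by rewrite ltrDl.
(* If [h] is a simple function below [f], then [h - S], clipped at 0 and cut to [D], is measurable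
   and lies below [g]. *)
pose q x : R := \1_D x * Num.max (k x - S) 0.
have bq : bounded_measurable q.
  apply: bmf_mul; first exact: bmf_indic.
  by apply: bmf_max; [apply: bmf_sub => //; exact: bmf_cst|exact: bmf_cst].
apply: (@le_trans _ _ (\int[m]_x (q x)%:E + S%:E)%E); last first.
  rewrite leeD2r//; apply: le_integral_ge0 => x; apply/andP; split.
    by rewrite lee_fin mulr_ge0// le_max lexx orbT.
  rewrite patchE /q indicE; case: ifPn => xD; last by rewrite mul0r.
  rewrite mul1r; move/set_mem in xD; have := hf x; rewrite patchE mem_set// => hfx.
  have [_|_] := leP (k x - S) 0; first exact: g0.
  by rewrite EFinB leeBlDr//; exact: le_trans hfx (fg _ xD).
have -> : sintegral m h = (\int[m]_x (k x)%:E)%E by rewrite integralT_nnsfun.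
rewrite !bmf_integralE// -EFinD lee_fin.
have -> : S = \int[m]_x (S * \1_D x).
  rewrite bmf_intZ; last exact: bmf_indic.
  rewrite (Rintegral_eq_on (g := fun=> 1) mD mD1) ?bmf_int_cst ?mulr1//.
  - exact: bmf_indic.
  - exact: bmf_cst.
  - by move=> x xD; rewrite indicE mem_set.
rewrite -bmf_intD//; last by apply: bmf_scale; exact: bmf_indic.
apply: bmf_le => //.
  by apply: bmf_add => //; apply: bmf_scale; exact: bmf_indic.
move=> x; rewrite /q indicE; have [xD|xD] := boolP (x \in D).
  by rewrite mul1r mulr1 -lerBlDr le_max lexx.
by rewrite mul0r mulr0 addr0; have := hf x; rewrite patchE (negbTE xD) lee_fin.
Qed.

Lemma bmf_min_class d (T : measurableType d) (R : realType) (N : nat) (Lam : Type)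
    (g : Lam -> T -> R) (l : min_param N Lam) : (forall v, bounded_measurable (g v)) ->
  bounded_measurable (min_class g l).
Proof.
move=> bg; rewrite /min_class; elim: (index_enum _) => [|i s IH].
  by under eq_fun do rewrite big_nil; exact: bmf_cst.
under eq_fun do rewrite big_cons; apply: bmf_min => //.
by apply: bmf_sub => //; exact: bmf_cst.
Qed.

Lemma bmf_ball_class (R : realType) (d N p : nat) (r : R) : 0 < r ->
  forall l : min_param N {y : 'rV[R]_d | enorm y <= r},
  bounded_measurable (min_class (ball_cost p (r:=r)) l).
Proof.
move=> r0 l; apply: bmf_min_class => y; split; first exact: measurable_ball_cost.
by exists 1 => x; have /andP[h1 h2] := ball_cost_itv p r0 y x; rewrite ger0_norm.
Qed.

Lemma bmf_slice_class (R : realType) (d N p : nat) (r : R) : 0 < r ->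
  forall l : min_param N (@slice_param R d r),
  bounded_measurable (min_class (slice_cost p (r:=r)) l).
Proof.
move=> r0 l; apply: bmf_min_class => v; split; first exact: measurable_slice_cost.
by exists 1 => x; have /andP[h1 h2] := slice_cost_itv p r0 v x; rewrite ger0_norm.
Qed.

Lemma measurable_esphere (R : realType) (d : nat) :
  measurable (esphere : set (euclidean R d)).
Proof.
have me := measurable_dist (0 : 'rV[R]_d).
rewrite (_ : esphere = (fun x : euclidean R d => enorm ((x : 'rV[R]_d) - 0)) @^-1` [set 1]).
  by rewrite -[X in measurable X]setTI; apply: me => //; exact: measurable_set1.
by apply/seteqP; split => x /=; rewrite subr0.
Qed.

Section localization.
Context {R : realType} {d : measure_display} {T : measurableType d}.
Variables (K : set T) (c : T * T -> R).
Hypotheses (mK : measurable K) (mc : measurable_fun setT c).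

(** Duality is stated for costs bounded on the whole space. Couplings of measures carried by [K] do
    not charge the complement of its square, so cutting there changes no integral. *)
Definition cut (z : T * T) : R := \1_(K `*` K) z * c z.

Lemma measurable_cut : measurable_fun setT cut.
Proof.
by apply: measurable_funM => //; apply: measurable_indic; exact: measurableX.
Qed.

Lemma integral_cut (mu nu : probability T R) (g : probability (T * T)%type R) :
  mu K = 1%E -> nu K = 1%E -> coupling mu nu g ->
  (\int[g]_z (cut z)%:E = \int[g]_z (c z)%:E)%E.
Proof.
move=> muK nuK [gmu gnu]; apply: ae_eq_integral => //.
- by apply/measurable_EFinP; exact: measurable_cut.
- exact/measurable_EFinP.
have null (P : probability T R) : P K = 1%E -> P (~` K) = 0.
  by move=> PK; rewrite probability_setC// PK subee.
exists ((~` K) `*` setT `|` setT `*` (~` K)); split.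
- by apply: measurableU; apply: measurableX => //; exact: measurableC.
- apply: null_set_setU.
  + by apply: measurableX => //; exact: measurableC.
  + by apply: measurableX => //; exact: measurableC.
  + by apply: etrans (gmu _ _) (null _ muK); exact: measurableC.
  + by apply: etrans (gnu _ _) (null _ nuK); exact: measurableC.
move=> [x y] /= xy; apply: contrapT => nxy; apply: xy => _.
rewrite /cut indicE mem_set ?mul1r//; split => /=.
  by apply: contrapT => nK; apply: nxy; left.
by apply: contrapT => nK; apply: nxy; right.
Qed.

Lemma transport_cost_cut (mu nu : probability T R) :
  mu K = 1%E -> nu K = 1%E ->
  transport_cost cut mu nu = transport_cost c mu nu.
Proof.
move=> muK nuK; congr ereal_inf; apply: eq_imagel => g cg.
exact: integral_cut cg.
Qed.

Lemma entropic_cost_cut (eps : R) (mu nu : probability T R) :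
  mu K = 1%E -> nu K = 1%E ->
  entropic_cost cut eps mu nu = entropic_cost c eps mu nu.
Proof.
move=> muK nuK; congr ereal_inf; apply: eq_imagel => g cg.
by rewrite (integral_cut muK nuK cg).
Qed.

Context {N : nat} (mu mu' nu : probability T R) (w : 'I_N -> R) (z : 'I_N -> T).
Hypotheses (w0 : forall i, 0 <= w i) (w1 : \sum_i w i = 1).
Hypothesis nuE : forall B, measurable B ->
  nu B = (\sum_i (w i)%:E * \d_(z i) B)%E.
Hypothesis zK : forall i, K (z i).
Variables (M S : R).
Hypotheses (c0 : forall x, 0 <= c x) (cM : forall x y, K x -> K y -> c (x, y) <= M).
Hypotheses (M0 : 0 <= M) (muK : mu K = 1%E) (muK' : mu' K = 1%E).

Let nuK : nu K = 1%E.
Proof.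
rewrite nuE//; under eq_bigr => i _ do rewrite diracE mem_set// mule1.
by rewrite sumEFin w1.
Qed.

Lemma cut_itv x : 0 <= cut x <= M.
Proof.
case: x => x y; rewrite /cut indicE; have [|_] := boolP ((x, y) \in _).
  by rewrite inE => -[xK yK]; rewrite mul1r c0 cM.
by rewrite mul0r lexx.
Qed.

Lemma cut_discrete x i : cut (x, z i) = \1_K x * c (x, z i).
Proof.
rewrite /cut !indicE; congr (_%:R * _); congr (nat_of_bool _).
apply/idP/idP => [/set_mem[h _]|/set_mem h]; apply/mem_set => //.
exact: (conj h (zK i)).
Qed.

Lemma transport_cost_stable_on : (forall x : T, measurable [set x]) ->
  (forall j psi i0, psi i0 = 0 -> (forall i, - M <= psi i <= 0) ->
    \int[mu]_x min_fun z cut M j psi x - \int[mu']_x min_fun z cut M j psi x <= S) ->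
  (transport_cost c mu nu <= transport_cost c mu' nu + S%:E)%E.
Proof.
move=> m1 HS; rewrite -(transport_cost_cut muK nuK) -(transport_cost_cut muK' nuK).
exact: (@transport_cost_stable R d T N mu mu' nu w z w0 w1 nuE cut M S
  measurable_cut cut_itv m1 HS).
Qed.

Lemma entropic_cost_stable_on (eps : R) : 0 < eps ->
  (forall v : 'I_N -> R, (forall i, 0 <= v i) -> \sum_i v i = 1 ->
    \int[mu]_x softmin_fun z cut eps v x - \int[mu']_x softmin_fun z cut eps v x <= S) ->
  (entropic_cost c eps mu nu <= entropic_cost c eps mu' nu + S%:E)%E.
Proof.
move=> e0 HS; rewrite -(entropic_cost_cut eps muK nuK) -(entropic_cost_cut eps muK' nuK).
exact: (@entropic_cost_stable R d T N mu mu' nu w z w0 w1 nuE cut M S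
  measurable_cut cut_itv eps e0 HS).
Qed.

End localization.

Section divergence_stability.
Context {R : realType} {d N p : nat} (r : R) (a : 'M[R]_(N, d) * 'rV[R]_N).
Hypotheses (r0 : 0 < r) (aP : parameter_set r a).
Variables (mu mu' : probability (euclidean R d) R) (S : R).
Hypotheses (muK : mu (eball r) = 1%E) (muK' : mu' (eball r) = 1%E).

Let K : set (euclidean R d) := eball r.

Let w0 i : 0 <= a.2 0 i. Proof. by case: aP => _ [/(_ i)/andP[]]. Qed.

Let w1 : \sum_i a.2 0 i = 1. Proof. by case: aP => _ []. Qed.

Let aE B : measurable B ->
  atoms a B = (\sum_i (a.2 0 i)%:E * \d_(row i a.1 : euclidean R d) B)%E.
Proof.
by move=> _; rewrite /atoms /= /discrete_measure mem_set//; case: aP.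
Qed.

Let rowP i : enorm (row i a.1) <= r. Proof. by case: aP => /(_ i). Qed.

Let r2 : 0 < 2 * r. Proof. by rewrite mulr_gt0. Qed.

Let M : R := (2 * r) ^+ p.

Let M0 : 0 < M. Proof. by rewrite exprn_gt0. Qed.

Lemma measurable_point (x : euclidean R d) : measurable [set x].
Proof.
have := measurable_fun_ler (measurable_dist x) (@measurable_cst _ _ _ _ setT (0 : R)).
move=> /(_ measurableT [set true] I); rewrite setTI.
congr (measurable _); apply/seteqP; split => y /= h.
  apply/eqP; rewrite -subr_eq0; apply/eqP/enorm_eq0/eqP.
  by rewrite eq_le h enorm_ge0.
have -> : y = x by [].
by rewrite subrr enormE /dot big1 ?sqrtr0 ?lexx// => i _; rewrite mxE mul0r.
Qed.

Let cost (z : euclidean R d * euclidean R d) : R :=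
  enorm ((z.1 : 'rV[R]_d) - (z.2 : 'rV[R]_d)) ^+ p.

Let measurable_cost : measurable_fun setT cost.
Proof.
apply: measurable_funX; rewrite /enorm.
apply: (@measurableT_comp _ _ _ _ _ _ (@Num.sqrt R)).
  by apply: continuous_measurable_fun; exact: sqrt_continuous.
apply: measurable_sum => i; apply: measurable_funX.
under eq_fun do rewrite !mxE.
by apply: measurable_funB; apply: (measurableT_comp (measurable_coord i)).
Qed.

Let cost_ge0 x : 0 <= cost x. Proof. by rewrite exprn_ge0// enorm_ge0. Qed.

Let costM x y : eball r x -> eball r y -> cost (x, y) <= M.
Proof.
move=> xr yr; rewrite lerXn2r ?nnegrE ?enorm_ge0 ?(ltW r2)//=.
rewrite /eball/= in xr yr; apply: le_trans (enormD _ _) _.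
by rewrite -[- _]scaleN1r enormZ normrN1 mul1r; lra.
Qed.

Let cutE (i : 'I_N) (x : euclidean R d) : cut K cost (x, row i a.1) =
  M * ball_cost p (exist _ (row i a.1) (rowP i)) x.
Proof.
rewrite (@cut_discrete R _ _ K cost N (fun i => row i a.1) rowP) /ball_cost /=.
rewrite [RHS]mulrCA /M -exprMn; congr (_ * _ ^+ _).
by rewrite mulrC divfK// gt_eqF.
Qed.

Lemma min_class_ball_scale (j : 'I_N -> 'I_N) (psi : 'I_N -> R) i0 :
  psi i0 = 0 -> (forall i, - M <= psi i <= 0) ->
  exists l : min_param N {y : 'rV[R]_d | enorm y <= r},
  forall x, min_fun (fun i => row i a.1 : euclidean R d) (cut K cost) M j psi x =
    M * min_class (ball_cost p (r:=r)) l x.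
Proof.
move=> p0 pM.
have b i : -1 <= psi i / M <= 0.
  by have /andP[h1 h2] := pM i; rewrite ler_pdivlMr// mulN1r h1 ler_pdivrMr// mul0r.
have t : exists i, psi i / M = 0 by exists i0; rewrite p0 mul0r.
exists (MinParam (fun i => exist _ (row (j i) a.1) (rowP (j i))) b t) => x.
rewrite /min_fun /min_class /=; elim/big_rec2: _ => [|i y1 y2 _ ->]; first by rewrite mulr1.
by rewrite cutE minr_pMr ?(ltW M0)// mulrBr [M * (_ / _)]mulrCA mulfV ?gt_eqF// mulr1.
Qed.

Lemma Wpp_stable :
  (forall l : min_param N {y : 'rV[R]_d | enorm y <= r},
    M * (\int[mu]_x min_class (ball_cost p (r:=r)) l x -
         \int[mu']_x min_class (ball_cost p (r:=r)) l x) <= S) ->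
  (Wpp p mu (atoms a) <= Wpp p mu' (atoms a) + S%:E)%E.
Proof.
move=> HS; apply: (@transport_cost_stable_on R _ (euclidean R d) K cost
  (measurable_eball r) measurable_cost N mu mu' (atoms a) (fun i => a.2 0 i)
  (fun i => row i a.1 : euclidean R d) w0 w1 aE rowP M S cost_ge0 costM (ltW M0) muK muK').
  exact: measurable_point.
move=> j psi i0 p0 pM; have [l lE] := min_class_ball_scale j p0 pM.
apply: le_trans (HS l); rewrite mulrBr.
have bm := bmf_ball_class p r0 l.
by rewrite -!bmf_intZ//; apply/le_of_eq; congr (_ - _);
  apply: eq_Rintegral => x _; exact: lE.
Qed.

(** Rescaling the cost by [M] changes the temperature to [eps / M]; this is why the softmin class
    has to be bounded uniformly in its temperature. *)
Lemma Wepp_stable (eps : R) : 0 < eps ->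
  (forall l : weighted_points N r,
    M * (\int[mu]_x softmin_class p (eps / M) l x -
         \int[mu']_x softmin_class p (eps / M) l x) <= S) ->
  (Wepp p eps mu (atoms a) <= Wepp p eps mu' (atoms a) + S%:E)%E.
Proof.
move=> e0 HS; apply: (@entropic_cost_stable_on R _ (euclidean R d) K cost
  (measurable_eball r) measurable_cost N mu mu' (atoms a) (fun i => a.2 0 i)
  (fun i => row i a.1 : euclidean R d) w0 w1 aE rowP M S cost_ge0 costM (ltW M0) muK muK')
  => //.
move=> v v0 v1.
pose l := @WeightedPoints R d N r (fun i => exist _ (row i a.1) (rowP i)) v (conj v0 v1).
have lE x : softmin_fun (fun i => row i a.1 : euclidean R d) (cut K cost) eps v x =
    M * softmin_class p (eps / M) l x.
  rewrite /softmin_fun /softmin_class /softmin /gibbs /= !mulNr mulrN mulrA.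
  rewrite [M * (_ / _)]mulrCA mulfV ?gt_eqF// mulr1; congr (- (_ * ln _)).
  apply: eq_bigr => i _; rewrite cutE; congr (_ * expR (- _)).
  by rewrite invf_div [RHS]mulrA [_ * M]mulrC.
have bs : bounded_measurable (softmin_class p (eps / M) l).
  by apply: bmf_softmin_class => //; rewrite divr_gt0.
apply: le_trans (HS l); rewrite mulrBr -!bmf_intZ//.
by apply/le_of_eq; congr (_ - _);
  apply: eq_Rintegral => x _; exact: lE.
Qed.

Let Kr : set R := [set t | `|t| <= r].

Let measurable_Kr : measurable Kr.
Proof.
have := measurable_fun_ler (@normr_measurable R setT) (@measurable_cst _ _ _ _ setT r).
move=> /(_ measurableT [set true] I); rewrite setTI.
by congr (measurable _); apply/seteqP; split.
Qed.

Let cost1 (z : R * R) : R := `|z.1 - z.2| ^+ p.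

Let measurable_cost1 : measurable_fun setT cost1.
Proof.
apply: measurable_funX; apply: (@measurableT_comp _ _ _ _ _ _ (@Num.norm R R)) => //.
exact: measurable_funB.
Qed.

Let cost1_ge0 x : 0 <= cost1 x. Proof. by rewrite exprn_ge0. Qed.

Let cost1M x y : Kr x -> Kr y -> cost1 (x, y) <= M.
Proof.
move=> xr yr; rewrite lerXn2r ?nnegrE ?(ltW r2)//=.
rewrite /Kr/= in xr yr; apply: le_trans (ler_normB _ _) _; lra.
Qed.

Lemma proj_le (th x : 'rV[R]_d) : enorm th = 1 -> enorm x <= r -> `|Defs.proj th x| <= r.
Proof.
move=> th1 xr.
have tt : dot th th = 1 by rewrite -enorm_sqr th1 expr1n.
have xx : dot x x / r <= r.
  rewrite ler_pdivrMr// -enorm_sqr expr2.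
  by apply: ler_pM => //; exact: enorm_ge0.
have h s : `|s| = 1 -> s * dot th x <= r.
  move=> s1; have := dot_young (s *: th) x r0; rewrite !dotE tt mulr1.
  have -> : s * s = 1 by rewrite -expr2 -real_normK ?num_real// s1 expr1n.
  by move=> h; lra.
have := h 1; have := h (-1); rewrite normrN1 normr1 => /(_ erefl) h1 /(_ erefl) h2.
by rewrite ler_norml; apply/andP; split; rewrite /Defs.proj -/(dot th x); lra.
Qed.

Section slice.
Variable th : 'rV[R]_d.
Hypothesis th1 : enorm th = 1.

Let zs (i : 'I_N) : R := Defs.proj th (row i a.1).

Let zsK i : Kr (zs i). Proof. exact: proj_le. Qed.

Let thE B : measurable B ->
  distribution (atoms a) (Defs.proj th) B = (\sum_i (a.2 0 i)%:E * \d_(zs i) B)%E.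
Proof.
move=> mB; apply: etrans (aE _) _.
  by rewrite -[X in measurable X]setTI; apply: Defs.measurable_proj.
apply: eq_bigr => i _; rewrite !diracE; congr (_ * (_ _)%:R%:E)%E.
Qed.

Let slice_dist (m : probability (euclidean R d) R) : m K = 1%E ->
  distribution m (Defs.proj th) Kr = 1%E.
Proof.
move=> mK; apply/eqP; rewrite eq_le probability_le1//=.
rewrite -mK; apply: le_measure; rewrite ?inE.
- exact: measurable_eball.
- by rewrite -[X in measurable X]setTI; apply: Defs.measurable_proj.
- by move=> x xr; exact: proj_le.
Qed.

Let slice_cutE i x (v := exist _ (th, zs i) (conj th1 (zsK i)) : @slice_param R d r) :
  eball r x -> cut Kr cost1 (Defs.proj th x, zs i) = M * slice_cost p v x.
Proof.
move=> xr; rewrite (@cut_discrete R _ _ Kr cost1 N zs zsK) /slice_cost /=.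
rewrite !indicE !mem_set//; last exact: proj_le.
by rewrite !mul1r /M -exprMn mulrC divfK// gt_eqF.
Qed.

(** Equality is restricted to [K]: the class is cut off in the space and the transport problem on
    the line, and a point outside the ball may project into [Kr]. *)
Lemma min_class_slice_scale (j : 'I_N -> 'I_N) (psi : 'I_N -> R) i0 :
  psi i0 = 0 -> (forall i, - M <= psi i <= 0) ->
  exists l : min_param N (@slice_param R d r),
  forall x : euclidean R d, K x -> min_fun zs (cut Kr cost1) M j psi (Defs.proj th x) =
    M * min_class (slice_cost p (r:=r)) l x.
Proof.
move=> p0 pM.
have b i : -1 <= psi i / M <= 0.
  by have /andP[h1 h2] := pM i; rewrite ler_pdivlMr// mulN1r h1 ler_pdivrMr// mul0r.
have t : exists i, psi i / M = 0 by exists i0; rewrite p0 mul0r.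
exists (MinParam (fun i => exist _ (th, zs (j i)) (conj th1 (zsK (j i)))) b t) => x xr.
rewrite /min_fun /min_class /=; elim/big_rec2: _ => [|i y1 y2 _ ->]; first by rewrite mulr1.
by rewrite slice_cutE// minr_pMr ?(ltW M0)// mulrBr [M * (_ / _)]mulrCA mulfV ?gt_eqF// mulr1.
Qed.

Let integral_slice (m : probability (euclidean R d) R) f g : m K = 1%E ->
  bounded_measurable f -> bounded_measurable g ->
  (forall x : euclidean R d, K x -> f (Defs.proj th x) = M * g x) ->
  \int[distribution m (Defs.proj th)]_t f t = M * \int[m]_x g x.
Proof.
move=> mK bf bg fg; rewrite -bmf_intZ//.
(* The change of variables along [th] is the formula for the mean of a function of a sample of size
   1. *)
pose Z (_ : 'I_1) : {RV m >-> R} := Defs.proj th.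
rewrite -(@Rintegral_sample R _ _ _ _ m (distribution m (Defs.proj th)) 1 Z _ f ord0)//.
apply: (Rintegral_eq_on (measurable_eball r) mK) => //.
- exact: (bmf_comp (Defs.measurable_proj th) bf).
- exact: bmf_scale.
Qed.

Lemma slice_stable :
  (forall l : min_param N (@slice_param R d r),
    M * (\int[mu]_x min_class (slice_cost p (r:=r)) l x -
         \int[mu']_x min_class (slice_cost p (r:=r)) l x) <= S) ->
  (Wpp_real p (distribution mu (Defs.proj th)) (distribution (atoms a) (Defs.proj th)) <=
   Wpp_real p (distribution mu' (Defs.proj th)) (distribution (atoms a) (Defs.proj th))
    + S%:E)%E.
Proof.
move=> HS; apply: (@transport_cost_stable_on R _ R Kr cost1 measurable_Kr
  measurable_cost1 N _ _ _ (fun i => a.2 0 i) zs w0 w1 thE zsK M S cost1_ge0 cost1M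
  (ltW M0) (slice_dist muK) (slice_dist muK')) => //.
move=> j psi i0 p0 pM; have [l lE] := min_class_slice_scale j p0 pM.
apply: le_trans (HS l); rewrite mulrBr.
have bm := bmf_min_fun zs (measurable_cut measurable_Kr measurable_cost1)
  (@cut_itv R _ _ Kr cost1 M cost1_ge0 cost1M (ltW M0)) j psi.
rewrite (integral_slice muK bm (bmf_slice_class p r0 l) lE).
by rewrite (integral_slice muK' bm (bmf_slice_class p r0 l) lE).
Qed.

End slice.

Hypothesis slice_S : forall l : min_param N (@slice_param R d r),
  M * (\int[mu]_x min_class (slice_cost p (r:=r)) l x -
       \int[mu']_x min_class (slice_cost p (r:=r)) l x) <= S.

Lemma max_SWpp_stable :
  (max_SWpp p mu (atoms a) <= max_SWpp p mu' (atoms a) + S%:E)%E.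
Proof.
apply: ge_ereal_sup => _ [th th1 <-].
apply: le_trans (slice_stable th1 slice_S) _; rewrite leeD2r//.
by apply: ereal_sup_ubound; exists th.
Qed.

Lemma SWpp_stable (sigma : probability (euclidean R d) R) : sigma esphere = 1%E ->
  (SWpp sigma p mu (atoms a) <= SWpp sigma p mu' (atoms a) + S%:E)%E.
Proof.
move=> s1; apply: integral_le_cst => //.
- exact: measurable_esphere.
- move=> th _; apply: le_ereal_inf_tmp => _ [g _ <-]; apply: integral_ge0 => z _.
  by rewrite lee_fin cost1_ge0.
- move=> th _; apply: le_ereal_inf_tmp => _ [g _ <-]; apply: integral_ge0 => z _.
  by rewrite lee_fin cost1_ge0.
by move=> th th1; exact: slice_stable.
Qed.

End divergence_stability.

(** * Lower bound of the entropy integral *)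

Section log_integral.
Context {R : realType}.
Variables (b K : R).
Hypotheses (b0 : 0 < b) (K0 : 0 <= K).

Let f (t : R) : R := Num.sqrt (ln (2 + K / t)).

Let level (k : nat) : set R := [set` `]0, b / (2 ^ k.+1)%:R]].

Let level_gt0 k : 0 < b / (2 ^ k.+1)%:R.
Proof. by rewrite divr_gt0// ltr0n expn_gt0. Qed.

Let measure_itv (c : R) : 0 < c -> lebesgue_measure (`]0, c]%classic : set R) = c%:E.
Proof.
by move=> c0; rewrite lebesgue_measure_itv/= lte_fin c0 sube0.
Qed.

(* Dyadic layers show that the integrand has at most a logarithmic
   singularity at 0. *)
Let f_le t : 0 < t <= b ->
  ((f t)%:E <= (2 + ln (2 + K / b))%:E + \sum_(k <oo) (\1_(level k) t : R)%:E)%E.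
Proof.
move=> /andP[t0 tb].
have ex : exists m, b / (2 ^ m.+1)%:R < t.
  exists (Num.truncn (b / t)).
  have h : b / t < (Num.truncn (b / t)).+1%:R by exact: truncnS_gt.
  have h2 : (Num.truncn (b / t)).+1%:R <= (2 ^ (Num.truncn (b / t)).+1)%:R :> R.
    by rewrite ler_nat ltnW// ltn_expl.
  rewrite ltr_pdivrMr ?ltr0n ?expn_gt0// mulrC -ltr_pdivrMr//.
  exact: lt_le_trans h2.
case: (ex_minnP ex) => m bm mmin.
have layers k : (k < m)%N -> \1_(level k) t = 1 :> R.
  move=> km; rewrite indicE mem_set// /level/= in_itv/= t0/= leNgt.
  by apply/negP => /mmin; rewrite leqNgt km.
have sm : ((m%:R : R)%:E <= \sum_(k <oo) (\1_(level k) t : R)%:E)%E.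
  have u0 n : (0 <= n)%N -> true -> (0 <= (\1_(level n) t)%:E :> \bar R)%E.
    by move=> _ _; rewrite lee_fin indicE.
  have := @nneseries_lim_ge R (fun k => (\1_(level k) t : R)%:E) xpredT 0 m u0.
  move=> hs; apply: (le_trans _ hs).
  rewrite big_mkord sumEFin lee_fin (eq_bigr (fun=> 1)); last by move=> i _; exact: layers.
  by rewrite sumr_const card_ord.
apply: le_trans (leeD2l _ sm); rewrite -EFinD lee_fin.
have Kt : 0 <= K / t by rewrite divr_ge0// ltW.
have Kb : 0 <= K / b by rewrite divr_ge0// ltW.
have l0 : 0 <= ln (2 + K / t) by rewrite ln_ge0//; lra.
have f1 : f t <= 1 + ln (2 + K / t).
  rewrite -[leRHS]ger0_norm ?addr_ge0// -sqrtr_sqr ler_wsqrtr//.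
  by rewrite sqrrD expr1n mul1r mulr2n; have := sqr_ge0 (ln (2 + K / t)); lra.
apply: le_trans f1 _.
have p2 : (1 : R) <= (2 ^ m.+1)%:R by rewrite ler1n expn_gt0.
have : ln (2 + K / t) <= ln ((2 ^ m.+1)%:R * (2 + K / b)).
  have q0 : 0 < 2 + K / b by lra.
  have q1 : 0 < 2 + K / t by lra.
  rewrite ler_ln ?posrE ?mulr_gt0// ?ltr0n ?expn_gt0//.
  have : K / t <= (2 ^ m.+1)%:R * (K / b).
    rewrite mulrCA ler_wpM2l// -(ler_pM2l t0) mulfV ?gt_eqF// mulrA ler_pdivlMr// mul1r.
    by move: bm; rewrite ltr_pdivrMr ?ltr0n ?expn_gt0// => /ltW.
  by rewrite mulrDr; move: p2; set u := (2 ^ _)%:R; lra.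
rewrite lnM ?posrE ?ltr0n ?expn_gt0//; last lra.
rewrite natrX lnXn// -[ln 2 *+ _]mulr_natr.
have l2 : ln 2 <= 1 :> R by have := @le_ln1Dx R 1; apply; lra.
have := ler_wpM2r (ler0n R m.+1) l2; rewrite mul1r -(natr1 m); lra.
Qed.

(** The integrand is at least [sqrt (ln 2)]. Since a real-valued integral defaults to 0 when the
    extended one is infinite, finiteness has to be proved as well. *)
Lemma log_integral_ge : b * Num.sqrt (ln 2) <= log_integral b K.
Proof.
pose D : set R := `]0, b]%classic.
have mD : measurable D by exact: measurable_itv.
have C0 : 0 <= 2 + ln (2 + K / b).
  have Kb : 0 <= K / b by rewrite divr_ge0// ltW.
  by rewrite addr_ge0// ln_ge0//; lra.
have low : ((b * Num.sqrt (ln 2))%:E <= \int[lebesgue_measure]_(t in D) (f t)%:E)%E.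
  have -> : (b * Num.sqrt (ln 2))%:E =
      (\int[@lebesgue_measure R]_(t in D) (cst (Num.sqrt (ln 2))%:E) t)%E.
    by rewrite integral_cst// [X in (_ * X)%E](measure_itv b0) -EFinM mulrC.
  rewrite integral_mkcond [leRHS]integral_mkcond; apply: le_integral_ge0 => t.
  rewrite !patchE; case: ifPn => [/set_mem|_]; last by rewrite lexx.
  rewrite /D /= in_itv/= => /andP[t0 _]; rewrite lee_fin sqrtr_ge0/= lee_fin.
  rewrite ler_wsqrtr// ler_ln ?posrE ?ltr_wpDr ?lerDl ?divr_ge0 ?(ltW t0)//.
have up : (\int[lebesgue_measure]_(t in D) (f t)%:E < +oo)%E.
  apply: (@le_lt_trans _ _ (\int[lebesgue_measure]_(t in D)
    ((2 + ln (2 + K / b))%:E + \sum_(k <oo) (\1_(level k) t : R)%:E))%E).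
    rewrite integral_mkcond [leRHS]integral_mkcond; apply: le_integral_ge0 => t.
    rewrite !patchE; case: ifPn => [/set_mem|_]; last by rewrite lexx.
    rewrite /D /= in_itv/= => tD; rewrite lee_fin sqrtr_ge0/=; exact: f_le.
  have mlev k : measurable (level k) by exact: measurable_itv.
  have me k : measurable_fun D (fun t => (\1_(level k) t : R)%:E).
    apply/measurable_EFinP; apply: measurable_funTS; apply: measurable_indic.
    exact: mlev.
  rewrite ge0_integralD//.
  - rewrite integral_cst// [X in (_ * X)%E](measure_itv b0) integral_nneseries//.
    + rewrite (eq_eseriesr (g := fun k => (b / (2 ^ (k + 1))%:R)%:E)); last first.
        move=> k _; rewrite integral_indic; [|exact: mD|exact: mlev].
        rewrite setIidl; first by rewrite addn1; exact: measure_itv.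
        move=> t; rewrite /level /D /= !in_itv/= => /andP[-> /le_trans]; apply.
        by rewrite ler_pdivrMr ?ltr0n ?expn_gt0// ler_peMr ?(ltW b0)// ler1n expn_gt0.
      have := @cvg_geometric_eseries_half R b 0; move/cvg_lim => ->//.
      by rewrite -EFinM -EFinD ltry.
  - by move=> t _; apply: nneseries_ge0 => k _ _; rewrite lee_fin.
  - by apply: ge0_emeasurable_sum => [k t _ _|k _]; [rewrite lee_fin|exact: me].
rewrite /log_integral /Rintegral -lee_fin fineK// ge0_fin_numE//.
by apply: integral_ge0 => t _; rewrite lee_fin sqrtr_ge0.
Qed.

End log_integral.

(** * Excess risk *)

Section sample_gap.
Context {R : realType} {dO : measure_display} {Omega : measurableType dO} {d : nat}
  (P : probability Omega R) (mu : probability (euclidean R d) R).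
Context {n : nat} (X : 'I_n -> {RV P >-> euclidean R d}).
Hypothesis n_gt0 : (0 < n)%N.

Let n0 : 0 < n%:R :> R. Proof. by rewrite ltr0n. Qed.

Let uniform_weights : (const_mx n%:R^-1 : 'rV[R]_n) \in simplex.
Proof.
rewrite inE; split=> [i|]; first by rewrite mxE invr_ge0 ltW//= invf_le1// ler1n.
under eq_bigr do rewrite mxE.
by rewrite sumr_const card_ord -[_ *+ n]mulr_natr mulVf// gt_eqF.
Qed.

Lemma empiricalE (x : 'I_n -> euclidean R d) B : measurable B ->
  empirical x B = (\sum_i (n%:R^-1)%:E * \d_(x i) B)%E.
Proof.
move=> _; rewrite /empirical /= /discrete_measure uniform_weights.
by apply: eq_bigr => i _; rewrite mxE.
Qed.

Lemma empirical_eball (r : R) (x : 'I_n -> euclidean R d) :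
  (forall i, eball r (x i)) -> empirical x (eball r) = 1%E.
Proof.
move=> xr; apply: etrans (empiricalE _ (measurable_eball r)) _.
under eq_bigr => i _ do rewrite diracE mem_set// mule1.
by rewrite sumEFin sumr_const card_ord -[_ *+ n]mulr_natr mulVf// gt_eqF.
Qed.

Lemma integral_empirical (f : euclidean R d -> R) w : bounded_measurable f ->
  \int[empirical (fun i => X i w)]_x f x - \int[mu]_x f x = deviation mu X f w.
Proof.
have v0 (i : 'I_n) : 0 <= n%:R^-1 :> R by rewrite invr_ge0 ltW.
have v1 : \sum_(i < n) n%:R^-1 = 1 :> R.
  by rewrite sumr_const card_ord -[_ *+ n]mulr_natr mulVf// gt_eqF.
move=> bf; have := Rintegral_discrete v0 (empiricalE (fun i => X i w)) v1 bf.
by rewrite -mulr_sumr => ->.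
Qed.

Lemma sample_gap (Lam : Type) (f : Lam -> euclidean R d -> R) (M b C e : R) :
  (forall l, bounded_measurable (f l)) -> deviation_bounded mu X f b ->
  0 < M -> M * b <= C -> 0 < e ->
  exists U V, [/\ mean_bounded P U (C + e), mean_bounded P V (C + e) &
    forall l w, let m := empirical (fun i => X i w) in
      M * (\int[mu]_x f l x - \int[m]_x f l x) <= U w /\
      M * (\int[m]_x f l x - \int[mu]_x f l x) <= V w].
Proof.
move=> bf db M0 MbC e0.
have eM : 0 < e / M by rewrite divr_gt0.
have H sg : `|sg| = 1 -> exists2 U, mean_bounded P U (C + e) &
    forall l w, M * (sg * deviation mu X (f l) w) <= U w.
  move=> sg1; have [U mU HU] := db sg (e / M) sg1 eM.
  have [bMU MU] := mean_bounded_scale (ltW M0) mU.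
  exists (fun w => M * U w); last by move=> l w; rewrite ler_wpM2l ?(ltW M0).
  split => //; apply: le_trans MU _; rewrite mulrDr mulrCA mulfV ?gt_eqF// mulr1.
  by rewrite lerD2r.
have [|U mU HU] := H (-1); first by rewrite normrN1.
have [|V mV HV] := H 1; first by rewrite normr1.
exists U, V; split => // l w /=; split; last first.
  by have := HV l w; rewrite mul1r integral_empirical.
by have := HU l w; rewrite mulN1r -integral_empirical// opprB.
Qed.

End sample_gap.

Section divergence_gap.
Context {R : realType} {dO : measure_display} {Omega : measurableType dO} {d : nat}
  (P : probability Omega R) (mu : probability (euclidean R d) R).
Context {n : nat} (X : 'I_n -> {RV P >-> euclidean R d}).
Hypothesis n_gt0 : (0 < n)%N.
Hypothesis Xlaw : forall i B, measurable B -> distribution P (X i) B = mu B.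
Hypothesis Xind : mutually_independent X.
Variables (N p : nat) (r : R).
Hypotheses (N_gt0 : (0 < N)%N) (d_gt0 : (0 < d)%N) (p_gt0 : (0 < p)%N) (r0 : 0 < r).
Hypothesis muK : mu (eball r) = 1%E.

Let M : R := (2 * r) ^+ p.

Let M0 : 0 < M. Proof. by rewrite exprn_gt0// mulr_gt0. Qed.

Let root : Num.sqrt (N%:R * d.+1%:R * ln 2 / n%:R) =
  Num.sqrt (ln 2) * Num.sqrt ((N * (d + 1))%:R / n%:R) :> R.
Proof.
by rewrite -sqrtrM ?ln_ge0 ?ler1n// addn1 natrM; congr Num.sqrt; ring.
Qed.

Let K0 : 0 <= r ^+ p /\ 0 <= M. Proof. by rewrite exprn_ge0 ltW. Qed.

Let sqrt32 : Num.sqrt 32 = 4 * Num.sqrt 2 :> R.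
Proof.
have -> : 32 = 4 ^+ 2 * 2 :> R by rewrite expr2; ring.
by rewrite sqrtrM ?exprn_ge0// sqrtr_sqr ger0_norm.
Qed.

(** [4 * sqrt 32 = 8 * sqrt 2 * 2], so the class bound matches the lower bound of [C_pR] with no
    slack. *)
Let transport_rate (D : divergence R d) (K : R) (m : nat) : 0 <= K ->
  C_pR D p r = 8 * Num.sqrt 2 * log_integral (2 * M) K ->
  C_dN D N = m -> (N * (d + 1) <= m)%N ->
  M * (4 * Num.sqrt 32 * Num.sqrt (N%:R * d.+1%:R * ln 2 / n%:R)) <=
  C_pR D p r * Num.sqrt ((C_dN D N)%:R / n%:R).
Proof.
move=> K_ge0 -> -> mN; rewrite root sqrt32.
have b0 : 0 < 2 * M by rewrite mulr_gt0.
have li := log_integral_ge b0 K_ge0.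
have s2 : 0 <= Num.sqrt 2 :> R := sqrtr_ge0 _.
have sl : 0 <= Num.sqrt (ln 2) :> R := sqrtr_ge0 _.
have ss : Num.sqrt ((N * (d + 1))%:R / n%:R) <= Num.sqrt (m%:R / n%:R) :> R.
  by rewrite ler_wsqrtr// ler_wpM2r ?invr_ge0// ler_nat.
have -> (q : R) : M * (4 * (4 * Num.sqrt 2) * (Num.sqrt (ln 2) * q)) =
  8 * Num.sqrt 2 * (2 * M * Num.sqrt (ln 2)) * q by ring.
apply: ler_pM => //; first by rewrite !mulr_ge0// ltW.
by rewrite ler_wpM2l// mulr_ge0.
Qed.

Let entropic_rate (eps : R) (eps0 : 0 < eps) (D := EntropicWasserstein d eps0) :
  M * (8 * Num.sqrt 2 * (4 * p%:R + 1) * Num.sqrt (N%:R * d.+1%:R * ln 2 / n%:R)) <=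
  C_pR D p r * Num.sqrt ((C_dN D N)%:R / n%:R).
Proof.
rewrite root /C_pR /C_dN -/M.
have b0 : 0 < (4 * p%:R + 1) * M by rewrite mulr_gt0// ltr_wpDl// mulr_ge0.
have K_ge0 : 0 <= 64 * p%:R * M by rewrite !mulr_ge0// ltW.
have li := log_integral_ge b0 K_ge0.
have -> (q : R) : M * (8 * Num.sqrt 2 * (4 * p%:R + 1) * (Num.sqrt (ln 2) * q)) =
  8 * Num.sqrt 2 * ((4 * p%:R + 1) * M * Num.sqrt (ln 2)) * q by ring.
by rewrite ler_wpM2r ?sqrtr_ge0// ler_wpM2l// mulr_ge0// sqrtr_ge0.
Qed.

(** [U] and [V] are chosen before the atoms: the minimizer depends on the sample, so the gaps must
    be uniform over the parameter set. *)
Lemma divergence_gap (D : divergence R d) (e : R) : 0 < e ->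
  let C := C_pR D p r * Num.sqrt ((C_dN D N)%:R / n%:R) in
  exists U V, [/\ mean_bounded P U (C + e), mean_bounded P V (C + e) &
    forall w (a : 'M[R]_(N, d) * 'rV[R]_N), (forall i, eball r (X i w)) ->
      parameter_set r a -> let m := empirical (fun i => X i w) in
      (div_pp D p mu (atoms a) <= div_pp D p m (atoms a) + (U w)%:E)%E /\
      (div_pp D p m (atoms a) <= div_pp D p mu (atoms a) + (V w)%:E)%E].
Proof.
move=> e0 C; have [rp Mp] := K0.
have dbs := slice_class_bounded n_gt0 Xlaw Xind (N := N) N_gt0 d_gt0 p_gt0 r0.
have dbb := ball_class_bounded n_gt0 Xlaw Xind (N := N) N_gt0 d_gt0 p_gt0 r0.
case: D @C => [|eps eps0|sigma sigmaP|] C.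
- have rate : M * (4 * Num.sqrt 32 * Num.sqrt (N%:R * d.+1%:R * ln 2 / n%:R)) <= C.
    by apply: (@transport_rate _ (32 * p%:R * r ^+ p)) => //; rewrite !mulr_ge0.
  have [U [V [mU mV UV]]] := sample_gap n_gt0 (bmf_ball_class p r0) dbb M0 rate e0.
  exists U, V; split => // w a Xr aP m; have mK := empirical_eball n_gt0 Xr.
  split; apply: (Wpp_stable r0 aP) => // l; by have [] := UV l w.
- have tau0 : 0 < eps / M by rewrite divr_gt0.
  have bs (l : @weighted_points R d N r) :
      bounded_measurable (softmin_class p (eps / M) l) by exact: bmf_softmin_class.
  have ds := softmin_class_bounded n_gt0 Xlaw Xind N_gt0 d_gt0 p_gt0 r0 tau0.
  have [U [V [mU mV UV]]] := sample_gap n_gt0 bs ds M0 (entropic_rate eps0) e0.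
  exists U, V; split => // w a Xr aP m; have mK := empirical_eball n_gt0 Xr.
  split; apply: (Wepp_stable r0 aP) => // l; by have [] := UV l w.
- have rate : M * (4 * Num.sqrt 32 * Num.sqrt (N%:R * d.+1%:R * ln 2 / n%:R)) <= C.
    apply: (@transport_rate _ (48 * p%:R * r ^+ p) (N * (d + 1) + d)) => //.
      by rewrite !mulr_ge0.
    exact: leq_addr.
  have [U [V [mU mV UV]]] := sample_gap n_gt0 (bmf_slice_class p r0) dbs M0 rate e0.
  exists U, V; split => // w a Xr aP m; have mK := empirical_eball n_gt0 Xr.
  have [s1 _] := sigmaP.
  split; apply: (SWpp_stable r0 aP) => // l; by have [] := UV l w.
have rate : M * (4 * Num.sqrt 32 * Num.sqrt (N%:R * d.+1%:R * ln 2 / n%:R)) <= C.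
  apply: (@transport_rate _ (48 * p%:R * r ^+ p) (N * (d + 1) + d)) => //.
    by rewrite !mulr_ge0.
  exact: leq_addr.
have [U [V [mU mV UV]]] := sample_gap n_gt0 (bmf_slice_class p r0) dbs M0 rate e0.
exists U, V; split => // w a Xr aP m; have mK := empirical_eball n_gt0 Xr.
split; apply: (max_SWpp_stable r0 aP) => // l; by have [] := UV l w.
Qed.

End divergence_gap.

(** Suited to an excess risk [f] of unknown measurability: the majorant is set to [+oo] off [A], so
    that it dominates the positive part of [f] everywhere. *)
Lemma integral_le_on d (T : measurableType d) (R : realType) (P : probability T R)
    (A : set T) (f : T -> \bar R) (g : T -> R) : measurable A -> P A = 1%E ->
  bounded_measurable g -> (forall x, A x -> (maxe (f x) 0 <= (g x)%:E)%E) ->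
  (\int[P]_x f x <= (\int[P]_x g x)%:E)%E.
Proof.
move=> mA PA bg fg; rewrite integralE.
apply: (@le_trans _ _ (\int[P]_x (f^\+%E x))%E).
  rewrite -[leRHS]sube0 leeB//; apply: integral_ge0 => x _; exact: funeneg_ge0.
pose G x : \bar R := if `[< A x >] then (g x)%:E else +oo%E.
apply: (@le_trans _ _ (\int[P]_x G x)%E).
  apply: le_integral_ge0 => x; rewrite funepos_ge0/= funeposE /G.
  by case: asboolP => [/fg//|_]; rewrite leey.
rewrite -bmf_integralE//; apply/le_of_eq.
apply: ae_eq_integral => //.
- apply: measurable_fun_ifT => //; last by apply/measurable_EFinP; case: bg.
  apply: (measurable_fun_bool true); rewrite setTI (_ : _ @^-1` _ = A)//.
  by apply/seteqP; split => x /= h; exact/asboolP.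
- by apply/measurable_EFinP; case: bg.
exists (~` A); split; first exact: measurableC.
  by apply: etrans (probability_setC P mA) _; rewrite PA subee.
by move=> x /= nG Ax; apply: nG => _; rewrite /G asboolT.
Qed.

Lemma average_le (R : realType) (L : nat) (x y : 'I_L -> \bar R) (u : 'I_L -> R) :
  (forall l, x l <= y l + (u l)%:E)%E ->
  ((L%:R^-1)%:E * \sum_l x l <= (L%:R^-1)%:E * \sum_l y l + (L%:R^-1 * \sum_l u l)%:E)%E.
Proof.
move=> xy; rewrite EFinM -sumEFin -muleDr//; last first.
  by rewrite sumEFin fin_num_adde_defl.
by apply: lee_wpmul2l; [rewrite lee_fin invr_ge0|rewrite -big_split; apply: lee_sum].
Qed.

Lemma C_pR_ge0 (R : realType) (d : nat) (D : divergence R d) (p : nat) (r : R) :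
  0 <= C_pR D p r.
Proof.
have li0 b K : 0 <= log_integral b K :> R.
  by apply: Rintegral_ge0 => t _; exact: sqrtr_ge0.
by rewrite /C_pR mulr_ge0 ?mulr_ge0 ?sqrtr_ge0//; case: D.
Qed.

Theorem corollary3p4 (R : realType) (d L N n p : nat)
    (hd : (1 <= d)%N) (hL : (1 <= L)%N) (hN : (1 <= N)%N) (hn : (1 <= n)%N)
    (hp : (1 <= p)%N)
    (r : R) (hr : 0 < r)
    (mu : 'I_L -> probability (euclidean R d) R)
    (hmu : forall l, mu l (eball r) = 1%E)
    (dO : measure_display) (Omega : measurableType dO) (P : probability Omega R)
    (X : 'I_L -> 'I_n -> {RV P >-> euclidean R d})
    (hXlaw : forall l i B, measurable B -> distribution P (X l i) B = mu l B)
    (hXind : forall l, mutually_independent (X l))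
    (A : set ('M[R]_(N, d) * 'rV[R]_N))
    (hAclosed : closed A) (hA0 : A !=set0) (hA : A `<=` parameter_set r)
    (D : divergence R d)
    (YPn : Omega -> 'M[R]_(N, d) * 'rV[R]_N)
    (hmin : forall w, minimizer A
      (fun a => barycenter_fun D p
                  (fun l => empirical (fun i => X l i w)) (atoms a))
      (YPn w)) :
  (\int[P]_w (barycenter_fun D p mu (atoms (YPn w))
              - ereal_inf [set barycenter_fun D p mu (atoms a) | a in A])
   <= (2 * C_pR D p r * Num.sqrt ((C_dN D N)%:R / n%:R))%:E)%E.
Proof.
set C := C_pR D p r * Num.sqrt ((C_dN D N)%:R / n%:R).
have -> : 2 * C_pR D p r * Num.sqrt ((C_dN D N)%:R / n%:R) = 2 * C by rewrite -mulrA.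
set opt := ereal_inf _; pose m w l := empirical (fun i => X l i w).
apply/lee_addgt0Pr => e e0; have e2 : 0 < e / 2 by rewrite divr_gt0.
have /fin_all_exists[U /fin_all_exists[V UV]] l :=
  divergence_gap (hn) (hXlaw l) (hXind l) (p := p) hN hd hp hr (hmu l) D e2.
pose u w := L%:R^-1 * \sum_l U l w; pose v w := L%:R^-1 * \sum_l V l w.
pose g w := u w + v w.
have L0 : 0 < L%:R :> R by rewrite ltr0n.
have avg (F : 'I_L -> Omega -> R) : (forall l, mean_bounded P (F l) (C + e / 2)) ->
    mean_bounded P (fun w => L%:R^-1 * \sum_l F l w) (C + e / 2).
  move=> mF; have bF l := (mF l).1; split.
    by apply: bmf_scale; exact: bmf_sum.
  rewrite bmf_intZ; last exact: bmf_sum.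
  rewrite bmf_int_sum// ler_pdivrMl//.
  apply: le_trans (ler_sum _ (fun l _ => (mF l).2)) _.
  by rewrite sumr_const card_ord mulr_natl.
(* One [C] is paid for replacing [mu] by the sample at the minimizer and one for returning to [mu]
   at a competitor. *)
have [bg mg] : mean_bounded P g (2 * C + e).
  have -> : 2 * C + e = (C + e / 2) + (C + e / 2) by field.
  by apply: mean_bounded_add; apply: avg => l; have [] := UV l.
(* The stability estimates require the empirical measures to be carried by the ball, an event of
   probability 1. *)
pose Omega0 : set Omega := [set w | forall li : 'I_L * 'I_n, eball r (X li.1 li.2 w)].
have mX l i : measurable (X l i @^-1` eball r).
  by rewrite -[_ @^-1` _]setTI; apply: measurable_funP => //; exact: measurable_eball.
have mO : measurable Omega0.
  rewrite (_ : Omega0 = \bigcap_(li in [set: 'I_L * 'I_n]) (X li.1 li.2 @^-1` eball r)).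
    by apply: fin_bigcap_measurable.
  by apply/seteqP; split => [w h li _|w h li]; [exact: h|exact: (h li I)].
have PO : P Omega0 = 1%E.
  have XP (li : 'I_L * 'I_n) : almost_everywhere P (X li.1 li.2 @^-1` eball r).
    have mXC := measurableC (mX li.1 li.2); apply/(negligibleP _ mXC).
    apply: etrans (probability_setC P (mX _ _)) _.
    have := hXlaw li.1 li.2 _ (measurable_eball r); rewrite hmu => XK.
    by rewrite [X in (1 - X)%E]XK subee.
  have /negligibleP : P.-negligible (~` Omega0).
    exact: (@filter_forall _ _ _ (almost_everywhere P) (ae_filter_ringOfSetsType P) XP).
  move=> /(_ (measurableC mO)) /(etrans (esym (probability_setC P mO)))/eqP.
  by rewrite sube_eq ?fin_num_measure// add0e => /eqP ->.
have gap w a : Omega0 w -> A a ->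
    (barycenter_fun D p mu (atoms a) <= barycenter_fun D p (m w) (atoms a) + (u w)%:E)%E /\
    (barycenter_fun D p (m w) (atoms a) <= barycenter_fun D p mu (atoms a) + (v w)%:E)%E.
  move=> Ow /hA aP; have Xr l i : eball r (X l i w) := Ow (l, i).
  have H l : _ := (let: And3 _ _ H := UV l in H) w a (Xr l) aP.
  by split; apply: average_le => l; have [] := H l.
have excess w a : Omega0 w -> A a ->
    (barycenter_fun D p mu (atoms (YPn w)) <= barycenter_fun D p mu (atoms a) + (g w)%:E)%E.
  move=> Ow Aa; have [AY minY] := hmin w.
  have [h1 _] := gap w _ Ow AY; have [_ h2] := gap w a Ow Aa.
  apply: le_trans h1 _; rewrite /g [u w + _]addrC EFinD addeA leeD2r//.
  exact: le_trans (minY _ Aa) h2.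
have excess_inf w : Omega0 w -> (barycenter_fun D p mu (atoms (YPn w)) <= opt + (g w)%:E)%E.
  move=> Ow; rewrite -leeBlDr//; apply: le_ereal_inf_tmp => _ [a Aa <-].
  by rewrite leeBlDr//; exact: excess.
have opt_le w : (opt <= barycenter_fun D p mu (atoms (YPn w)))%E.
  by apply: ereal_inf_lbound; exists (YPn w) => //; have [] := hmin w.
have [fin_opt|fin_opt] := boolP (opt \is a fin_num).
  apply: le_trans (_ : _ <= (\int[P]_w g w)%:E)%E _; last by rewrite -EFinD lee_fin.
  apply: (integral_le_on mO PO bg) => w Ow.
  have exc0 : (0 <= barycenter_fun D p mu (atoms (YPn w)) - opt)%E.
    by rewrite sube_ge0 ?fin_opt// opt_le.
  by rewrite max_l// leeBlDr// addeC; exact: excess_inf.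
(* An infinite optimum makes the excess risk [-oo]. *)
have C0 : 0 <= C by rewrite mulr_ge0 ?C_pR_ge0// sqrtr_ge0.
apply: (@le_trans _ _ (\int[P]_w (cst 0 w))%:E); last first.
  by rewrite bmf_int_cst -EFinD lee_fin addr_ge0 ?(ltW e0)// mulr_ge0.
apply: (@integral_le_on _ _ _ P _ _ (cst 0) mO PO) => [|w Ow]; first exact: bmf_cst.
rewrite [X in maxe X _](_ : _ = -oo%E) ?max_r//.
move: (excess_inf w Ow) fin_opt; case: (opt) => //= [_ _|]; first by rewrite addeNy.
by rewrite addNye leeNy_eq => /eqP ->.
Qed.
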